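(* A complex polynomial mapping $f:\mathbb{C}^n\to\mathbb{C}^p$ attains a Lipschitz trivial value if and only if there exist a dominant polynomial mapping $g:\mathbb{C}^p\to\mathbb{C}^p$ and a linear surjective projection $\pi:\mathbb{C}^n\to\mathbb{C}^p$ such that $$f=g\circ\pi.$$ In such a case $$\mathrm{L}(f)=\mathbb{C}^p\setminus\mathrm{Bif}(g).$$ In particular, the set of regular Lipschitz trivial values is either empty or the complement of an algebraic hypersurface.
   Context: A value $\mathbf{c}\in\mathbb{C}^p$ is a Lipschitz trivial value of a mapping $\varphi:\mathbb{C}^n\to\mathbb{C}^p$ if there exist a neighbourhood $\mathcal{V}$ of $\mathbf{c}$ in $\mathbb{C}^p$ and a bi-Lipschitz homeomorphism $H:\varphi^{-1}(\mathbf{c})\times\mathcal{V}\to\varphi^{-1}(\mathcal{V})$ with $(\varphi\circ H)(\mathbf{x},\mathbf{t})=\mathbf{t}$. Here subsets of Euclidean spaces carry the outer metric (the restriction of the ambient Euclidean distance) and products carry the product metric. The empty mapping is allowed, so every value outside the closure of the image of $\varphi$ is Lipschitz trivial. $\mathrm{L}(\varphi)$ denotes the set of Lipschitz trivial values of $\varphi$. The mapping $\varphi$ attains a Lipschitz trivial value if $\mathrm{L}(\varphi)$ contains a value lying in the image of $\varphi$. $\mathrm{Bif}(\varphi)$, the set of bifurcation values, is the complement of the set of values $\mathbf{c}$ at which $\varphi$ is $\mathcal{C}^\infty$ trivial, i.e. for which there exist a neighbourhood $\mathcal{V}$ of $\mathbf{c}$ and a $\mathcal{C}^\infty$ diffeomorphism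 $H:\varphi^{-1}(\mathbf{c})\times\mathcal{V}\to\varphi^{-1}(\mathcal{V})$ with $(\varphi\circ H)(\mathbf{x},\mathbf{t})=\mathbf{t}$ (empty mappings allowed). A value is regular if it is not a critical value, i.e. not the image of a critical point; values that are not in the image are therefore regular. A polynomial mapping is dominant if its image is Zariski dense in the target.
   Formalization: The last sentence is stated for f attaining a Lipschitz trivial value and, for every f, for the regular Lipschitz trivial values in the image of f; unrestricted it fails for the zero map to C^2. The empty set counts as a hypersurface. *)

(* Defs.v *)
From HB Require Import structures.
From mathcomp Require Import all_boot all_order all_algebra.
From mathcomp Require Import complex.
From mathcomp Require Import -(notations) mpoly.
From mathcomp Require Import all_classical all_reals all_analysis.
Set Implicit Arguments.
Unset Strict Implicit.
Unset Printing Implicit Defensive.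
Import Order.TTheory GRing.Theory Num.Theory.
Import numFieldNormedType.Exports.

Local Open Scope classical_set_scope.
Local Open Scope ring_scope.

(* C^n is 'rV[R[i]]_n, and A x B, for A in C^n and B in C^p, is a subset of
   C^(n + p), so that its product metric is the ambient Euclidean one. *)
Definition prod_set (R : realType) (n p : nat)
    (A : set 'rV[R[i]]_n) (B : set 'rV[R[i]]_p) : set 'rV[R[i]]_(n + p) :=
  [set z | exists x t, [/\ A x, B t & z = row_mx x t]].

Definition euclid_dist (R : realType) (n : nat) (x y : 'rV[R[i]]_n) : R :=
  Num.sqrt (\sum_(j < n) ComplexField.Normc.normc (x 0 j - y 0 j) ^+ 2).

Definition neighbourhood (R : realType) (p : nat) (c : 'rV[R[i]]_p)
    (V : set 'rV[R[i]]_p) : Prop :=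
  exists2 r : R, 0 < r & forall t, euclid_dist c t < r -> V t.

Definition lipschitz_on (R : realType) (n m : nat) (A : set 'rV[R[i]]_n)
    (h : 'rV[R[i]]_n -> 'rV[R[i]]_m) : Prop :=
  exists K : R, forall x y, A x -> A y ->
    euclid_dist (h x) (h y) <= K * euclid_dist x y.

Definition bilipschitz_homeo (R : realType) (n m : nat)
    (A : set 'rV[R[i]]_n) (B : set 'rV[R[i]]_m)
    (h : 'rV[R[i]]_n -> 'rV[R[i]]_m) : Prop :=
  set_bij A B h /\ lipschitz_on A h /\
  exists g : 'rV[R[i]]_m -> 'rV[R[i]]_n,
    {in A, cancel h g} /\ lipschitz_on B g.

(* Smoothness is real smoothness, read through C^n = R^(2n). *)
Definition realify (R : realType) (n : nat) (z : 'rV[R[i]]_n) :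
    'rV[R]_(n + n) :=
  row_mx (map_mx (@complex.Re R) z) (map_mx (@complex.Im R) z).

(* The partial derivatives of order at most k exist and are continuous on U;
   meant for U open. *)
Fixpoint Ck_on (R : realType) (n m k : nat) (U : set 'rV[R]_n)
    (f : 'rV[R]_n -> 'rV[R]_m) : Prop :=
  (forall x, U x -> {for x, continuous f}) /\
  (if k is k'.+1 then
     forall j : 'I_n, (forall x, U x -> derivable f x (delta_mx 0 j)) /\
                      Ck_on k' U ('D_(delta_mx 0 j) f)
   else True).

(* Smoothness on an arbitrary subset A: local extendability to smooth maps
   between open subsets of the ambient spaces. *)
Definition smooth_on (R : realType) (n m : nat) (A : set 'rV[R[i]]_n)
    (h : 'rV[R[i]]_n -> 'rV[R[i]]_m) : Prop :=
  forall a, A a ->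
    exists (U : set 'rV[R]_(n + n)) (F : 'rV[R]_(n + n) -> 'rV[R]_(m + m)),
      [/\ open U, U (realify a), forall k, Ck_on k U F &
          forall x, A x -> U (realify x) -> realify (h x) = F (realify x)].

Definition diffeomorphism (R : realType) (n m : nat)
    (A : set 'rV[R[i]]_n) (B : set 'rV[R[i]]_m)
    (h : 'rV[R[i]]_n -> 'rV[R[i]]_m) : Prop :=
  set_bij A B h /\ smooth_on A h /\
  exists g : 'rV[R[i]]_m -> 'rV[R[i]]_n,
    {in A, cancel h g} /\ smooth_on B g.

Definition trivialization (R : realType) (n p : nat)
    (phi : 'rV[R[i]]_n -> 'rV[R[i]]_p) (c : 'rV[R[i]]_p)
    (V : set 'rV[R[i]]_p) (H : 'rV[R[i]]_(n + p) -> 'rV[R[i]]_n) : Prop :=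
  forall x t, phi x = c -> V t -> phi (H (row_mx x t)) = t.

Definition lipschitz_trivial_values (R : realType) (n p : nat)
    (phi : 'rV[R[i]]_n -> 'rV[R[i]]_p) : set 'rV[R[i]]_p :=
  [set c | exists V H, [/\ neighbourhood c V,
     bilipschitz_homeo (prod_set (phi @^-1` [set c]) V) (phi @^-1` V) H &
     trivialization phi c V H]].

Definition attains_lipschitz_trivial_value (R : realType) (n p : nat)
    (phi : 'rV[R[i]]_n -> 'rV[R[i]]_p) : Prop :=
  exists2 c, lipschitz_trivial_values phi c & range phi c.

Definition smooth_trivial_values (R : realType) (n p : nat)
    (phi : 'rV[R[i]]_n -> 'rV[R[i]]_p) : set 'rV[R[i]]_p :=
  [set c | exists V H, [/\ neighbourhood c V,
     diffeomorphism (prod_set (phi @^-1` [set c]) V) (phi @^-1` V) H &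
     trivialization phi c V H]].

Definition Bif (R : realType) (n p : nat)
    (phi : 'rV[R[i]]_n -> 'rV[R[i]]_p) : set 'rV[R[i]]_p :=
  ~` smooth_trivial_values phi.

Definition mpoly_at (R : realType) (n : nat) (q : mpoly.mpoly n R[i])
    (x : 'rV[R[i]]_n) : R[i] :=
  mpoly.meval (fun j => x 0 j) q.

Definition polymap (R : realType) (n p : nat)
    (f : 'I_p -> mpoly.mpoly n R[i]) (x : 'rV[R[i]]_n) : 'rV[R[i]]_p :=
  \row_(i < p) mpoly_at (f i) x.

Definition zariski_closure (R : realType) (p : nat) (A : set 'rV[R[i]]_p) :
    set 'rV[R[i]]_p :=
  [set c | forall q : mpoly.mpoly p R[i],
     (forall a, A a -> mpoly_at q a = 0) -> mpoly_at q c = 0].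

Definition dominant (R : realType) (n p : nat)
    (f : 'I_p -> mpoly.mpoly n R[i]) : Prop :=
  zariski_closure (range (polymap f)) = setT.

Definition jacobian_mx (R : realType) (n p : nat)
    (f : 'I_p -> mpoly.mpoly n R[i]) (x : 'rV[R[i]]_n) : 'M[R[i]]_(p, n) :=
  \matrix_(i < p, j < n) mpoly_at (mpoly.mderiv j (f i)) x.

Definition critical_points (R : realType) (n p : nat)
    (f : 'I_p -> mpoly.mpoly n R[i]) : set 'rV[R[i]]_n :=
  [set x | (\rank (jacobian_mx f x) < p)%N].

Definition regular_values (R : realType) (n p : nat)
    (f : 'I_p -> mpoly.mpoly n R[i]) : set 'rV[R[i]]_p :=
  ~` (polymap f @` critical_points f).

(* The zero set of a nonzero polynomial; a nonzero constant is allowed, so the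
   empty set is a hypersurface (for g the identity, Bif g is empty). *)
Definition algebraic_hypersurface (R : realType) (p : nat)
    (S : set 'rV[R[i]]_p) : Prop :=
  exists2 q : mpoly.mpoly p R[i], q != 0 & S = [set c | mpoly_at q c = 0].

Definition empty_or_hypersurface_complement (R : realType) (p : nat)
    (A : set 'rV[R[i]]_p) : Prop :=
  A = set0 \/ exists2 S, algebraic_hypersurface S & A = ~` S.

(* Main.v *)
Require Import Defs.
From HB Require Import structures.
From mathcomp Require Import all_boot all_order all_algebra.
From mathcomp Require Import complex.
From mathcomp Require Import -(notations) mpoly.
From mathcomp Require Import all_classical all_reals all_analysis.
From mathcomp Require Import ring lra zify.
Set Implicit Arguments.
Unset Strict Implicit.
Unset Printing Implicit Defensive.
Import Order.TTheory GRing.Theory Num.Theory.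
Import numFieldNormedType.Exports.
Local Open Scope ring_scope.

(** Call a value c good for g : C^p -> C^p when g is proper over a neighbourhood of
    c and has no critical point over c. When f is g o pi with g dominant, the good
    values of g turn out to be both the Lipschitz trivial values of f and the smooth
    trivial values of g, and to form the complement of a hypersurface.

    Good values are trivial. By the inverse function theorem and properness, the
    preimage under g of a small ball around a good value is cut into finitely many
    sheets, each in bi-Lipschitz bijection with the ball ([sheets_exist]). Moving
    points along the sheets trivializes g, and moving them along a complement of
    the kernel of pi, as their images move in the sheets, trivializes f
    ([sheets_lipschitz_trivial]). The trivialization of g is smooth because the
    partial derivatives of a section of g, and of the reciprocal of the Jacobian
    determinant along it, are polynomials in these same functions
    ([pfaffian_smooth], [sheets_smooth_trivial]).

    Trivial values are good. A trivialization realizes every small displacement of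
    the value by a displacement of the point of comparable size, which makes the
    differential surjective ([linearly_open_injective]). It also brings the points
    over a ball to the central fibre by a bounded displacement, and for g this fibre
    is finite, since generic fibres have boundedly many points and noncritical
    points persist in them ([fibre_finite]); so the preimage of the ball is bounded.

    The good values form the complement of a hypersurface. Since g is dominant,
    every polynomial phi is algebraic over the components of g; take a relation of
    least degree whose coefficients have no common factor. If phi is bounded on the
    fibres near c, so are the roots of the relation at nearby values, hence the
    ratios of its coefficients to the leading one. A zero of the leading coefficient
    at c would then be a zero of a prime on whose zeros near c all coefficients
    vanish, and by a local Nullstellensatz ([prime_divides]) this prime would divide
    all of them. With the coordinates and the Jacobian determinant as phi this
    yields the equation ([good_values_hypersurface]).

    An attained Lipschitz trivial value c forces a factorization. The trivialization
    bounds the first derivatives of f over a ball around c. By Chevalley's theorem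
    ([image_contains_open_of_closure]) a derivative that is algebraically
    independent of f would be unbounded there; so it is algebraic over f and its
    gradient lies in the span of the gradients of f ([gradient_in_span]). Hence on
    each line the derivatives of f in a fixed direction solve a homogeneous linear
    differential system, a direction in the kernel of one generic differential is in
    the kernel of every differential ([kernel_constant]), and f factors through the
    quotient by this kernel. *)

(** * Multivariate polynomials as univariate ones over fewer variables *)

Section MuniEval.
Variables (K : comNzRingType) (B : comNzRingType) (f : {rmorphism K -> B}).

(** Variables are indexed by natural numbers here so that the last one can be split
    off without casts. *)
Lemma mmap_muni m (y : nat -> B) (q : mpoly m.+1 K) :
  mmap f (fun i : 'I_m.+1 => y i) q =
  (map_poly (mmap f (fun i : 'I_m => y i)) (muni q)).[y m].
Proof.
rewrite muniE rmorph_sum horner_sum /mmap; apply: eq_bigr => u _.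
rewrite -!mul_polyC !rmorphM /= map_polyC map_polyXn !hornerE /=.
rewrite mmapZ mmapX /mmap1 -mulrA big_ord_recr /=; congr (_ * (_ * _)).
by apply: eq_bigr => i _; rewrite mnmE.
Qed.
End MuniEval.

Section MuniIso.
Variables (K : comNzRingType) (m : nat).

(** Substituting the variables back into the univariate form recovers the
    polynomial. *)
Lemma muni_inj : injective (@muni m K).
Proof.
move=> p q; pose y i : mpoly m.+1 K := if insub i is Some j then mpolyX _ (mnm1 j) else 0.
have E r : r = (map_poly (mmap (@mpolyC m.+1 K) (fun i : 'I_m => y i)) (muni r)).[y m].
  rewrite -mmap_muni -{1}[r]comp_mpoly_id /comp_mpoly /mmap.
  apply: eq_bigr => u _; congr (_ * _); apply: mmap1_eq => i.
  by rewrite tnth_mktuple /y valK.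
by move=> e; rewrite (E p) e -E.
Qed.
End MuniIso.

Section MuniSurj.
Variables (K : comNzRingType) (m : nat).

Lemma muni_monomial (u : multinom m.+1) :
  muni (mpolyX K u) =
  mpolyX K (Multinom [tuple u (widen_ord (leqnSn m) i) | i < m]) *: 'X^(u ord_max).
Proof. by rewrite muniE msuppX big_seq1 mcoeffX eqxx scale1r. Qed.

Lemma muni_widen (p : mpoly.mpoly m K) : muni (mwiden p) = p%:P.
Proof.
rewrite (mwidenE (leqnn _)) [p in RHS](mpolywE (leqnn (msize p))) !raddf_sum /=.
apply: eq_bigr => u _.
rewrite muniZ muni_monomial mnmwiden_ordmax expr0.
rewrite -!mul_polyC mulr1 -polyCM mul_mpolyC; congr ((_ *: mpolyX _ _)%:P).
by apply/mnmP => i; rewrite mnmE mnmwiden_widen.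
Qed.

Lemma muni_surj (u : {poly mpoly.mpoly m K}) : exists q, muni q = u.
Proof.
exists (mmulti u); rewrite /mmulti rmorph_sum /= -[RHS]coefK poly_def.
apply: eq_bigr => i _; rewrite rmorphM rmorphXn /= muni_widen -mul_polyC.
congr (_ * _ ^+ _); rewrite muni_monomial mnm1E eqxx expr1.
have -> : Multinom [tuple mnm1 (@ord_max m) (widen_ord (leqnSn m) j) | j < m] = mnm0.
  apply/mnmP => j; rewrite !mnmE -val_eqE /= gtn_eqF //.
by rewrite mpolyX0 scale1r.
Qed.
End MuniSurj.

(** * Chevalley's theorem *)

Section PseudoDivision.
Variable S : idomainType.
Implicit Types p q : {poly S}.

Lemma pseudo_division p q : q != 0 ->
  exists k w r, lead_coef q ^+ k *: p = w * q + r /\ (size r < size q)%N.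
Proof.
move=> q0; exists (scalp p q), (p %/ q), (p %% q); split.
  exact: Pdiv.WeakIdomain.divp_eq.
by rewrite ltn_modp.
Qed.
End PseudoDivision.

Section ExtensionStep.
Variables (S B : idomainType) (K : closedFieldType).
Variables (e : {rmorphism S -> B}) (x : B).
Local Notation ev U := (map_poly e U).[x].

(** Modulo the kernel of e, coefficients killed by e can be dropped from the top. *)
Lemma truncate_mod_ker (A : {poly S}) : map_poly e A != 0 ->
  exists A', [/\ map_poly e A' = map_poly e A, size A' = size (map_poly e A)
               & e (lead_coef A') != 0].
Proof.
move=> A0; exists (take_poly (size (map_poly e A)) A).
have E : map_poly e (take_poly (size (map_poly e A)) A) = map_poly e A.
  apply/polyP => i; rewrite coef_map coef_take_poly /=.
  case: ltnP => [_|h]; first by rewrite coef_map.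
  by rewrite rmorph0 nth_default.
have sE : size (take_poly (size (map_poly e A)) A) = size (map_poly e A).
  apply/eqP; rewrite eqn_leq size_take_poly /= -{1}E.
  exact: size_poly.
split=> //.
rewrite lead_coefE sE -coef_map E -lead_coefE lead_coef_eq0 //.
Qed.

(** One generator at a time: a point of the closed image of a partial
    parametrization lifts through an extra generator x as soon as it avoids one
    hypersurface. When x is transcendental almost any value will do; otherwise the
    value is a root of a relation of least degree, and pseudo-division by that
    relation shows that every other relation vanishes there too. *)
Lemma extension_step (b : {poly S}) : ev b != 0 ->
  exists2 s, e s != 0 & forall sg : {rmorphism S -> K},
    (forall a, e a = 0 -> sg a = 0) -> sg s != 0 ->
    exists2 z : K, (forall U, ev U = 0 -> (map_poly sg U).[z] = 0) &
                   (map_poly sg b).[z] != 0.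
Proof.
move=> b0.
have bne : map_poly e b != 0 by apply: contraNneq b0 => ->; rewrite horner0.
have rest (A : {poly S}) : map_poly e A = 0 -> forall sg : {rmorphism S -> K},
    (forall a, e a = 0 -> sg a = 0) -> map_poly sg A = 0.
  move=> h sg hs; apply/polyP => i; rewrite coef_map coef0 /=; apply: hs.
  by have := congr1 (fun u : {poly B} => u`_i) h; rewrite coef_map coef0.
(* Either x satisfies a relation that e does not kill, and A has least degree, *)
(* or x is transcendental over the image of e. *)
have [[A [A0 evA minA]]|noA] := pselect (exists A : {poly S},
    [/\ map_poly e A != 0, ev A = 0 & forall A', map_poly e A' != 0 -> ev A' = 0 ->
     (size (map_poly e A) <= size (map_poly e A'))%N]).
  have [A1 [eA1 sA1 lA1]] := truncate_mod_ker A0.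
  (* An element E of least degree in the ideal of A1 and b: were it of positive *)
  (* degree, it would split a relation of smaller degree off A1. *)
  pose W (E : {poly S}) := exists u v, map_poly e E = map_poly e (u * A1 + v * b).
  have [E [WE E0 minE]] : exists E : {poly S}, [/\ W E, map_poly e E != 0 &
      forall E', W E' -> map_poly e E' != 0 ->
      (size (map_poly e E) <= size (map_poly e E'))%N].
    have : exists k, `[< exists E : {poly S}, [/\ W E, map_poly e E != 0 &
                size (map_poly e E) = k] >].
      exists (size (map_poly e b)); apply/asboolP; exists b; split=> //.
      by exists 0, 1; rewrite mul0r mul1r add0r.
    move=> /ex_minnP[k /asboolP[E [WE E0 <-]] mk].
    exists E; split=> // E' WE' E'0; apply: mk; apply/asboolP; by exists E'.
  have [E1 [eE1 sE1 lE1]] := truncate_mod_ker E0.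
  have E1n0 : E1 != 0 by apply: contraNneq lE1 => ->; rewrite lead_coef0 rmorph0.
  have A1n0 : A1 != 0 by apply: contraNneq lA1 => ->; rewrite lead_coef0 rmorph0.
  have [u [v euv]] := WE.
  have WP p : W p -> exists k w, lead_coef E1 ^+ k *: p = w * E1 +
     (lead_coef E1 ^+ k *: p - w * E1) /\
     map_poly e (lead_coef E1 ^+ k *: p - w * E1) = 0.
    move=> [u' [v' Wp]]; have [k [w [r [er sr]]]] := pseudo_division p E1n0.
    exists k, w; split; first by rewrite addrC subrK.
    have -> : lead_coef E1 ^+ k *: p - w * E1 = r by rewrite er addrC addKr.
    apply/eqP/negPn/negP => r0.
    have : W r.
      exists (lead_coef E1 ^+ k *: u' - w * u), (lead_coef E1 ^+ k *: v' - w * v).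
      have -> : r = lead_coef E1 ^+ k *: p - w * E1 by rewrite er addrC addKr.
      rewrite rmorphB rmorphM /= eE1 euv -mul_polyC rmorphM /= Wp -!rmorphM -rmorphB /=.
      by congr map_poly; rewrite -!mul_polyC; ring.
    move=> /minE /(_ r0); rewrite -sE1; apply/negP; rewrite -ltnNge.
    by apply: leq_ltn_trans sr; rewrite size_poly.
  have Wb : W b by exists 0, 1; rewrite mul0r mul1r add0r.
  have WA : W A1 by exists 1, 0; rewrite mul1r mul0r addr0.
  have [k [w [_ /eqP]]] := WP _ WA; have [k' [w' [_ /eqP]]] := WP _ Wb.
  rewrite !rmorphB !subr_eq0 -!mul_polyC !rmorphM /= !map_polyC /=.
  move=> /eqP eb /eqP eA.
  have sE : size E1 = 1%N.
    have evE : ev E1 != 0.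
      apply: contraNneq b0 => h.
      have /(congr1 (fun t => t.[x])) := eb; rewrite !hornerM h mulr0 hornerC => /eqP.
      by rewrite mulf_eq0 rmorphXn expf_eq0 (negPf lE1) andbF.
    have evw : ev w = 0.
      have /(congr1 (fun t => t.[x])) := eA; rewrite !hornerM eA1 evA mulr0.
      by move/esym/eqP; rewrite mulf_eq0 (negPf evE) orbF => /eqP.
    have w0 : map_poly e w != 0.
      apply/negP => /eqP h; move: eA; rewrite h mul0r => /eqP.
      by rewrite mulf_eq0 polyC_eq0 rmorphXn expf_eq0 (negPf lE1) andbF eA1 (negPf A0).
    have := minA _ w0 evw.
    have /(congr1 (fun t : {poly B} => size t)) /= := eA.
    rewrite size_Cmul; last by rewrite rmorphXn expf_neq0.
    rewrite eA1 => ->; rewrite eE1 size_mul // -sE1.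
    have : (0 < size E1)%N by rewrite size_poly_gt0.
    have : (0 < size (map_poly e w))%N by rewrite size_poly_gt0.
    move: (size E1) (size _) => a c; lia.
  exists (lead_coef A1 * lead_coef E1); first by rewrite rmorphM mulf_neq0.
  move=> sg hs; rewrite rmorphM mulf_eq0 negb_or => /andP[sA sE0].
  have lA : sg (lead_coef A1) != 0 by [].
  have [z rz] : exists z, root (map_poly sg A1) z.
    apply/closed_rootP; rewrite size_map_poly_id0 //; apply/negP => /eqP sz.
    have cA := size1_polyC (eq_leq sz); move: evA lA1.
    by rewrite -eA1 cA map_polyC hornerC lead_coefC => ->; rewrite eqxx.
  have hs' p : map_poly e p = 0 -> map_poly sg p = 0 by move/rest; apply.
  exists z => [U evU|].
    have [k1 [w1 [r1 [er1 sr1]]]] := pseudo_division U A1n0.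
    have r10 : map_poly e r1 = 0.
      apply/eqP/negPn/negP => r0.
      have : ev r1 = 0.
        have -> : r1 = lead_coef A1 ^+ k1 *: U - w1 * A1 by rewrite er1 addrC addKr.
        rewrite rmorphB -mul_polyC !rmorphM /= hornerD hornerN !hornerM eA1 evA evU.
        by rewrite !mulr0 subrr.
      move=> /(minA _ r0); rewrite -sA1; apply/negP; rewrite -ltnNge.
      by apply: leq_ltn_trans sr1; rewrite size_poly.
    have /(congr1 (fun t => (map_poly sg t).[z])) := er1.
    rewrite -mul_polyC rmorphD !rmorphM /= map_polyC /= hornerD !hornerM hornerC.
    rewrite (eqP rz) mulr0 (hs' _ r10) horner0 addr0 => /eqP.
    by rewrite mulf_eq0 rmorphXn expf_eq0 (negPf lA) andbF => /eqP.
  have : map_poly sg (E1 - (u * A1 + v * b)) = 0.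
    by apply: hs'; rewrite rmorphB /= eE1 euv subrr.
  move=> /(congr1 (fun t => t.[z])); rewrite !rmorphB rmorphD !rmorphM /=.
  rewrite hornerD hornerN hornerD !hornerM (eqP rz) mulr0 add0r horner0 => /eqP.
  apply: contraTneq => ->; rewrite mulr0 subr0.
  rewrite (size1_polyC (eq_leq sE)) map_polyC hornerC /=.
  by move: sE0; rewrite lead_coefE sE.
have [b1 [eb1 sb1 lb1]] := truncate_mod_ker bne.
have evU0 U : ev U = 0 -> map_poly e U = 0.
  move=> U0; apply/eqP/negPn/negP => Une; apply: noA.
  have : exists k, `[< exists A : {poly S}, [/\ map_poly e A != 0, ev A = 0 &
                size (map_poly e A) = k] >].
    by exists (size (map_poly e U)); apply/asboolP; exists U.
  move=> /ex_minnP[k /asboolP[A [A0 evA <-]] mk].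
  exists A; split=> // A' A'0 evA'; apply: mk; apply/asboolP; by exists A'.
exists (lead_coef b1) => // sg hs sb.
have hs' p : map_poly e p = 0 -> map_poly sg p = 0 by move/rest; apply.
have bs0 : map_poly sg b1 != 0.
  by rewrite -lead_coef_eq0 lead_coef_map_id0 ?rmorph0.
have /closed_nonrootP[z bz] := bs0.
exists z => [U /evU0 /hs' ->|]; first by rewrite horner0.
suff -> : map_poly sg b = map_poly sg b1 by [].
have : map_poly sg (b - b1) = 0 by apply: hs'; rewrite rmorphB /= eb1 subrr.
by move/eqP; rewrite rmorphB subr_eq0 => /eqP.
Qed.
End ExtensionStep.

Section Chevalley.
Variables (K : closedFieldType) (B : idomainType) (f : {rmorphism K -> B}).
Local Notation P m := (mpoly.mpoly m K).

(** The Zariski closure of the image of the first m entries of y. *)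
Definition on_closure (y : nat -> B) m (z : nat -> K) : Prop :=
  forall U : P m, mmap f (fun i : 'I_m => y i) U = 0 -> meval (fun i : 'I_m => z i) U = 0.

(** The d extra generators are added one by one, and the inequation to be preserved
    is traded at each step for one on fewer generators. *)
Lemma lift_to_closure (y : nat -> B) m d (Q : P (d + m)) :
  mmap f (fun i : 'I_(d + m) => y i) Q != 0 ->
  exists2 Q' : P m, mmap f (fun i : 'I_m => y i) Q' != 0 &
    forall z, on_closure y m z -> meval (fun i : 'I_m => z i) Q' != 0 ->
    exists w : nat -> K, [/\ forall i : 'I_m, w i = z i, on_closure y (d + m) w &
                  meval (fun i : 'I_(d + m) => w i) Q != 0].
Proof.
elim: d Q => [|d IHd] Q Q0; first by exists Q => // z hz Qz; exists z.
move: (Q0); rewrite mmap_muni => Q0'.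
have [s s0 hs] := extension_step K Q0'.
have [Q' Q'0 hQ'] := IHd s s0.
exists Q' => // z hz Qz; have [w [wz hw sw]] := hQ' z hz Qz.
have [t tU tb] := hs (meval (fun i : 'I_(d + m) => w i)) hw sw.
pose w' i := if (i < d + m)%N then w i else t.
have w'E : map_poly (meval (fun i : 'I_(d + m) => w' i)) =1
           map_poly (meval (fun i : 'I_(d + m) => w i)).
  move=> p; apply: eq_map_poly => q; apply: meval_eq => i.
  by rewrite /w' ltn_ord.
have w't : w' (d + m)%N = t by rewrite /w' ltnn.
exists w'; split.
- by move=> i; rewrite /w' -wz (leq_trans (ltn_ord i)) // leq_addl.
- move=> U; rewrite mmap_muni => /tU; rewrite /meval (mmap_muni idfun w').
  by rewrite w'E w't.
- by rewrite /meval (mmap_muni idfun w') w'E w't.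
Qed.
End Chevalley.

Section ChevalleyImage.
Variables (K : closedFieldType).
Local Notation P m := (mpoly.mpoly m K).

(** Chevalley's theorem in the form used here: the image of a polynomial map
    contains every point of its Zariski closure off some hypersurface that does
    not contain the image. The graph of F is lifted to one coordinate of the
    source at a time. *)
Theorem image_contains_open_of_closure m n (F : 'I_m -> P n) :
  exists2 Q : P m, mmap (@mpolyC n K) F Q != 0 &
    forall z : 'I_m -> K,
      (forall U : P m, mmap (@mpolyC n K) F U = 0 -> meval z U = 0) ->
      meval z Q != 0 -> exists x : 'I_n -> K, forall i, meval x (F i) = z i.
Proof.
pose y i : P n := if insub i is Some j then F j else
                  if insub (i - m)%N is Some j then mpolyX _ (mnm1 j) else 0.
have yF (i : 'I_m) : y i = F i by rewrite /y valK.
have mF U : mmap (@mpolyC n K) F U = mmap (@mpolyC n K) (fun i : 'I_m => y i) U.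
  by apply: eq_bigr => u _; congr (_ * _); apply: mmap1_eq => i.
have one0 : mmap (@mpolyC n K) (fun i : 'I_(n + m) => y i) 1 != 0.
  by rewrite rmorph1 oner_neq0.
have [Q Q0 hQ] := lift_to_closure one0.
exists Q => [|z hz Qz]; first by rewrite mF.
pose z' i := if insub i is Some j then z j else 0.
have z'E (i : 'I_m) : z' i = z i by rewrite /z' valK.
have mz U : meval (fun i : 'I_m => z' i) U = meval z U by apply: meval_eq => i.
have hz' : on_closure (@mpolyC n K) y m z' by move=> U; rewrite -mF mz => /hz.
have [|w [wz hw _]] := hQ z' hz'; first by rewrite mz.
have ltx (j : 'I_n) : (m + j < n + m)%N by rewrite addnC ltn_add2r.
have ltF (i : 'I_m) : (i < n + m)%N by rewrite (leq_trans (ltn_ord i)) ?leq_addl.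
have yx (j : 'I_n) : y (m + j)%N = mpolyX _ (mnm1 j).
  rewrite /y insubN ?addKn ?valK // -leqNgt leq_addr //.
(* The relation that writes the i-th component of F in terms of the coordinates *)
(* also holds at the lifted point. *)
exists (fun j => w (m + j)%N) => i; rewrite -z'E -wz.
pose U : P (n + m) := comp_mpoly [tuple mpolyX _ (mnm1 (Ordinal (ltx j))) | j < n] (F i)
          - mpolyX _ (mnm1 (Ordinal (ltF i))).
have : mmap (@mpolyC n K) (fun i : 'I_(n + m) => y i) U = 0.
  rewrite rmorphB /= mmapX mmap1U /= yF; apply/eqP; rewrite subr_eq0; apply/eqP.
  rewrite comp_mpolyE rmorph_sum /= [RHS]mpolyE; apply: eq_bigr => u _.
  rewrite mmapZ -mul_mpolyC mpolyXE_id; congr (_ * _).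
  rewrite rmorph_prod; apply: eq_bigr => j _ /=.
  by rewrite rmorphXn /= tnth_mktuple mmapX mmap1U /= yx.
move=> /hw; rewrite /U mevalB mevalXU comp_mpoly_meval => /eqP.
rewrite subr_eq0 => /eqP <-; apply: meval_eq => j.
by rewrite tnth_mktuple mevalXU.
Qed.
End ChevalleyImage.

(** * Algebraic dependence *)

Section Dependence.
Variables (K : fieldType).
Local Notation P m := (mpoly.mpoly m K).

Lemma msize_mul_le n (p q : P n) a b :
  (msize p <= a.+1)%N -> (msize q <= b.+1)%N -> (msize (p * q) <= (a + b).+1)%N.
Proof.
have [->|p0] := eqVneq p 0; first by rewrite mul0r msize0.
have [->|q0] := eqVneq q 0; first by rewrite mulr0 msize0.
rewrite msizeM //; move: (mmeasure _ p) (mmeasure _ q) => x y; lia.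
Qed.

Lemma msize_prod_le n (I : finType) (F : I -> P n) (d : I -> nat) :
  (forall i, msize (F i) <= (d i).+1)%N ->
  (msize (\prod_i F i) <= (\sum_i d i).+1)%N.
Proof.
move=> hF; elim/big_rec2: _ => [|i s p _ h]; first by rewrite msize1.
exact: msize_mul_le.
Qed.

Lemma msize_exp_le n (p : P n) d k : (msize p <= d.+1)%N ->
  (msize (p ^+ k) <= (k * d).+1)%N.
Proof.
move=> hp; elim: k => [|k IH]; first by rewrite expr0 msize1.
by rewrite exprS mulSn; apply: msize_mul_le.
Qed.

(** Counting: the monomials with exponents below k in n+1 letters outnumber the
    monomials in n letters that can occur in their images, because the exponents
    of the latter are bounded linearly in k; so some combination vanishes. *)
Theorem algebraically_dependent n (F : 'I_n.+1 -> P n) :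
  exists2 A : P n.+1, A != 0 & mmap (@mpolyC n K) F A = 0.
Proof.
pose D := \max_i msize (F i).
have hD i : (msize (F i) <= D.+1)%N by rewrite leqW // /D (leq_bigmax i).
pose E := (n.+1 * D + 1)%N; pose k := (E ^ n + 1)%N; pose N := (n.+1 * k * D + 1)%N.
pose I := {ffun 'I_n.+1 -> 'I_k}; pose J := {ffun 'I_n -> 'I_N}.
pose mI (u : I) : multinom n.+1 := Multinom [tuple (u i : nat) | i < n.+1].
pose mJ (u : J) : multinom n := Multinom [tuple (u i : nat) | i < n].
pose Fu (u : I) : P n := \prod_i F i ^+ u i.
pose M : 'M[K]_(#|I|, #|J|) := \matrix_(a, b) mcoeff (mJ (enum_val b)) (Fu (enum_val a)).
have ltIJ : (#|J| < #|I|)%N.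
  rewrite !card_ffun !card_ord.
  have leN : (N <= k * E)%N by rewrite /N /E /k; nia.
  apply: (@leq_ltn_trans ((k * E) ^ n)%N); first by case: (n) => // n'; rewrite leq_exp2r.
  by rewrite expnMn expnS mulnC ltn_pmul2r ?expn_gt0 /k ?addn1.
have [a a0 aM] : exists2 a : 'rV[K]_#|I|, a != 0 & a *m M = 0.
  have : kermx M != 0.
    rewrite -mxrank_eq0 mxrank_ker subn_eq0 -ltnNge.
    by apply: leq_ltn_trans ltIJ; rewrite rank_leq_col.
  by move=> /rowV0Pn[a /sub_kermxP aM a0]; exists a.
pose A : P n.+1 := \sum_j a 0 j *: mpolyX K (mI (enum_val j)).
exists A.
  have [j aj] : exists j, a 0 j != 0.
    by move/rV0Pn: a0.
  apply: contraNneq aj => /(congr1 (mcoeff (mI (enum_val j)))).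
  rewrite mcoeff0 raddf_sum /= (bigD1 j) //= mcoeffZ mcoeffX eqxx mulr1 big1 ?addr0 ?eqxx //.
    by move=> ->.
  move=> i ij; rewrite mcoeffZ mcoeffX; case: eqP => [e|_]; last by rewrite mulr0.
  case/eqP: ij; apply: enum_val_inj; apply/ffunP => l; apply/val_inj.
  by have := congr1 (fun t : multinom n.+1 => t l) e; rewrite !mnmE.
have hFu u m : mcoeff m (Fu u) != 0 -> forall i, (m i < N)%N.
  move=> h i; have mI' : m \in msupp (Fu u) by rewrite mcoeff_msupp.
  have := msize_mdeg_lt mI'.
  have hs : (msize (Fu u) <= (\sum_(i < n.+1) (u i * D)).+1)%N.
    by apply: msize_prod_le => l; apply: msize_exp_le.
  have hs' : (\sum_(i < n.+1) (u i * D) <= n.+1 * (k * D))%N.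
    rewrite -[X in (_ <= X * _)%N]card_ord -sum_nat_const; apply: leq_sum => l _.
    by rewrite leq_mul2r ltnW ?orbT.
  have hm : (m i <= mdeg m)%N by rewrite mdegE (bigD1 i) //= leq_addr.
  by rewrite /N; lia.
rewrite raddf_sum /=; apply/mpolyP => m; rewrite mcoeff0 raddf_sum /=.
have E1 j : mcoeff m (mmap (@mpolyC n K) F (a 0 j *: mpolyX K (mI (enum_val j)))) =
            a 0 j * mcoeff m (Fu (enum_val j)).
  rewrite mmapZ mmapX mcoeffCM; congr (_ * mcoeff m _).
  by apply: eq_bigr => i _; rewrite mnmE.
rewrite (eq_bigr _ (fun j _ => E1 j)).
have [hm|/existsNP[i /negP]] := pselect (forall i, (m i < N)%N).
  pose v : J := [ffun i => Ordinal (hm i)].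
  have := congr1 (fun t : 'rV_#|J| => t 0 (enum_rank v)) aM; rewrite !mxE => {2}<-.
  apply: eq_bigr => j _; rewrite mxE enum_rankK; congr (_ * mcoeff _ _).
  by apply/mnmP => i; rewrite mnmE ffunE.
move=> hi; rewrite big1 // => j _.
have [->|/hFu /(_ i) h] := eqVneq (mcoeff m (Fu (enum_val j))) 0; first by rewrite mulr0.
by rewrite h in hi.
Qed.
End Dependence.

(** * Factoriality of polynomial rings *)

Section Factorial.

Definition divides (D : comNzRingType) (a b : D) := exists c, b = c * a.

Definition prime_element (D : comUnitRingType) (q : D) :=
  [/\ q != 0, q \isn't a GRing.unit &
      forall a b, divides q (a * b) -> divides q a \/ divides q b].

Definition factorial_domain (D : comUnitRingType) :=
  forall a : D, a != 0 -> exists u l,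
    [/\ u \is a GRing.unit, forall q, q \in l -> prime_element q &
        a = u * \prod_(q <- l) q].

Definition primitive (D : comUnitRingType) (h : {poly D}) :=
  forall q, prime_element q -> ~ (forall i, divides q h`_i).

Lemma dividesP_polyC (D : idomainType) (q : D) (h : {poly D}) :
  divides q%:P h <-> forall i, divides q h`_i.
Proof.
split=> [[c ->] i|H]; first by exists c`_i; rewrite coefMC.
have [g hg] := choice H.
exists (\poly_(i < size h) g i); apply/polyP => i.
rewrite coefMC coef_poly; case: ltnP => [_|sh]; first exact: hg.
by rewrite mul0r nth_default.
Qed.

Lemma divides_mulr (D : comNzRingType) (q a b : D) : divides q a -> divides q (a * b).
Proof. by case=> c ->; exists (b * c); ring. Qed.

Lemma divides_add (D : comNzRingType) (q a b : D) :
  divides q a -> divides q b -> divides q (a + b).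
Proof. by move=> [c ->] [d ->]; exists (c + d); ring. Qed.

Lemma divides_addl (D : comNzRingType) (q a b : D) :
  divides q (a + b) -> divides q b -> divides q a.
Proof. by move=> [c e] [d eb]; exists (c - d); rewrite mulrBl -e -eb addrK. Qed.

Lemma divides_sum (D : comNzRingType) (q : D) (I : finType) (P : pred I) (F : I -> D) :
  (forall i, P i -> divides q (F i)) -> divides q (\sum_(i | P i) F i).
Proof.
move=> h; elim/big_ind: _ => // [|a b]; first by exists 0; rewrite mul0r.
exact: divides_add.
Qed.

(** In a product of two polynomials not divisible by q, look at the product of the
    first coefficients not divisible by q. *)
Lemma prime_polyC (D : idomainType) (q : D) : prime_element q -> prime_element q%:P.
Proof.
case=> q0 qu qp; split; first by rewrite polyC_eq0.
  by rewrite poly_unitE size_polyC q0 coefC.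
move=> a b /dividesP_polyC h.
have [//|na] := pselect (divides q%:P a); first by left.
have [//|nb] := pselect (divides q%:P b); first by right.
have mn (f : {poly D}) : ~ divides q%:P f -> exists i, ~ divides q f`_i /\
      forall j, (j < i)%N -> divides q f`_j.
  move=> nf; have : exists i, `[< ~ divides q f`_i >].
    have [//|h'] := pselect (exists i, `[< ~ divides q f`_i >]).
    exfalso; apply: nf; apply/dividesP_polyC => i.
    by apply: contrapT => ni; apply: h'; exists i; apply/asboolP.
  move=> /ex_minnP[i /asboolP hi mi]; exists i; split=> // j ji.
  by apply: contrapT => nj; have := mi j (introT (asboolP _) nj); rewrite leqNgt ji.
have [i [hi mi]] := mn _ na; have [j [hj mj]] := mn _ nb.
have lti : (i < (i + j).+1)%N by rewrite ltnS leq_addr.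
have := h (i + j)%N; rewrite coefM (bigD1 (Ordinal lti)) //= addKn.
move=> /divides_addl hh; have [|//|//] := qp a`_i b`_j.
apply: hh; apply: divides_sum => k /eqP ki.
have [kltj|jk] := ltnP k i; first by apply: divides_mulr; apply: mi.
rewrite mulrC; apply: divides_mulr; apply: mj.
have kni : (k : nat) <> i by move=> e; apply: ki; apply/val_inj.
have := ltn_ord k; lia.
Qed.

(** Gauss's lemma, in the form of a cancellation rule: constants that occur on
    one side of an identity with a primitive polynomial can be removed prime by
    prime. *)
Lemma gauss_cancel (D : idomainType) (s : D) (h u w : {poly D}) :
  factorial_domain D -> primitive h -> s != 0 -> s%:P * u = w * h -> divides h u.
Proof.
move=> fD ph s0; have [c [l [cu lp ->]]] := fD s s0.
elim: l lp w => [|q l IH] lp w.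
  rewrite big_nil mulr1 => e; exists (c^-1%:P * w).
  by rewrite -mulrA -e mulrA -polyCM mulVr // mul1r.
rewrite big_cons mulrCA polyCM -mulrA => e.
have pq : prime_element q by apply: lp; rewrite inE eqxx.
have [q0 _ qdiv] := prime_polyC pq.
have qwh : divides q%:P (w * h).
  by rewrite -e; exists ((c * \prod_(j <- l) j)%:P * u); rewrite mulrC.
have [[w' ew]|/dividesP_polyC hq] := qdiv w h qwh; last by case: (ph q pq).
apply: (IH _ w') => [r rl|]; first by apply: lp; rewrite inE rl orbT.
by apply: (mulfI q0); rewrite e ew; ring.
Qed.

(** The degree function dg makes the extraction of common prime factors stop; for
    polynomials over a field it is the total degree. *)
Section PrimitivePart.
Variables (D : idomainType) (dg : D -> nat).
Hypothesis dgM : forall q a : D, q != 0 -> q \isn't a GRing.unit -> a != 0 ->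
  (dg a < dg (q * a)%R)%N.

Lemma primitive_part (h : {poly D}) : h != 0 ->
  exists c h', [/\ c != 0, h = c%:P * h' & primitive h'].
Proof.
have [n] := ubnP (dg (lead_coef h)); elim: n h => // n IH h hn h0.
have [ph|] := pselect (primitive h).
  by exists 1, h; split; rewrite ?oner_neq0 ?mul1r.
move=> /existsNP[q /not_implyP[pq /contrapT /dividesP_polyC[h1 e]]].
have [q0 qu _] := pq.
have h10 : h1 != 0 by apply: contraNneq h0 => z; rewrite e z mul0r.
have [||c [h' [c0 e' ph']]] := IH h1 => //.
  have : (dg (lead_coef h1) < dg (lead_coef h))%N.
    by rewrite e mulrC lead_coefM lead_coefC; apply: dgM; rewrite ?lead_coef_eq0.
  by move=> h2; rewrite -ltnS; apply: leq_ltn_trans hn.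
exists (q * c), h'; split=> //; first by rewrite mulf_neq0.
by rewrite e e' polyCM; ring.
Qed.

(** A factor of least positive degree, made primitive, is prime: by Euclid's
    algorithm over the fractions it divides one factor of a product up to a
    constant, which Gauss's lemma removes. *)
Theorem factorial_poly : factorial_domain D -> factorial_domain {poly D}.
Proof.
move=> fD f; have [n] := ubnP (size f); elim: n f => // n IH f fn f0.
have [sf|sf] := leqP (size f) 1.
  have ef := size1_polyC sf; rewrite ef polyC_eq0 in f0.
  have [u [l [uu lp e]]] := fD _ f0.
  exists u%:P, [seq q%:P | q <- l]; split.
  - exact: rmorph_unit.
  - by move=> q /mapP[r /lp pr ->]; apply: prime_polyC.
  - by rewrite {1}ef e polyCM big_map rmorph_prod.
have [h [hf sh mh]] : exists h : {poly D}, [/\ h %| f, (1 < size h)%N &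
    forall h', h' %| f -> (1 < size h')%N -> (size h <= size h')%N].
  have : exists k, `[< exists h : {poly D}, [/\ h %| f, (1 < size h)%N & size h = k] >].
    by exists (size f); apply/asboolP; exists f.
  move=> /ex_minnP[k /asboolP[h [hf sh <-]] mk].
  by exists h; split=> // h' h'f sh'; apply: mk; apply/asboolP; exists h'.
have h0 : h != 0 by rewrite -size_poly_gt0; apply: ltnW.
have [c [g [c0 eg pg]]] := primitive_part h0.
have g0 : g != 0 by apply: contraNneq h0 => z; rewrite eg z mulr0.
have sgh : size g = size h by rewrite eg size_Cmul.
have sg : (1 < size g)%N by rewrite sgh.
have gf : g %| f by apply: dvdp_trans hf; rewrite eg dvdp_mull.
have cancel w : g %| w -> divides g w.
  move=> /Pdiv.Idomain.dvdpP[[s t] /= s0]; rewrite -mul_polyC => e.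
  exact: (gauss_cancel fD pg s0 e).
have pg' : prime_element g.
  split=> //; first by rewrite poly_unitE negb_and gtn_eqF.
  move=> u v [w e].
  have dv : g %| u * v by rewrite e dvdp_mull.
  have [co|nco] := boolP (coprimep g u).
    by right; apply: cancel; rewrite -(Gauss_dvdpr _ co).
  left; apply: cancel.
  have dG : gcdp g u %| g by apply: dvdp_gcdl.
  have G0 : gcdp g u != 0 by rewrite gcdp_eq0 negb_and g0.
  have sG : (1 < size (gcdp g u))%N.
    by rewrite ltn_neqAle eq_sym nco size_poly_gt0.
  have sG' := mh _ (dvdp_trans dG gf) sG.
  have : gcdp g u %= g by rewrite -(dvdp_size_eqp dG) eqn_leq dvdp_leq // sgh.
  by move=> /eqp_dvdl <-; apply: dvdp_gcdr.
have [f1 ef] := cancel _ gf.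
have f10 : f1 != 0 by apply: contraNneq f0 => z; rewrite ef z mul0r.
have [||u [l [uu lp e]]] := IH f1 => //.
  move: fn; rewrite ef size_mul //; move: (size f1) (size g) sg => a b; lia.
exists u, (g :: l); split=> // [q|].
  by rewrite inE => /orP[/eqP ->|/lp].
by rewrite big_cons ef e; ring.
Qed.
End PrimitivePart.

(** An isomorphism is given as a bijective morphism because its inverse carries no
    morphism structure. *)
Lemma factorial_transport (D E : idomainType) (phi : {rmorphism D -> E}) :
  injective phi -> (forall u, exists q, phi q = u) ->
  factorial_domain E -> factorial_domain D.
Proof.
move=> inj surj fE a a0.
have a0' : phi a != 0 by rewrite -(rmorph0 phi) (inj_eq inj).
have [u [l [uu lp e]]] := fE _ a0'.
have [inv hinv] := choice surj.
have invM p q : inv (p * q) = inv p * inv q by apply: inj; rewrite rmorphM /= !hinv.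
have phiK p : inv (phi p) = p by apply: inj; rewrite hinv.
have inv1 : inv 1 = 1 by apply: inj; rewrite hinv rmorph1.
exists (inv u), (map inv l); split.
- move: uu => /unitrP[q [qp pq]]; apply/unitrP; exists (inv q).
  by rewrite -!invM qp pq inv1.
- move=> _ /mapP[q /lp[q0 qu qp] ->]; split.
  + by apply: contraNneq q0 => z; rewrite -[q]hinv z rmorph0.
  + by apply: contra qu => h; rewrite -[q]hinv; apply: rmorph_unit.
  + move=> b c [d ebc]; have [|[t et]|[t et]] := qp (phi b) (phi c).
    * by exists (phi d); rewrite -rmorphM ebc rmorphM /= hinv.
    * by left; exists (inv t); rewrite -invM -et phiK.
    * by right; exists (inv t); rewrite -invM -et phiK.
- rewrite -[a]phiK e invM; congr (_ * _).
  by elim: l {lp e} => [|q l IHl]; rewrite ?big_nil ?inv1 //= !big_cons invM IHl.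
Qed.

Section MpolyFactorial.
Variable K : fieldType.
Local Notation P m := (mpoly.mpoly m K).

Lemma nonunit_msize m (q : P m) : q != 0 -> q \isn't a GRing.unit -> (1 < msize q)%N.
Proof.
move=> q0 qu; rewrite ltnNge; apply: contra qu => /msize1_polyC e.
rewrite e; apply: rmorph_unit; rewrite unitfE.
by apply: contraNneq q0 => z; rewrite e z mpolyC0.
Qed.

Lemma msize_lt_mul m (q a : P m) : q != 0 -> q \isn't a GRing.unit -> a != 0 ->
  (msize a < msize (q * a)%R)%N.
Proof.
move=> q0 qu a0; rewrite msizeM //; have := nonunit_msize q0 qu.
move: (mmeasure _ q) (mmeasure _ a) => x y; lia.
Qed.

Theorem factorial_mpoly m : factorial_domain (P m).
Proof.
elim: m => [|m IH] a a0.
  exists a, [::]; split=> //; last by rewrite big_nil mulr1.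
  apply/negPn/negP => /(nonunit_msize a0).
  rewrite ltnNge => /negP; apply.
  suff -> : a = mpolyC 0 (mcoeff mnm0 a) by rewrite msizeC; case: eqP.
  apply/mpolyP => u; rewrite mcoeffC; have -> : u = mnm0 by apply/mnmP => -[].
  by rewrite eqxx mulr1.
exact: (factorial_transport (@muni_inj K m) (@muni_surj K m)
          (factorial_poly (@msize_lt_mul m) IH)).
Qed.
End MpolyFactorial.
End Factorial.

(** * Minimal relations and gradients *)

Section Annihilator.

(** Induction over the ring operations: the form in which identities between
    morphisms and derivations are checked on generators. *)
Lemma mpoly_ring_ind (K : comNzRingType) n (Q : mpoly.mpoly n K -> Prop) :
  (forall c, Q (mpolyC n c)) -> (forall i, Q (mpolyX K (mnm1 i))) ->
  (forall p q, Q p -> Q q -> Q (p + q)) -> (forall p q, Q p -> Q q -> Q (p * q)) ->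
  forall p, Q p.
Proof.
move=> QC QX QD QM p; rewrite [p]mpolyE; elim/big_ind: _ => [||u _].
- by rewrite -mpolyC0.
- exact: QD.
rewrite -mul_mpolyC; apply: (QM) => //.
rewrite mpolyXE_id; elim/big_ind: _ => [||i _].
- by rewrite -mpolyC1.
- exact: QM.
elim: (u i) => [|k IH]; first by rewrite expr0 -mpolyC1.
by rewrite exprS; apply: (QM).
Qed.

Lemma mderiv_var (K : comNzRingType) n (u i : 'I_n) :
  mderiv u (mpolyX K (mnm1 i)) = if i == u then 1 else 0.
Proof.
rewrite mderivX mnm1E; case: eqP => [->|_]; last by rewrite scale0r.
have -> : mnm_sub (mnm1 u) (mnm1 u) = mnm0 by apply/mnmP => j; rewrite !mnmE subnn.
by rewrite mpolyX0 scale1r.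
Qed.

Variable K : numClosedFieldType.
Local Notation P m := (mpoly.mpoly m K).

Lemma meval_mmap m n (F : 'I_m -> P n) (U : P m) (x : 'I_n -> K) :
  meval x (mmap (@mpolyC n K) F U) = meval (fun i => meval x (F i)) U.
Proof.
elim/mpoly_ring_ind: U => [c|i|p q hp hq|p q hp hq].
- by rewrite mmapC !mevalC.
- by rewrite mmapX mmap1U mevalXU.
- by rewrite rmorphD !mevalD hp hq.
- by rewrite rmorphM !mevalM hp hq.
Qed.

Lemma mderiv_mmap m n (F : 'I_m -> P n) (U : P m) (u : 'I_n) :
  mderiv u (mmap (@mpolyC n K) F U) =
  \sum_k mmap (@mpolyC n K) F (mderiv k U) * mderiv u (F k).
Proof.
elim/mpoly_ring_ind: U => [c|i|p q hp hq|p q hp hq].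
- rewrite mmapC mderivC big1 // => k _.
  by rewrite mderivC rmorph0 mul0r.
- rewrite mmapX mmap1U (bigD1 i) //= mderiv_var eqxx rmorph1 mul1r.
  rewrite big1 ?addr0 // => k ki.
  by rewrite mderiv_var eq_sym (negPf ki) rmorph0 mul0r.
- rewrite rmorphD mderivD hp hq -big_split; apply: eq_bigr => k _ /=.
  by rewrite mderivD rmorphD mulrDl.
- rewrite rmorphM mderivM hp hq mulr_suml mulr_sumr -big_split.
  apply: eq_bigr => k _ /=; rewrite mderivM rmorphD !rmorphM /= mulrDl.
  by rewrite mulrAC !mulrA.
Qed.

Section Relations.
Variables (m n : nat) (F : 'I_m -> P n).
Local Notation G := (mmap (@mpolyC n K) F).
Local Notation at_ phi A := (map_poly G A).[phi].

(** Algebraic independence, that is, injectivity of the substitution of F. *)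
Definition independent := forall U, G U = 0 -> U = 0.

(** A relation of least degree of phi over F, without common factor of its
    coefficients. Over the fractions it is the minimal polynomial of phi; primitivity
    pins it down up to a unit and excludes a hypersurface of common zeros of the
    coefficients. *)
Definition annihilator (phi : P n) (A : {poly P m}) : Prop :=
  [/\ A != 0, at_ phi A = 0,
      forall A', A' != 0 -> at_ phi A' = 0 -> (size A <= size A')%N & primitive A].

Hypothesis iF : independent.

Lemma exists_annihilator phi A0 : A0 != 0 -> at_ phi A0 = 0 ->
  exists A, annihilator phi A.
Proof.
move=> A00 eA0.
have : exists k, `[< exists A, [/\ A != 0, at_ phi A = 0 & size A = k] >].
  by exists (size A0); apply/asboolP; exists A0.
move=> /ex_minnP[k /asboolP[A [A1 eA <-]] mk].
have [c [A' [c0 e pA]]] := primitive_part (@msize_lt_mul K m) A1.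
have A'0 : A' != 0 by apply: contraNneq A1 => z; rewrite e z mulr0.
exists A'; split=> //.
- have /eqP := eA; rewrite e rmorphM /= map_polyC hornerM hornerC mulf_eq0.
  by move=> /orP[/eqP/iF z|/eqP //]; rewrite z eqxx in c0.
- move=> B B0 eB; rewrite -(size_Cmul A' c0) -e.
  by apply: mk; apply/asboolP; exists B.
Qed.

Lemma annihilator_size phi A : annihilator phi A -> (1 < size A)%N.
Proof.
move=> [A0 eA _ _]; rewrite ltnNge; apply/negP => sA.
move: eA A0; rewrite (size1_polyC sA) map_polyC hornerC polyC_eq0 => /iF ->.
by rewrite eqxx.
Qed.

Lemma annihilator_deriv phi A : annihilator phi A -> at_ phi A^`() != 0.
Proof.
move=> hA; have sA := annihilator_size hA; have [A0 _ mA _] := hA.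
have A'0 : A^`() != 0.
  apply/negP => /eqP /(congr1 (fun p : {poly P m} => p`_(size A).-2)).
  rewrite coef_deriv coef0 => /eqP.
  have -> : ((size A).-2.+1 = (size A).-1)%N by case: (size A) sA => [|[]].
  rewrite -lead_coefE -scaler_nat scaler_eq0 lead_coef_eq0 (negPf A0) orbF.
  by rewrite pnatr_eq0; case: (size A) sA => [|[]].
apply/negP => /eqP /(mA _ A'0); apply/negP; rewrite -ltnNge.
by apply: lt_size_deriv.
Qed.

(** Differentiating a relation of least degree: in characteristic zero, algebraic
    dependence on F forces the gradient into the span of the gradients of F. *)
Lemma gradient_in_span phi A : annihilator phi A ->
  exists e c, e != 0 /\ forall u,
    e * mderiv u phi = \sum_k c k * mderiv u (F k).
Proof.
move=> hA; exists (at_ phi A^`()), (fun k => - at_ phi (map_poly (mderiv k) A)).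
split=> [|u]; first exact: annihilator_deriv.
have [_ eA _ _] := hA.
have chain (B : {poly P m}) : mderiv u (at_ phi B) =
    \sum_k at_ phi (map_poly (mderiv k) B) * mderiv u (F k)
    + at_ phi B^`() * mderiv u phi.
  elim/poly_ind: B => [|B c IH].
    rewrite rmorph0 horner0 mderiv0 deriv0 rmorph0 horner0 mul0r addr0 big1 // => k _.
    by rewrite raddf0 rmorph0 horner0 mul0r.
  have E k : map_poly (mderiv k) (B * 'X + c%:P) =
             map_poly (mderiv k) B * 'X + (mderiv k c)%:P.
    apply/polyP => i; rewrite coefD coefMX coefC !coef_map coefD coefMX coefC.
    by rewrite raddfD; case: i => [|i]; rewrite ?raddf0.
  rewrite rmorphD rmorphM /= map_polyX map_polyC !hornerE /= mderivD mderivM IH.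
  rewrite mderiv_mmap derivD derivM derivX derivC addr0 mulr1.
  rewrite rmorphD rmorphM /= map_polyX !hornerE mulrDl mulr_suml.
  have -> : \sum_k at_ phi (map_poly (mderiv k) (B * 'X + c%:P)) * mderiv u (F k) =
     \sum_k at_ phi (map_poly (mderiv k) B) * mderiv u (F k) * phi +
     \sum_k G (mderiv k c) * mderiv u (F k).
    rewrite -big_split /=; apply: eq_bigr => k _.
    by rewrite E rmorphD rmorphM /= map_polyX map_polyC !hornerE /=; ring.
  ring.
have := chain A; rewrite eA mderiv0 => /esym/eqP.
rewrite addr_eq0 => /eqP h.
rewrite (eq_bigr _ (fun k _ => mulNr (at_ phi (map_poly (mderiv k) A)) (mderiv u (F k)))).
by rewrite sumrN h opprK.
Qed.
End Relations.
End Annihilator.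

Section Extend.
Variable K : numClosedFieldType.
Local Notation P m := (mpoly.mpoly m K).
Variables (m n : nat) (F : 'I_m -> P n).
Local Notation G := (mmap (@mpolyC n K) F).
Local Notation at_ phi A := (map_poly G A).[phi].

(** The family f followed by a, indexed by natural numbers as the substitution
    lemmas for the last variable require. *)
Definition extend (T : Type) (f : 'I_m -> T) (a : T) (i : nat) : T :=
  oapp f a (insub i).

Lemma extend_ord T (f : 'I_m -> T) a (i : 'I_m) : extend f a i = f i.
Proof. by rewrite /extend valK. Qed.

Lemma extend_last T (f : 'I_m -> T) a : extend f a m = a.
Proof. by rewrite /extend insubN // ltnn. Qed.

Lemma mmap_extend phi U :
  mmap (@mpolyC n K) (fun i : 'I_m.+1 => extend F phi i) U = at_ phi (muni U).
Proof.
rewrite mmap_muni extend_last; congr (_.[phi]); apply: eq_map_poly => V.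
by apply: eq_bigr => u _; congr (_ * _); apply: mmap1_eq => i; rewrite extend_ord.
Qed.

Lemma meval_extend (t : 'I_m -> K) (z : K) U :
  meval (fun i : 'I_m.+1 => extend t z i) U = (map_poly (meval t) (muni U)).[z].
Proof.
rewrite /meval (mmap_muni idfun) extend_last; congr (_.[z]).
by apply: eq_map_poly => V; apply: meval_eq => i; rewrite extend_ord.
Qed.

Lemma meval_at phi A (x : 'I_n -> K) :
  meval x (at_ phi A) = (map_poly (meval (fun i => meval x (F i))) A).[meval x phi].
Proof.
elim/poly_ind: A => [|A c IH]; first by rewrite !rmorph0 !horner0 meval0.
rewrite !rmorphD !rmorphM /= !map_polyX !map_polyC !hornerE /=.
by rewrite mevalD mevalM IH meval_mmap.
Qed.

Lemma at_mul phi A B : at_ phi (A * B) = at_ phi A * at_ phi B.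
Proof. by rewrite rmorphM hornerM. Qed.

Lemma at_sub phi A B : at_ phi (A - B) = at_ phi A - at_ phi B.
Proof. by rewrite rmorphB hornerD hornerN. Qed.

Lemma at_const phi c : at_ phi c%:P = G c.
Proof. by rewrite map_polyC hornerC. Qed.

Lemma meval_exp (t : 'I_m -> K) (a : P m) k : meval t (a ^+ k) = meval t a ^+ k.
Proof. exact: rmorphXn. Qed.

Lemma specialize_mul (t : 'I_m -> K) z (A B : {poly P m}) :
  (map_poly (meval t) (A * B)).[z] = (map_poly (meval t) A).[z] * (map_poly (meval t) B).[z].
Proof. by rewrite rmorphM hornerM. Qed.

(** Over a generic t every root of the minimal relation is a value of phi on the
    fibre over t: the graph hypersurface is, up to a proper closed subset, in the
    image of (F, phi). *)
Lemma roots_are_values phi A : independent F -> annihilator F phi A ->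
  exists2 r : P m, r != 0 & forall t z, meval t r != 0 ->
    (map_poly (meval t) A).[z] = 0 ->
    exists2 x, (forall i, meval x (F i) = t i) & meval x phi = z.
Proof.
move=> iF hA; have [A0 eA mA _] := hA.
have [Q Q0 hQ] := image_contains_open_of_closure (fun i : 'I_m.+1 => extend F phi i).
rewrite mmap_extend in Q0; pose b := muni Q.
(* No factor of A of positive degree survives at phi, by minimality; hence A is *)
(* coprime to the polynomial b that cuts out the points missed by the image. *)
have noroot (B : {poly P m}) w s : B != 0 -> s != 0 -> s%:P * A = w * B ->
    at_ phi B != 0 -> (size B <= 1)%N.
  move=> B0 s0 e eB.
  have w0 : w != 0.
    apply: contraNneq A0 => z; move: e; rewrite z mul0r => /eqP.
    by rewrite mulf_eq0 polyC_eq0 (negPf s0).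
  have ew : at_ phi w = 0.
    have /eqP := congr1 (fun p => at_ phi p) e.
    rewrite !at_mul eA mulr0 eq_sym mulf_eq0 (negPf eB) orbF.
    by move/eqP.
  have := mA _ w0 ew; have := congr1 (fun p : {poly P m} => size p) e.
  rewrite size_Cmul // size_mul // => ->.
  have : (0 < size w)%N by rewrite size_poly_gt0.
  move: (size w) (size B) => a c; lia.
have [r [u [v [r0 er]]]] : exists r u v, r != 0 /\ r%:P = u * A + v * b.
  have [D0 dA db] : [/\ gcdp A b != 0, gcdp A b %| A & gcdp A b %| b].
    by rewrite gcdp_eq0 negb_and A0 dvdp_gcdl dvdp_gcdr.
  have [[s w] /= s0 es] := Pdiv.Idomain.dvdpP _ _ dA.
  have [[s' w'] /= s'0 es'] := Pdiv.Idomain.dvdpP _ _ db.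
  rewrite -mul_polyC in es; rewrite -mul_polyC in es'.
  have sD : (size (gcdp A b) <= 1)%N.
    apply: (noroot _ w s) => //; apply: contraNneq Q0 => z.
    have /eqP := congr1 (fun p => at_ phi p) es'.
    rewrite !at_mul z mulr0 at_const mulf_eq0.
    move=> /orP[/eqP/iF h|//]; by rewrite h eqxx in s'0.
  have [[u v] /= huv] := Bezoutp A b.
  have hs : size (u * A + v * b) = 1%N.
    by rewrite (eqp_size huv); apply/eqP; rewrite eqn_leq sD size_poly_gt0.
  have /size_poly1P[c c0 ec] : size (u * A + v * b) == 1%N by rewrite hs.
  by exists c, u, v.
exists (r * lead_coef A) => [|t z]; first by rewrite mulf_neq0 ?lead_coef_eq0.
rewrite mevalM mulf_eq0 negb_or => /andP[rt lt_] Az.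
have [||x hx] := hQ (fun i : 'I_m.+1 => extend t z i).
- move=> U; rewrite mmap_extend meval_extend => eU.
  have [k [w [q [e sq]]]] := pseudo_division (muni U) A0.
  have q0 : q = 0.
    apply/eqP/negPn/negP => q0.
    have : at_ phi q = 0.
      have -> : q = (lead_coef A ^+ k)%:P * muni U - w * A.
        by rewrite mul_polyC e addrC addKr.
      by rewrite at_sub !at_mul eA eU !mulr0 subrr.
    by move=> /(mA _ q0); rewrite leqNgt sq.
  have := congr1 (fun p => (map_poly (meval t) p).[z]) e.
  rewrite q0 addr0 -mul_polyC !specialize_mul Az mulr0 map_polyC hornerC /=.
  by move/eqP; rewrite mulf_eq0 meval_exp expf_eq0 (negPf lt_) andbF => /eqP.
- rewrite meval_extend; apply: contraNneq rt => z0.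
  have := congr1 (fun p => (map_poly (meval t) p).[z]) er.
  rewrite rmorphD hornerD !specialize_mul Az mulr0 add0r.
  by rewrite z0 mulr0 map_polyC hornerC => ->.
exists x => [i|].
  by have := hx (widen_ord (leqnSn m) i); rewrite !extend_ord.
by have := hx ord_max; rewrite !extend_last.
Qed.

Lemma annihilator_of_relation phi (U : P m.+1) : independent F -> U != 0 ->
  mmap (@mpolyC n K) (fun i : 'I_m.+1 => extend F phi i) U = 0 ->
  exists A, annihilator F phi A.
Proof.
move=> iF U0; rewrite mmap_extend => e; apply: (exists_annihilator iF (A0 := muni U)) => //.
by rewrite -(rmorph0 (@muni m K)) (inj_eq (@muni_inj _ _)).
Qed.
End Extend.

Section Jacobian.
Variable K : numClosedFieldType.
Local Notation P m := (mpoly.mpoly m K).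
Variables (p : nat) (g : 'I_p -> P p).
Hypothesis ig : independent g.

Definition jacobian : P p := \det (\matrix_(i, j) mderiv j (g i)).

(** The p + 1 polynomials g and phi in p variables are dependent. *)
Lemma annihilator_exists phi : exists A, annihilator g phi A.
Proof.
have [U U0 eU] := algebraically_dependent (fun i : 'I_p.+1 => extend g phi i).
exact: annihilator_of_relation U0 eU.
Qed.

(** The coordinates are algebraic over the components of g, so their gradients
    are spanned by those of the components. *)
Lemma jacobian_neq0 : jacobian != 0.
Proof.
have H j : exists ec : P p * ('I_p -> P p), ec.1 != 0 /\ forall u,
    ec.1 * mderiv u (mpolyX K (mnm1 j)) = \sum_k ec.2 k * mderiv u (g k).
  have [A hA] := annihilator_exists (mpolyX K (mnm1 j)).
  by have [e [c [e0 h]]] := gradient_in_span ig hA; exists (e, c).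
have [ec hec] := choice H.
have E : (\matrix_(i, j) (ec i).2 j) *m (\matrix_(i, j) mderiv j (g i)) =
         diag_mx (\row_j (ec j).1).
  apply/matrixP => j u; rewrite !mxE; have [e0 h] := hec j.
  rewrite -[RHS]mulr_natr.
  have <- : mderiv u (mpolyX K (mnm1 j)) = (j == u)%:R by rewrite mderiv_var; case: eqP.
  by rewrite h; apply: eq_bigr => k _; rewrite !mxE.
have : \det (diag_mx (\row_j (ec j).1)) != 0.
  by rewrite det_diag; apply/prodf_neq0 => j _; rewrite mxE; case: (hec j).
by rewrite -E det_mulmx mulf_eq0 negb_or => /andP[].
Qed.
End Jacobian.

(** * Estimates for polynomials *)

Section Norms.
Variable R : rcfType.
Local Notation C := (complex R).
Local Notation nC := (@ComplexField.Normc.normc R).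

Lemma nC_ge0 (z : C) : 0 <= nC z.
Proof. by case: z => a b; apply: sqrtr_ge0. Qed.

Lemma nC0 : nC 0 = 0. Proof. exact: ComplexField.Normc.normc0. Qed.
Lemma nC1 : nC 1 = 1. Proof. exact: ComplexField.Normc.normc1. Qed.
Lemma nCM (x y : C) : nC (x * y) = nC x * nC y.
Proof. exact: ComplexField.Normc.normcM. Qed.
Lemma nCD (x y : C) : nC (x + y) <= nC x + nC y.
Proof. exact: le_normcD. Qed.
Lemma nCN (x : C) : nC (- x) = nC x. Proof. exact: normcN. Qed.
Lemma nCB (x y : C) : nC (x - y) <= nC x + nC y.
Proof. by rewrite -(nCN y) nCD. Qed.
Lemma nC_eq0 (x : C) : (nC x == 0) = (x == 0).
Proof. by apply/eqP/eqP => [/ComplexField.Normc.eq0_normc|->]; rewrite ?nC0. Qed.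
Lemma nC_gt0 (x : C) : (0 < nC x) = (x != 0).
Proof. by rewrite lt_neqAle eq_sym nC_eq0 nC_ge0 andbT. Qed.
Lemma nCX (x : C) k : nC (x ^+ k) = nC x ^+ k.
Proof. by elim: k => [|k IH]; rewrite ?expr0 ?nC1 // !exprS nCM IH. Qed.
Lemma nCV (x : C) : nC x^-1 = (nC x)^-1. Proof. exact: ComplexField.Normc.normcV. Qed.
Lemma nC_real (a : R) : nC (real_complex R a) = `|a|.
Proof. by rewrite /ComplexField.Normc.normc /= expr0n addr0 sqrtr_sqr. Qed.
Lemma nC_sum (I : Type) (r : seq I) (Q : pred I) (F : I -> C) :
  nC (\sum_(i <- r | Q i) F i) <= \sum_(i <- r | Q i) nC (F i).
Proof.
elim/big_rec2: _ => [|i y x _ h]; first by rewrite nC0.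
by apply: le_trans (nCD _ _) _; rewrite lerD2l.
Qed.
Lemma nC_prod (I : Type) (r : seq I) (F : I -> C) :
  nC (\prod_(i <- r) F i) = \prod_(i <- r) nC (F i).
Proof. by elim/big_rec2: _ => [|i y x _ <-]; rewrite ?nC1 ?nCM. Qed.
Lemma nCBC (x y : C) : nC (x - y) = nC (y - x).
Proof. by rewrite -nCN opprB. Qed.
Lemma nC_sub_ge (x y : C) : nC x - nC y <= nC (x - y).
Proof. by rewrite lerBlDr; apply: le_trans (nCD _ _); rewrite subrK. Qed.

(** The l1 norm: it is additive over blocks of coordinates, and equivalent to the
    Euclidean norm. *)
Definition vn n (x : 'rV[C]_n) : R := \sum_j nC (x 0 j).

Variable n : nat.
Implicit Types x y z : 'rV[C]_n.

Lemma vn_ge0 x : 0 <= vn x.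
Proof. by apply: sumr_ge0 => j _; apply: nC_ge0. Qed.
Lemma vn0 : vn (0 : 'rV[C]_n) = 0.
Proof. by rewrite /vn big1 // => j _; rewrite mxE nC0. Qed.
Lemma vnD x y : vn (x + y) <= vn x + vn y.
Proof. by rewrite /vn -big_split; apply: ler_sum => j _; rewrite mxE nCD. Qed.
Lemma vnN x : vn (- x) = vn x.
Proof. by apply: eq_bigr => j _; rewrite mxE nCN. Qed.
Lemma vnB x y : vn (x - y) <= vn x + vn y.
Proof. by rewrite -(vnN y) vnD. Qed.
Lemma vnBC x y : vn (x - y) = vn (y - x).
Proof. by rewrite -vnN opprB. Qed.
Lemma vnZ (a : C) x : vn (a *: x) = nC a * vn x.
Proof. by rewrite /vn mulr_sumr; apply: eq_bigr => j _; rewrite mxE nCM. Qed.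
Lemma nC_le_vn x j : nC (x 0 j) <= vn x.
Proof. by rewrite /vn (bigD1 j) //= lerDl sumr_ge0 // => i _; apply: nC_ge0. Qed.
Lemma vn_tri x y z : vn (x - z) <= vn (x - y) + vn (y - z).
Proof. by apply: le_trans (vnD _ _); rewrite addrA subrK. Qed.
Lemma vn_eq0 x : vn x = 0 -> x = 0.
Proof.
move=> h; apply/rowP => j; rewrite mxE; apply/eqP; rewrite -nC_eq0 eq_le nC_ge0 andbT.
by rewrite -h nC_le_vn.
Qed.
Lemma vn_gt0 x y : x != y -> 0 < vn (x - y).
Proof.
by move=> ne; rewrite lt_neqAle vn_ge0 andbT eq_sym; apply: contraNneq ne => /vn_eq0 /subr0_eq ->.
Qed.
Lemma vn_le_of_coord x (e : R) : (forall j, nC (x 0 j) <= e) -> vn x <= n%:R * e.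
Proof.
move=> h; apply: le_trans (ler_sum _ (fun j _ => h j)) _.
by rewrite sumr_const card_ord mulr_natl.
Qed.
Lemma vn_lt_of_coord x (e : R) : 0 < e -> (forall j, nC (x 0 j) <= e / n.+1%:R) -> vn x < e.
Proof.
move=> e0 /vn_le_of_coord h; apply: le_lt_trans h _; rewrite mulrCA gtr_pMr //.
by rewrite ltr_pdivrMr ?ltr0n // mul1r ltr_nat.
Qed.
End Norms.

Lemma ler_sum_mem (R : numDomainType) (T : eqType) (s : seq T) (F : T -> R) y :
  (forall z, 0 <= F z) -> y \in s -> F y <= \sum_(z <- s) F z.
Proof.
move=> F0; elim: s => // z s IH; rewrite inE big_cons => /orP[/eqP ->|/IH h].
  by rewrite lerDl sumr_ge0.
by apply: le_trans h _; rewrite lerDr.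
Qed.

Section Increments.
Variable A : comNzRingType.
Implicit Types a b : A.

Lemma increment_mul a b a' b' : a * b - a' * b' = (a - a') * b + a' * (b - b').
Proof. ring. Qed.

Lemma taylor_remainderD a b a' b' da db :
  a + b - (a' + b') - (da + db) = (a - a' - da) + (b - b' - db).
Proof. ring. Qed.

Lemma taylor_remainderM a b a' b' da db :
  a * b - a' * b' - (da * b' + a' * db) =
  (a - a' - da) * b + a' * (b - b' - db) + da * (b - b').
Proof. ring. Qed.
End Increments.

Section PolynomialAnalysis.
Variable R : rcfType.
Local Notation C := (complex R).
Local Notation nC := (@ComplexField.Normc.normc R).
Local Notation P m := (mpoly.mpoly m C).

Definition pev m (q : P m) (x : 'rV[C]_m) : C := meval (fun j => x 0 j) q.

Lemma pevC m c (x : 'rV[C]_m) : pev (mpolyC m c) x = c. Proof. exact: mevalC. Qed.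
Lemma pevX m i (x : 'rV[C]_m) : pev (mpolyX C (mnm1 i)) x = x 0 i.
Proof. exact: mevalXU. Qed.
Lemma pevD m (p q : P m) x : pev (p + q) x = pev p x + pev q x.
Proof. exact: mevalD. Qed.
Lemma pevM m (p q : P m) x : pev (p * q) x = pev p x * pev q x.
Proof. exact: mevalM. Qed.

Variable m : nat.
Implicit Types (q : P m) (x y : 'rV[C]_m).

Lemma pev_bounded q (M : R) : exists2 B, 0 <= B &
  forall x, vn x <= M -> nC (pev q x) <= B.
Proof.
elim/mpoly_ring_ind: q => [c|i|p q [B1 B10 h1] [B2 B20 h2]|p q [B1 B10 h1] [B2 B20 h2]].
- by exists (nC c) => [|x _]; rewrite ?nC_ge0 // pevC.
- exists (Num.max 0 M) => [|x hx]; first by rewrite le_max lexx.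
  by rewrite pevX (le_trans (nC_le_vn _ _)) // (le_trans hx) // le_max lexx orbT.
- exists (B1 + B2) => [|x hx]; first exact: addr_ge0.
  by rewrite pevD (le_trans (nCD _ _)) // lerD ?h1 ?h2.
- exists (B1 * B2) => [|x hx]; first exact: mulr_ge0.
  by rewrite pevM nCM ler_pM ?nC_ge0 ?h1 ?h2.
Qed.

Lemma pev_lipschitz q (M : R) : exists2 L, 0 <= L &
  forall x y, vn x <= M -> vn y <= M -> nC (pev q x - pev q y) <= L * vn (x - y).
Proof.
elim/mpoly_ring_ind: q => [c|i|p q [L1 L10 h1] [L2 L20 h2]|p q [L1 L10 h1] [L2 L20 h2]].
- by exists 0 => // x y _ _; rewrite !pevC subrr nC0 mul0r.
- exists 1 => // x y _ _; rewrite !pevX mul1r.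
  by have := nC_le_vn (x - y) i; rewrite !mxE.
- exists (L1 + L2) => [|x y hx hy]; first exact: addr_ge0.
  rewrite !pevD mulrDl opprD addrACA.
  by apply: le_trans (nCD _ _) _; rewrite lerD ?h1 ?h2.
- have [B1 B10 b1] := pev_bounded p M; have [B2 B20 b2] := pev_bounded q M.
  exists (L1 * B2 + B1 * L2) => [|x y hx hy]; first by rewrite addr_ge0 ?mulr_ge0.
  rewrite !pevM.
  rewrite increment_mul.
  apply: le_trans (nCD _ _) _; rewrite !nCM mulrDl.
  have -> : L1 * B2 * vn (x - y) = L1 * vn (x - y) * B2 by ring.
  rewrite -(mulrA B1).
  by apply: lerD; apply: ler_pM; rewrite ?nC_ge0 ?h1 ?h2 ?b1 ?b2.
Qed.

Definition pdiff q x (v : 'rV[C]_m) : C := \sum_j pev (mderiv j q) x * v 0 j.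

Lemma pdiff_bound q (M : R) : exists2 B, 0 <= B &
  forall x v, vn x <= M -> nC (pdiff q x v) <= B * vn v.
Proof.
have [B hB] := choice (fun j => (let: ex_intro2 b b0 hb := pev_bounded (mderiv j q) M in
   ex_intro _ b (conj b0 hb) :
     exists b, 0 <= b /\ forall x, vn x <= M -> nC (pev (mderiv j q) x) <= b)).
exists (\sum_j B j) => [|x v hx]; first by apply: sumr_ge0 => j _; case: (hB j).
apply: le_trans (nC_sum _ _ _) _; rewrite mulr_suml; apply: ler_sum => j _.
by rewrite nCM ler_pM ?nC_ge0 ?nC_le_vn //; case: (hB j) => _; apply.
Qed.

Lemma pdiffC c x v : pdiff (mpolyC m c) x v = 0.
Proof. by rewrite /pdiff big1 // => j _; rewrite mderivC -(mpolyC0 _) pevC mul0r. Qed.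

Lemma pdiffX i x v : pdiff (mpolyX C (mnm1 i)) x v = v 0 i.
Proof.
rewrite /pdiff (bigD1 i) //= mderiv_var eqxx -(mpolyC1 _) pevC mul1r.
rewrite big1 ?addr0 // => k ki.
by rewrite mderiv_var eq_sym (negPf ki) -(mpolyC0 _) pevC mul0r.
Qed.

Lemma pdiffD p q x v : pdiff (p + q) x v = pdiff p x v + pdiff q x v.
Proof. by rewrite /pdiff -big_split; apply: eq_bigr => j _; rewrite mderivD pevD mulrDl. Qed.

Lemma pdiffM p q x v : pdiff (p * q) x v = pdiff p x v * pev q x + pev p x * pdiff q x v.
Proof.
rewrite /pdiff mulr_suml mulr_sumr -big_split; apply: eq_bigr => j _ /=.
by rewrite mderivM pevD !pevM mulrDl mulrA mulrAC.
Qed.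

(** Only the second order of the remainder matters, with a constant uniform on
    balls; it follows from the product rule by induction on the polynomial. *)
Lemma pev_taylor q (M : R) : exists2 L, 0 <= L &
  forall x y, vn x <= M -> vn y <= M ->
    nC (pev q y - pev q x - pdiff q x (y - x)) <= L * vn (y - x) ^+ 2.
Proof.
elim/mpoly_ring_ind: q => [c|i|p q [L1 L10 h1] [L2 L20 h2]|p q [L1 L10 h1] [L2 L20 h2]].
- by exists 0 => // x y _ _; rewrite !pevC pdiffC subrr subr0 nC0 mul0r.
- exists 0 => // x y _ _; rewrite !pevX pdiffX !mxE subrr nC0 mul0r //.
- exists (L1 + L2) => [|x y hx hy]; first exact: addr_ge0.
  rewrite !pevD pdiffD mulrDl.
  rewrite taylor_remainderD.
  by apply: le_trans (nCD _ _) _; rewrite lerD ?h1 ?h2.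
- have [B1 B10 b1] := pev_bounded p M; have [B2 B20 b2] := pev_bounded q M.
  have [D1 D10 d1] := pdiff_bound p M; have [K2 K20 k2] := pev_lipschitz q M.
  exists (L1 * B2 + B1 * L2 + D1 * K2) => [|x y hx hy]; first by rewrite !addr_ge0 ?mulr_ge0.
  rewrite !pevM pdiffM.
  rewrite taylor_remainderM.
  apply: le_trans (nCD _ _) _; rewrite [leRHS]mulrDl; apply: lerD.
    apply: le_trans (nCD _ _) _; rewrite [leRHS]mulrDl !nCM; apply: lerD.
      by rewrite mulrAC; apply: ler_pM; rewrite ?nC_ge0 ?h1 ?b2.
    by rewrite -mulrA; apply: ler_pM; rewrite ?nC_ge0 ?h2 ?b1.
  rewrite nCM expr2 mulrACA; apply: ler_pM; rewrite ?nC_ge0 ?d1 //.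
  exact: k2.
Qed.

End PolynomialAnalysis.

Section Lines.
Variable R : rcfType.
Local Notation C := (complex R).
Local Notation P m := (mpoly.mpoly m C).

(** Restriction to the line through x with direction u. *)
Definition on_line n (x u : 'rV[C]_n) : P n -> {poly C} :=
  mmap polyC (fun j => (x 0 j)%:P + u 0 j *: 'X).

Lemma on_line_horner n (x u : 'rV[C]_n) q s : (on_line x u q).[s] = pev q (x + s *: u).
Proof.
rewrite /on_line; elim/mpoly_ring_ind: q => [a|i|p q hp hq|p q hp hq].
- by rewrite mmapC hornerC pevC.
- by rewrite mmapX mmap1U pevX !mxE hornerD hornerC hornerZ hornerX mulrC.
- by rewrite rmorphD hornerD hp hq pevD.
- by rewrite rmorphM hornerM hp hq pevM.
Qed.

Lemma on_lineM n (x u : 'rV[C]_n) p q : on_line x u (p * q) = on_line x u p * on_line x u q.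
Proof. exact: rmorphM. Qed.

Lemma on_line_sum n (x u : 'rV[C]_n) (I : finType) (F : I -> P n) :
  on_line x u (\sum_i F i) = \sum_i on_line x u (F i).
Proof. exact: rmorph_sum. Qed.

Lemma on_line_deriv n (x u : 'rV[C]_n) q :
  (on_line x u q)^`() = \sum_j u 0 j *: on_line x u (mderiv j q).
Proof.
rewrite /on_line; elim/mpoly_ring_ind: q => [a|i|p q hp hq|p q hp hq].
- by rewrite mmapC derivC big1 // => j _; rewrite mderivC rmorph0 scaler0.
- rewrite mmapX mmap1U derivD derivC derivZ derivX add0r (bigD1 i) //= mderiv_var eqxx.
  rewrite rmorph1 big1 ?addr0 // => k ki.
  by rewrite mderiv_var eq_sym (negPf ki) rmorph0 scaler0.
- rewrite rmorphD derivD hp hq -big_split; apply: eq_bigr => k _ /=.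
  by rewrite mderivD rmorphD scalerDr.
- rewrite rmorphM derivM hp hq mulr_suml mulr_sumr -big_split.
  apply: eq_bigr => k _ /=; rewrite mderivM rmorphD !rmorphM /= scalerDr.
  by rewrite scalerAl scalerAr.
Qed.
End Lines.

(** * Nonvanishing and root bounds *)

Section NonVanishing.
Variable K : numClosedFieldType.

Lemma meval_nonzero m (q : mpoly.mpoly m K) : q != 0 -> exists v, meval v q != 0.
Proof.
elim: m q => [|m IH] q q0.
  exists (fun=> 0); apply: contraNneq q0 => e; apply/eqP/mpolyP => u.
  have -> : u = mnm0 by apply/mnmP => -[].
  have : q = mpolyC 0 (mcoeff mnm0 q).
    apply/mpolyP => u'; rewrite mcoeffC; have -> : u' = mnm0 by apply/mnmP => -[].
    by rewrite eqxx mulr1.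
  by move=> eq; move: e; rewrite eq mevalC mcoeffC eqxx mulr1 mcoeff0.
have u0 : muni q != 0 by rewrite -(rmorph0 (@muni m K)) (inj_eq (@muni_inj _ _)).
have [t ht] : exists t, meval t (lead_coef (muni q)) != 0.
  by apply: IH; rewrite lead_coef_eq0.
have h : map_poly (meval t) (muni q) != 0.
  apply: contraNneq ht => e; have := congr1 (fun p : {poly K} => p`_(size (muni q)).-1) e.
  by rewrite coef_map coef0 lead_coefE => ->.
have /closed_nonrootP[z hz] := h.
by exists (fun i => extend t z i); rewrite meval_extend.
Qed.
End NonVanishing.

Section RootBounds.
Variable R : rcfType.
Local Notation C := (complex R).
Local Notation nC := (@ComplexField.Normc.normc R).
Local Notation P m := (mpoly.mpoly m C).
Local Notation rc := (real_complex R).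

(** Among the numbers eps / (k + 2) there are more than u can have roots. *)
Lemma small_nonroot (u : {poly C}) (eps : R) : u != 0 -> 0 < eps ->
  exists s : R, [/\ 0 < s, s < eps & u.[rc s] != 0].
Proof.
move=> u0 e0; pose pt k : R := eps / k.+2%:R.
have pos k : 0 < pt k by rewrite divr_gt0 // ltr0n.
have lte k : pt k < eps by rewrite ltr_pdivrMr ?ltr0n // ltr_pMr // ltr1n.
have inj : injective (fun k => rc (pt k)).
  move=> i j /complexI /(mulfI (lt0r_neq0 e0)) /invr_inj /eqP.
  by rewrite eqr_nat => /eqP[].
have [h|h] := boolP (all (root u) [seq rc (pt k) | k <- iota 0 (size u)]).
  have := max_poly_roots u0 h; rewrite map_inj_uniq // iota_uniq => /(_ isT).
  by rewrite size_map size_iota ltnn.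
have /allPn[z /mapP[k _ ->] hz] := h.
by exists (pt k); split.
Qed.

(** On a line from c to a point where q does not vanish, q has finitely many
    zeros. *)
Lemma nonvanishing_near m (q : P m) (c : 'rV[C]_m) (delta : R) :
  q != 0 -> 0 < delta -> exists t, vn (t - c) < delta /\ pev q t != 0.
Proof.
move=> /meval_nonzero[v hv] d0.
pose w : 'rV[C]_m := \row_j v j - c.
pose u := on_line c w q.
have hu t : u.[t] = pev q (c + t *: w) := on_line_horner c w q t.
have u0 : u != 0.
  apply: contraNneq hv => z; have := hu 1; rewrite z horner0 scale1r addrC subrK => ->.
  by apply/eqP; apply: meval_eq => j; rewrite mxE.
have e0 : 0 < delta / (1 + vn w) by rewrite divr_gt0 // ltr_pwDl // vn_ge0.
have [s [s0 ls us]] := small_nonroot u0 e0.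
exists (c + rc s *: w); split; last by rewrite -hu.
rewrite addrC addKr vnZ nC_real gtr0_norm //.
have : s * (1 + vn w) < delta by rewrite -ltr_pdivlMr // ltr_pwDl // vn_ge0.
by apply: le_lt_trans; rewrite ler_wpM2l ?lerDr // ltW.
Qed.

Lemma nC_horner_prod (p : {poly C}) : exists rs : seq C,
  [/\ (p != 0 -> (size p).-1 = size rs), (p != 0 -> forall r, r \in rs -> root p r),
      (p = lead_coef p *: \prod_(r <- rs) ('X - r%:P)) &
      forall z, nC p.[z] = nC (lead_coef p) * \prod_(r <- rs) nC (z - r)].
Proof.
have [rs e] := closed_field_poly_normal p; exists rs.
have E z : p.[z] = lead_coef p * \prod_(r <- rs) (z - r).
  rewrite [in LHS]e hornerZ horner_prod; congr (_ * _).
  by apply: eq_bigr => r _; rewrite hornerXsubC.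
split=> // [p0|p0 r rrs|z].
- by rewrite e size_scale ?lead_coef_eq0 // size_prod_XsubC.
- by rewrite e rootZ ?lead_coef_eq0 // root_prod_XsubC.
- by rewrite E nCM nC_prod.
Qed.

Lemma prod_nat_ge (rs : seq C) (F : C -> R) (b : R) : 0 <= b ->
  (forall r, r \in rs -> b <= F r) -> b ^+ size rs <= \prod_(r <- rs) F r.
Proof.
move=> b0; elim: rs => [|r rs IH] h; first by rewrite big_nil expr0.
have h' r' : r' \in rs -> b <= F r' by move=> rr; apply: h; rewrite inE rr orbT.
by rewrite big_cons exprS ler_pM ?exprn_ge0 ?IH ?h ?mem_head.
Qed.

(** The value at z is the leading coefficient times the product of the distances
    from z to the roots; if it is small, one of these distances is small. *)
Lemma root_near (p : {poly C}) z (eps : R) : p != 0 -> 0 < eps ->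
  nC p.[z] < nC (lead_coef p) * eps ^+ (size p).-1 ->
  exists2 r, root p r & nC (z - r) < eps.
Proof.
move=> p0 e0; have [rs [srs rrs _ ->]] := nC_horner_prod p.
have l0 : 0 < nC (lead_coef p) by rewrite nC_gt0 lead_coef_eq0.
rewrite ltr_pM2l // srs // => h.
have [/hasP[r rin hr]|/hasPn nh] := boolP (has (fun r => nC (z - r) < eps) rs).
  by exists r => //; apply: rrs.
exfalso; move: h; apply/negP; rewrite -leNgt; apply: prod_nat_ge; first exact: ltW.
by move=> r /nh; rewrite -leNgt.
Qed.

(** Each factor 1 - r of the value at 1 is at most 1 + 1/eps times the factor r of
    the value at 0. *)
Lemma growth_from_zero (p : {poly C}) (eps : R) : p != 0 -> 0 < eps ->
  (forall r, root p r -> eps <= nC r) ->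
  nC p.[1] <= nC p.[0] * (1 + eps^-1) ^+ (size p).-1.
Proof.
move=> p0 e0 hr; have [rs [srs rrs _ E]] := nC_horner_prod p.
rewrite !E -mulrA ler_wpM2l ?nC_ge0 // srs //.
elim: rs {E srs} rrs => [|r rs IH] h; first by rewrite !big_nil expr0 mulr1.
rewrite !big_cons exprS mulrACA; apply: ler_pM.
- exact: nC_ge0.
- by apply: prodr_ge0 => r' _; apply: nC_ge0.
- have er : eps <= nC r by apply: hr; apply: h => //; apply: mem_head.
  rewrite sub0r nCN mulrDr mulr1; apply: le_trans (nCB _ _) _; rewrite nC1 addrC lerD2l.
  by rewrite ler_pdivlMr // mul1r.
- by apply: IH => _ r' rr; apply: h => //; rewrite inE rr orbT.
Qed.

(** The coefficients, divided by the leading one, are symmetric functions of the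
    roots. *)
Lemma coef_bound (p : {poly C}) (M : R) i : p != 0 -> 0 <= M ->
  (forall r, root p r -> nC r <= M) ->
  nC p`_i <= nC (lead_coef p) * (1 + M) ^+ (size p).-1.
Proof.
move=> p0 M0 hr; have [rs [srs rrs e _]] := nC_horner_prod p.
rewrite {1}e coefZ nCM ler_wpM2l ?nC_ge0 // srs //.
elim: rs {e srs} rrs i => [|r rs IH] h i.
  by rewrite big_nil expr0 coef1; case: eqP; rewrite ?nC1 ?nC0.
have h' : p != 0 -> forall r', r' \in rs -> root p r'.
  by move=> _ r' rr; apply: h => //; rewrite inE rr orbT.
rewrite big_cons mulrBl coefB coefXM coefCM exprS mulrDl mul1r.
apply: le_trans (nCB _ _) _; apply: lerD.
  by case: i => [|i]; rewrite ?nC0 ?exprn_ge0 ?addr_ge0 //=; apply: IH.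
rewrite nCM; apply: ler_pM; rewrite ?nC_ge0 //; last exact: IH.
by apply: hr; apply: h => //; apply: mem_head.
Qed.

Lemma constant_bound (p : {poly C}) (eps : R) : p != 0 -> 0 < eps ->
  (forall r, root p r -> eps <= nC r) ->
  nC (lead_coef p) * eps ^+ (size p).-1 <= nC p`_0.
Proof.
move=> p0 e0 hr; have [rs [srs rrs _ E]] := nC_horner_prod p.
rewrite -horner_coef0 E ler_wpM2l ?nC_ge0 // srs //; apply: prod_nat_ge; first exact: ltW.
by move=> r rr; rewrite sub0r nCN; apply: hr; apply: rrs.
Qed.
End RootBounds.

(** * A local Nullstellensatz for primes *)

Section Shear.
Variable K : comNzRingType.
Local Notation P m := (mpoly.mpoly m K).
Variable m : nat.

(** The substitution q(t + T w), as a polynomial in T over the polynomials in t: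
    it turns restriction to lines of direction w into a change of rings that needs
    no choice of coordinates. *)
Definition shear (w : 'rV[K]_m) (q : P m) : {poly P m} :=
  mmap (polyC \o @mpolyC m K)
       (fun i => (mpolyX K (mnm1 i))%:P + (mpolyC m (w 0 i))%:P * 'X) q.

HB.instance Definition _ w := GRing.RMorphism.copy (shear w)
  (mmap (polyC \o @mpolyC m K)
       (fun i => (mpolyX K (mnm1 i))%:P + (mpolyC m (w 0 i))%:P * 'X)).

(** The automorphism T |-> T, t_i |-> t_i + w_i T of the ring of polynomials in T
    over the polynomials in t. Since it extends the substitution above, the latter
    carries primes to primes. *)
Definition shear_auto (w : 'rV[K]_m) (A : {poly P m}) : {poly P m} :=
  (map_poly (shear w) A).['X].

Lemma shearC w c : shear w (mpolyC m c) = (mpolyC m c)%:P.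
Proof. exact: mmapC. Qed.
Lemma shearX w i : shear w (mpolyX K (mnm1 i)) =
  (mpolyX K (mnm1 i))%:P + (mpolyC m (w 0 i))%:P * 'X.
Proof. by rewrite /shear mmapX mmap1U. Qed.
Lemma shearD w p q : shear w (p + q) = shear w p + shear w q.
Proof. exact: raddfD. Qed.
Lemma shearM w p q : shear w (p * q) = shear w p * shear w q.
Proof. exact: rmorphM. Qed.

Lemma map_shearD w (A B : {poly P m}) :
  map_poly (shear w) (A + B) = map_poly (shear w) A + map_poly (shear w) B.
Proof. exact: rmorphD. Qed.
Lemma map_shearM w (A B : {poly P m}) :
  map_poly (shear w) (A * B) = map_poly (shear w) A * map_poly (shear w) B.
Proof. exact: rmorphM. Qed.

Lemma shear_autoD w A B : shear_auto w (A + B) = shear_auto w A + shear_auto w B.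
Proof. by rewrite /shear_auto map_shearD hornerD. Qed.
Lemma shear_autoM w A B : shear_auto w (A * B) = shear_auto w A * shear_auto w B.
Proof. by rewrite /shear_auto map_shearM hornerM. Qed.
Lemma shear_auto_const w c : shear_auto w c%:P = shear w c.
Proof. by rewrite /shear_auto map_polyC hornerC. Qed.
Lemma shear_autoX w : shear_auto w 'X = 'X.
Proof. by rewrite /shear_auto map_polyX hornerX. Qed.

Lemma shear_auto_horner w A B :
  shear_auto w (A * 'X + B) = shear_auto w A * 'X + shear_auto w B.
Proof. by rewrite shear_autoD shear_autoM shear_autoX. Qed.

Lemma shear_autoK w A : shear_auto w (shear_auto (- w) A) = A.
Proof.
elim/poly_ind: A => [|A c IH].
  by rewrite -[0](polyC0) shear_auto_const -mpolyC0 shearC shear_auto_const shearC.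
rewrite (shear_auto_horner (- w)) (shear_auto_horner w).
congr (_ * 'X + _); first exact: IH.
rewrite shear_auto_const; elim/mpoly_ring_ind: c => [a|i|p q hp hq|p q hp hq].
- by rewrite shearC shear_auto_const shearC.
- rewrite shearX (shear_autoD w) (shear_autoM w) (shear_autoX w) !shear_auto_const shearX shearC.
  by rewrite mxE mpolyCN polyCN mulNr addrK.
- by rewrite shearD (shear_autoD w) polyCD; congr (_ + _); [exact: hp|exact: hq].
- by rewrite shearM (shear_autoM w) polyCM; congr (_ * _); [exact: hp|exact: hq].
Qed.

Lemma shear_autoKV w A : shear_auto (- w) (shear_auto w A) = A.
Proof. by move: (shear_autoK (- w) A); rewrite opprK. Qed.

Lemma shear_at0 w q : (shear w q).[0] = q.
Proof.
elim/mpoly_ring_ind: q => [a|i|p q hp hq|p q hp hq].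
- by rewrite shearC hornerC.
- by rewrite shearX hornerD hornerM hornerX !hornerC mulr0 addr0.
- by rewrite shearD hornerD; congr (_ + _).
- by rewrite shearM hornerM; congr (_ * _).
Qed.

Lemma shear_eval w q (t : 'rV[K]_m) z :
  (map_poly (meval (fun j => t 0 j)) (shear w q)).[z] =
  meval (fun j => (t + z *: w) 0 j) q.
Proof.
elim/mpoly_ring_ind: q => [a|i|p q hp hq|p q hp hq].
- by rewrite shearC map_polyC hornerC /= !mevalC.
- rewrite shearX rmorphD rmorphM /= !map_polyC map_polyX !hornerE /=.
  by rewrite !mevalXU mevalC !mxE mulrC.
- by rewrite shearD rmorphD hornerD mevalD; congr (_ + _).
- by rewrite shearM rmorphM hornerM mevalM; congr (_ * _).
Qed.
End Shear.

(** The automorphism is given by bare multiplicative maps, as its inverse is again a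
    substitution and not an abstract inverse morphism. *)
Lemma prime_transport (D : idomainType) (al be : D -> D) (a : D) :
  {morph al : x y / x * y} -> {morph be : x y / x * y} ->
  cancel al be -> cancel be al -> prime_element a -> prime_element (al a).
Proof.
move=> alM beM alK beK [a0 au ap].
have al0 : al 0 = 0.
  have h := alM (be 0) 0; rewrite mulr0 beK mul0r in h; exact: h.
have al1 : al 1 = 1 by rewrite -[RHS](beK 1) -[be 1]mul1r alM beK mulr1.
split.
- by apply: contraNneq a0 => e; rewrite -(alK a) e -{1}al0 alK.
- apply: contra au => /unitrP[v [va av]]; apply/unitrP; exists (be v).
  by split; apply: (can_inj alK); rewrite alM beK al1 ?va ?av.
- move=> b c [d e].
  have [|[t et]|[t et]] := ap (be b) (be c).
  + by exists (be d); rewrite -beM e beM alK.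
  + by left; exists (al t); rewrite -alM -et beK.
  + by right; exists (al t); rewrite -alM -et beK.
Qed.

(** If Q and B are coprime over the fractions, a Bezout identity with cleared
    denominators eliminates T. Otherwise primality makes Q associated to their greatest
    common divisor up to constants, so that it divides B. *)
Lemma prime_elimination (D : idomainType) (K : comNzRingType) (q b : D) (Q B : {poly D}) :
  prime_element Q -> (1 < size Q)%N -> Q.[0] = q -> B.[0] = b -> divides q b \/
  exists2 r : D, r != 0 & forall (phi : {rmorphism D -> K}) z,
    (map_poly phi Q).[z] = 0 -> (map_poly phi B).[z] = 0 -> phi r = 0.
Proof.
move=> [Q0 _ Qp] sQ eq eb.
have not_const (e : {poly D}) (s : D) (G : {poly D}) :
    (1 < size G)%N -> s != 0 -> s%:P <> e * G.
  move=> sG s0 e1; have := congr1 (fun p : {poly D} => size p) e1.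
  have G0 : G != 0 by rewrite -size_poly_gt0 ltnW.
  have e0 : e != 0 by apply: contraNneq s0 => z; rewrite -polyC_eq0 e1 z mul0r.
  rewrite size_polyC s0 size_mul //.
  have : (0 < size e)%N by rewrite size_poly_gt0.
  move: (size e) (size G) sG => a a' /=; lia.
have [co|nco] := boolP (coprimep Q B).
  right; have [[u v] /= huv] := Bezoutp Q B.
  have /size_poly1P[r r0 er] : size (u * Q + v * B) == 1%N by rewrite (eqp_size huv).
  exists r => // phi z qz bz; have := congr1 (fun p => (map_poly phi p).[z]) er.
  by rewrite map_polyC hornerC rmorphD !rmorphM hornerD !hornerM /= qz bz !mulr0 addr0.
left.
have [G0 dQ dB] : [/\ gcdp Q B != 0, gcdp Q B %| Q & gcdp Q B %| B].
  by rewrite gcdp_eq0 negb_and Q0 dvdp_gcdl dvdp_gcdr.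
have sG : (1 < size (gcdp Q B))%N by rewrite ltn_neqAle eq_sym nco size_poly_gt0.
have [[s W] /= s0 es] := Pdiv.Idomain.dvdpP _ _ dQ.
have [[s' W'] /= s'0 es'] := Pdiv.Idomain.dvdpP _ _ dB.
rewrite -mul_polyC in es; rewrite -mul_polyC in es'.
have [|[e eW]|[e eG]] := Qp W (gcdp Q B).
- by exists s%:P.
- exfalso; apply: (not_const e s (gcdp Q B)) => //; apply: (mulIf Q0).
  by rewrite es eW mulrAC.
have [|[e' es1]|[e' eB]] := Qp s'%:P B.
- by exists (W' * e); rewrite es' eG mulrA.
- by case: (not_const e' s' Q).
- by exists e'.[0]; rewrite -eq -eb eB hornerM.
Qed.

Section LocalNullstellensatz.
Variable R : rcfType.
Local Notation C := (complex R).
Local Notation nC := (@ComplexField.Normc.normc R).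
Local Notation P m := (mpoly.mpoly m C).

Definition spec m (t : 'rV[C]_m) (z : C) (A : {poly P m}) : C :=
  (map_poly (meval (fun j => t 0 j)) A).[z].

Lemma spec_const m (t : 'rV[C]_m) z c : spec t z c%:P = pev c t.
Proof. by rewrite /spec map_polyC hornerC. Qed.
Lemma spec_shear m (t w : 'rV[C]_m) z (q : P m) :
  spec t z (shear w q) = pev q (t + z *: w).
Proof. exact: shear_eval. Qed.

Lemma spec_poly m (A : {poly P m}) t : pev (lead_coef A) t != 0 -> exists q : {poly C},
  [/\ q != 0, size q = size A, forall z, q.[z] = spec t z A & forall i, q`_i = pev A`_i t].
Proof.
move=> lt_; exists (map_poly (meval (fun j => t 0 j)) A).
have A0 : A != 0 by apply: contraNneq lt_ => ->; rewrite lead_coef0 /pev meval0.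
have s : size (map_poly (meval (fun j => t 0 j)) A) = size A by apply: size_map_poly_id0.
split=> // [|i]; last by rewrite coef_map.
by rewrite -size_poly_gt0 s size_poly_gt0.
Qed.

Lemma pev_continuous m (q : P m) c (eps : R) : 0 < eps ->
  exists2 d : R, 0 < d & forall t, vn (t - c) < d -> nC (pev q t - pev q c) < eps.
Proof.
move=> e0; have [L L0 hL] := pev_lipschitz q (vn c + 1).
exists (Num.min 1 (eps / (L + 1))).
  by rewrite lt_min ltr01 divr_gt0 // ltr_wpDl.
move=> t; rewrite lt_min ltr_pdivlMr ?ltr_wpDl // => /andP[h1 h2].
have ht : vn t <= vn c + 1.
  by rewrite -[t](subrK c) (le_trans (vnD _ _)) // addrC lerD2l ltW.
have hc : vn c <= vn c + 1 by rewrite lerDl ler01.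
apply: le_lt_trans (hL _ _ ht hc) _; apply: le_lt_trans h2.
by rewrite mulrDr mulr1 mulrC lerDl vn_ge0.
Qed.

(** Roots persist under small displacements of the line: otherwise the size of q at
    parameter one would be controlled by its size at parameter zero. *)
Lemma zero_near m (q : P m) c w (eps : R) : 0 < eps ->
  pev q c = 0 -> pev q (c + w) != 0 ->
  exists2 d : R, 0 < d & forall t, vn (t - c) < d ->
    exists2 z, nC z < eps & pev q (t + z *: w) = 0.
Proof.
move=> e0 qc qw; pose N := size (shear w q); pose B := (1 + eps^-1) ^+ N.
have B1 : 1 <= B by rewrite exprn_ege1 // lerDl invr_ge0 ltW.
have B0 : 0 < B by apply: lt_le_trans B1.
pose a := nC (pev q (c + w)); have a0 : 0 < a by rewrite nC_gt0.
have eta0 : 0 < a / 2 / B by rewrite !divr_gt0 // ltr0n.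
have [d1 d10 h1] := pev_continuous q c eta0.
have a20 : 0 < a / 2 by rewrite divr_gt0 // ltr0n.
have [d2 d20 h2] := pev_continuous q (c + w) a20.
exists (Num.min d1 d2) => [|t]; first by rewrite lt_min d10.
rewrite lt_min => /andP[/h1]; rewrite qc subr0 ltr_pdivlMr // => hq.
move=> ht2; have {ht2} : vn (t + w - (c + w)) < d2 by rewrite opprD addrACA subrr addr0.
move=> /h2 hq2.
pose p := map_poly (meval (fun j => t 0 j)) (shear w q).
have pE z : p.[z] = pev q (t + z *: w) by apply: shear_eval.
have big : a / 2 < nC p.[1].
  rewrite pE scale1r; have := le_lt_trans (nC_sub_ge _ _) (_ : nC (pev q (c + w) - pev q (t + w)) < a / 2).
  rewrite nCBC => /(_ hq2); rewrite -/a; lra.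
have p0 : p != 0.
  by apply: contraTneq big => ->; rewrite horner0 nC0 -leNgt ltW.
have [[r /rootP pr hr]|no] := pselect (exists2 r, root p r & nC r < eps).
  by exists r => //; rewrite -pE.
have h r : root p r -> eps <= nC r.
  by move=> rr; rewrite leNgt; apply/negP => lr; apply: no; exists r.
have := growth_from_zero p0 e0 h.
have pe : p.[0] = pev q t by rewrite pE scale0r addr0.
have lB : (1 + eps^-1) ^+ (size p).-1 <= B.
  apply: ler_weXn2l; first by rewrite lerDl invr_ge0 ltW.
  by apply: leq_trans (leq_pred _) _; apply: size_poly.
rewrite pe => hh; have := le_trans hh (ler_wpM2l (nC_ge0 _) lB).
by move=> /(lt_le_trans big) /(lt_trans hq); rewrite ltxx.
Qed.

(** A local Nullstellensatz for one prime: if b vanishes on the zeros of the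
    prime q near one of them, then q divides b. If not, eliminating T from
    q(t + T w) and b(t + T w) leaves a nonzero polynomial in t that vanishes near
    the point, since each line there meets the zeros of q. *)
Theorem prime_divides m (q b : P m) c (d : R) :
  prime_element q -> pev q c = 0 -> 0 < d ->
  (forall t, vn (t - c) < d -> pev q t = 0 -> pev b t = 0) -> divides q b.
Proof.
move=> pq qc d0 hb; have [q0 _ _] := pq.
have [x [_ qx]] := nonvanishing_near c q0 d0.
pose w := x - c; have qw : pev q (c + w) != 0 by rewrite addrC subrK.
pose Q := shear w q; pose B := shear w b.
have pQ : prime_element Q.
  rewrite /Q -shear_auto_const.
  apply: (@prime_transport _ (shear_auto w) (shear_auto (- w))).
  - by move=> a a'; apply: shear_autoM.
  - by move=> a a'; apply: shear_autoM.
  - exact: shear_autoKV.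
  - exact: shear_autoK.
  - exact: prime_polyC.
have sQ : (1 < size Q)%N.
  rewrite ltnNge; apply/negP => /size1_polyC e.
  have h z : pev q (c + z *: w) = pev Q`_0 c.
    by rewrite -spec_shear -/Q e spec_const coefC.
  by move: qw; rewrite -[w]scale1r h -(h 0) scale0r addr0 qc eqxx.
have [//|[r r0 hr]] := prime_elimination C pQ sQ (shear_at0 w q) (shear_at0 w b).
have e0 : 0 < d / 2 / (1 + vn w).
    by rewrite !divr_gt0 ?ltr0n // ltr_pwDl // vn_ge0.
  have [d' d'0 hd'] := zero_near e0 qc qw.
  have m0 : 0 < Num.min d' (d / 2) by rewrite lt_min d'0 divr_gt0 // ltr0n.
  have [t [ht rt]] := nonvanishing_near c r0 m0.
  move: ht; rewrite lt_min => /andP[/hd'[z hz qz] ht].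
  have : pev b (t + z *: w) = 0.
    apply: hb => //; rewrite addrAC; apply: le_lt_trans (vnD _ _) _.
    rewrite vnZ [ltRHS](splitr d); apply: ltr_leD => //.
    move: hz; rewrite ltr_pdivlMr ?ltr_pwDl ?vn_ge0 // => /ltW; apply: le_trans.
    by rewrite ler_wpM2l ?nC_ge0 // lerDr ler01.
  move=> bz; have er := hr (meval (fun j => t 0 j)) z (etrans (shear_eval _ _ _ _) qz)
    (etrans (shear_eval _ _ _ _) bz).
  by rewrite /pev er eqxx in rt.
Qed.
End LocalNullstellensatz.

(** * Coefficients of minimal relations *)

(** A relation of least degree of a nonzero element has a nonzero constant
    coefficient. *)
Lemma divide_out_root (D E : idomainType) (G : {rmorphism D -> E}) (x : E) (A : {poly D}) :
  A != 0 -> A`_0 = 0 -> x != 0 -> (map_poly G A).[x] = 0 ->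
  exists A', [/\ A' != 0, (map_poly G A').[x] = 0 & (size A' < size A)%N].
Proof.
move=> A0 z x0 eA.
have eA' : A = drop_poly 1 A * 'X.
  apply/polyP => i; rewrite coefMX coef_drop_poly; case: i => [|i] //=.
  by rewrite addn1.
exists (drop_poly 1 A); split.
- by apply: contraNneq A0 => e; rewrite eA' e mul0r.
- have := congr1 (fun p => (map_poly G p).[x]) eA'.
  rewrite eA rmorphM hornerM /= map_polyX hornerX => /esym/eqP.
  by rewrite mulf_eq0 (negPf x0) orbF => /eqP.
- rewrite size_drop_poly; have : (0 < size A)%N by rewrite size_poly_gt0.
  by case: (size A) => // s _; rewrite subn1 /=.
Qed.

Section FibresAndCoefficients.
Variable R : rcfType.
Local Notation C := (complex R).
Local Notation nC := (@ComplexField.Normc.normc R).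
Local Notation P m := (mpoly.mpoly m C).

Definition evmap m n (f : 'I_m -> P n) (x : 'rV[C]_n) : 'rV[C]_m := \row_i pev (f i) x.

Lemma pev_row m (q : P m) (v : 'I_m -> C) : pev q (\row_j v j) = meval v q.
Proof. by apply: meval_eq => j; rewrite mxE. Qed.

Lemma evmapP m n (f : 'I_m -> P n) x (t : 'rV[C]_m) : (forall i, pev (f i) x = t 0 i) <-> evmap f x = t.
Proof.
split=> [h|<- i]; last by rewrite mxE.
by apply/rowP => i; rewrite mxE h.
Qed.

Variables (p : nat) (g : 'I_p -> P p).
Hypothesis ig : independent g.

(** Near c all coefficients are dominated by the k-th one where r does not vanish,
    hence everywhere by continuity. If the k-th coefficient vanished at c, then so
    would one of its prime factors q; all coefficients would vanish on the zeros of q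
    near c and be divisible by q, against primitivity. *)
Lemma critical_coefficient phi A k (r : P p) c (B d : R) :
  annihilator g phi A -> r != 0 -> A`_k != 0 -> 0 < d ->
  (forall t, vn (t - c) < d -> pev r t != 0 -> forall i,
     nC (pev A`_i t) <= B * nC (pev A`_k t)) ->
  pev A`_k c != 0.
Proof.
move=> [A0 _ _ prA] r0 ak0 d0 hB; apply/negP => /eqP akc.
have [u [l [uu lp e]]] := factorial_mpoly ak0.
have uc : pev u c != 0.
  move: uu => /unitrP[v [vu _]]; apply/negP => /eqP z.
  have := pevM v u c; rewrite vu z mulr0 -(mpolyC1 _) pevC => /eqP.
  by rewrite oner_eq0.
have [q ql qc] : exists2 q, q \in l & pev q c = 0.
  move: akc; rewrite e pevM => /eqP; rewrite mulf_eq0 (negPf uc) /=.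
  elim: l {lp e} => [|q l IH]; first by rewrite big_nil -(mpolyC1 _) pevC oner_eq0.
  rewrite big_cons pevM mulf_eq0 => /orP[/eqP qc|/IH[q' ql h]].
    by exists q => //; apply: mem_head.
  by exists q' => //; rewrite inE ql orbT.
have pq := lp _ ql.
have qak : divides q A`_k.
  rewrite e; elim: l ql {lp e} => // q' l IH.
  rewrite inE big_cons => /orP[/eqP <-|/IH[s es]].
    by exists (u * \prod_(j <- l) j); rewrite mulrCA mulrC.
  by exists (q' * s); rewrite mulrCA es mulrA.
apply: (prA q pq) => i.
apply: (prime_divides pq qc d0) => t ht qt.
have akt : pev A`_k t = 0 by have [s ->] := qak; rewrite pevM qt mulr0.
apply/eqP/negPn/negP => ait.
pose a := nC (pev A`_i t); have a0 : 0 < a by rewrite nC_gt0.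
pose B' := Num.max B 0 + 1.
have B'0 : 0 < B' by rewrite ltr_wpDl // le_max lexx orbT.
have BB' : B <= B' by rewrite (le_trans (_ : B <= Num.max B 0)) ?le_max ?lexx // lerDl.
have a20 : 0 < a / 2 by rewrite divr_gt0 // ltr0n.
have a2B : 0 < a / 2 / B' by rewrite divr_gt0.
have [d1 d10 h1] := pev_continuous A`_i t a20.
have [d2 d20 h2] := pev_continuous A`_k t a2B.
have d3 : 0 < d - vn (t - c) by rewrite subr_gt0.
have m0 : 0 < Num.min (d - vn (t - c)) (Num.min d1 d2) by rewrite !lt_min d3 d10 d20.
have [t' [ht' rt']] := nonvanishing_near t r0 m0.
move: ht'; rewrite !lt_min => /and3P[ht1 /h1 hi /h2 hk].
have lt' : vn (t' - c) < d.
  by apply: le_lt_trans (vn_tri t' t c) _; rewrite -ltrBrDr.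
have := hB t' lt' rt' i; move: hk; rewrite akt subr0 ltr_pdivlMr // => hk hi'.
have : nC (pev A`_i t') < a / 2.
  apply: le_lt_trans hi' _; apply: le_lt_trans hk; rewrite mulrC.
  by rewrite ler_wpM2l ?nC_ge0.
have := nC_sub_ge (pev A`_i t) (pev A`_i t'); rewrite nCBC -/a; lra.
Qed.

Section NearC.
Variables (phi : P p) (A : {poly P p}) (c : 'rV[C]_p) (d M : R).
Hypotheses (hA : annihilator g phi A) (d0 : 0 < d) (M0 : 0 <= M).
Hypothesis bounded : forall x, vn (evmap g x - c) < d -> nC (pev phi x) <= M.

Lemma generic_roots : exists2 r : P p, r != 0 & forall t, pev r t != 0 ->
   pev (lead_coef A) t != 0 /\ forall z, spec t z A = 0 ->
   exists2 x, evmap g x = t & pev phi x = z.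
Proof.
have [A0 _ _ _] := hA; have [r r0 hr] := roots_are_values ig hA.
exists (r * lead_coef A) => [|t]; first by rewrite mulf_neq0 ?lead_coef_eq0.
rewrite pevM mulf_eq0 negb_or => /andP[rt lt_]; split=> // z hz.
have [x hx ex] := hr (fun j => t 0 j) z rt hz.
exists (\row_j x j); last by rewrite pev_row.
by apply/evmapP => i; rewrite pev_row.
Qed.

(** If the values of phi on the fibres near c stay bounded, so do the roots of
    its minimal relation, hence the coefficients divided by the leading one. *)
Lemma lead_nonvanishing : pev (lead_coef A) c != 0.
Proof.
have [r r0 hr] := generic_roots.
have A0 : A != 0 by case: hA.
rewrite lead_coefE.
apply: (critical_coefficient (B := (1 + M) ^+ (size A).-1) hA r0 _ d0).
  by rewrite -lead_coefE lead_coef_eq0.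
move=> t ht rt i; have [lt_ ht'] := hr t rt; have [q [q0 sq qz qi]] := spec_poly lt_.
rewrite -!qi -sq -lead_coefE mulrC; apply: coef_bound => // z /rootP.
rewrite qz => /ht'[x ex <-]; apply: bounded; by rewrite ex.
Qed.

(** Likewise the reciprocals of the roots stay bounded when the values of phi
    stay away from zero. *)
Lemma constant_nonvanishing (eps : R) : phi != 0 -> 0 < eps ->
  (forall x, vn (evmap g x - c) < d -> eps <= nC (pev phi x)) -> pev A`_0 c != 0.
Proof.
move=> phi0 e0 heps; have [r r0 hr] := generic_roots.
have ak0 : A`_0 != 0.
  have [A0 eA mA _] := hA; apply/negP => /eqP z.
  have [A' [A'0 /(mA _ A'0) h]] := divide_out_root A0 z phi0 eA.
  by rewrite ltnNge h.
apply: (critical_coefficient (B := (1 + M) ^+ (size A).-1 / eps ^+ (size A).-1)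
          hA r0 ak0 d0).
move=> t ht rt i; have [lt_ ht'] := hr t rt; have [q [q0 sq qz qi]] := spec_poly lt_.
have h1 : nC q`_i <= nC (lead_coef q) * (1 + M) ^+ (size q).-1.
  apply: coef_bound => // z /rootP; rewrite qz => /ht'[x ex <-].
  by apply: bounded; rewrite ex.
have h2 : nC (lead_coef q) * eps ^+ (size q).-1 <= nC q`_0.
  apply: constant_bound => // z /rootP; rewrite qz => /ht'[x ex <-].
  by apply: heps; rewrite ex.
rewrite -!qi -sq mulrAC ler_pdivlMr ?exprn_gt0 //.
have := ler_wpM2r (exprn_ge0 (size q).-1 (ltW e0)) h1.
move=> h; apply: le_trans h _; rewrite mulrAC mulrC ler_wpM2l //.
by rewrite exprn_ge0 // addr_ge0.
Qed.
End NearC.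
End FibresAndCoefficients.

(** * Fibres over nearby values *)

Lemma seq_lower_bound (R : rcfType) (T : eqType) (s : seq T) (F : T -> R) (eps : R) :
  0 < eps -> (forall y, y \in s -> 0 < F y) ->
  exists m, [/\ 0 < m, m <= eps & forall y, y \in s -> m <= F y].
Proof.
move=> e0; elim: s => [|y s IH] h; first by exists eps.
have [|m [m0 me mF]] := IH; first by move=> z zs; apply: h; rewrite inE zs orbT.
exists (Num.min m (F y)); split; first by rewrite lt_min m0 h ?mem_head.
  by rewrite ge_min me.
by move=> z; rewrite inE ge_min => /orP[/eqP ->|/mF ->] //; rewrite lexx orbT.
Qed.

Section Near.
Variable R : rcfType.
Local Notation C := (complex R).
Local Notation nC := (@ComplexField.Normc.normc R).

(** Neighbourhoods for the norm vn, over an arbitrary real closed field. *)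
Definition near_pt n (c : 'rV[C]_n) (Q : 'rV[C]_n -> Prop) : Prop :=
  exists2 d : R, 0 < d & forall t, vn (t - c) < d -> Q t.

Variable n : nat.
Implicit Types (c : 'rV[C]_n) (Q : 'rV[C]_n -> Prop).

Lemma near_at c Q : near_pt c Q -> Q c.
Proof. by move=> [d d0]; apply; rewrite subrr vn0. Qed.

Lemma near_mono c Q Q' : (forall t, Q t -> Q' t) -> near_pt c Q -> near_pt c Q'.
Proof. by move=> h [d d0 hd]; exists d => // t /hd /h. Qed.

Lemma near_and c Q Q' : near_pt c Q -> near_pt c Q' -> near_pt c (fun t => Q t /\ Q' t).
Proof.
move=> [d d0 hd] [d' d'0 hd']; exists (Num.min d d') => [|t]; first by rewrite lt_min d0.
by rewrite lt_min => /andP[/hd ? /hd' ?].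
Qed.

Lemma near_seq c (I : eqType) (s : seq I) (Q : I -> 'rV[C]_n -> Prop) :
  (forall i, i \in s -> near_pt c (Q i)) ->
  near_pt c (fun t => forall i, i \in s -> Q i t).
Proof.
elim: s => [|i s IH] h; first by exists 1.
have hi := h i (mem_head _ _).
have [|d d0 hd] := near_and hi (IH _).
  by move=> j js; apply: h; rewrite inE js orbT.
by exists d => // t /hd[Qi Qs] j; rewrite inE => /orP[/eqP -> //|/Qs].
Qed.

Lemma near_all c (I : finType) (Q : I -> 'rV[C]_n -> Prop) :
  (forall i, near_pt c (Q i)) -> near_pt c (fun t => forall i, Q i t).
Proof.
move=> h; have := @near_seq c I (enum I) Q (fun i _ => h i).
by apply: near_mono => t ht i; apply: ht; rewrite mem_enum.
Qed.

Lemma near_ball c (e : R) : 0 < e -> near_pt c (fun t => vn (t - c) < e).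
Proof. by move=> e0; exists e. Qed.

Lemma near_pev c (q : mpoly.mpoly n C) (e : R) : 0 < e ->
  near_pt c (fun t => nC (pev q t - pev q c) < e).
Proof. by move=> /(pev_continuous q c)[d d0 hd]; exists d. Qed.

Lemma near_evmap m (f : 'I_m -> mpoly.mpoly n C) c (e : R) : 0 < e ->
  near_pt c (fun t => vn (evmap f t - evmap f c) < e).
Proof.
move=> e0; have e' : 0 < e / m.+1%:R by rewrite divr_gt0 // ltr0n.
have := near_all (fun i => near_pev c (f i) e'); apply: near_mono => t h.
by apply: vn_lt_of_coord => // j; rewrite !mxE ltW.
Qed.

Lemma near_nonzero c (q : mpoly.mpoly n C) : pev q c != 0 ->
  near_pt c (fun t => nC (pev q c) / 2 < nC (pev q t)).
Proof.
rewrite -nC_gt0 => h; have h2 : 0 < nC (pev q c) / 2 by rewrite divr_gt0 // ltr0n.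
apply: near_mono (near_pev c q h2) => t ht.
have := nC_sub_ge (pev q c) (pev q t); rewrite nCBC; lra.
Qed.
End Near.

Section FibreNear.
Variable R : rcfType.
Local Notation C := (complex R).
Local Notation nC := (@ComplexField.Normc.normc R).
Local Notation P m := (mpoly.mpoly m C).

(** Cauchy's bound, without division by the leading coefficient. *)
Lemma cauchy_root_bound (q : {poly C}) z : q != 0 -> root q z ->
  nC z <= 1 \/ nC (lead_coef q) * nC z <= \sum_(i < (size q).-1) nC q`_i.
Proof.
move=> q0 /rootP qz; have [|z1] := leP (nC z) 1; [by left|right].
have sq : size q = (size q).-1.+1 by rewrite prednK // size_poly_gt0.
move: qz; rewrite horner_coef sq big_ord_recr /= => /eqP.
rewrite addrC addr_eq0 -lead_coefE; set N := (size q).-1 => /eqP e.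
case EN : N e => [|N'] e.
  move: e; rewrite big_ord0 oppr0 expr0 mulr1 => /eqP.
  by rewrite lead_coef_eq0 (negPf q0).
have zN : 0 < nC z ^+ N' by rewrite exprn_gt0 // (lt_trans ltr01).
have E : nC (lead_coef q) * nC z * nC z ^+ N' = nC (lead_coef q * z ^+ N'.+1).
  by rewrite nCM nCX exprS mulrA.
rewrite -(ler_pM2r zN) E e nCN.
apply: le_trans (nC_sum _ _ _) _; rewrite mulr_suml; apply: ler_sum => i _.
rewrite nCM nCX ler_wpM2l ?nC_ge0 // ler_weXn2l //; last by rewrite -ltnS.
exact: ltW.
Qed.

Variables (p : nat) (g : 'I_p -> P p).

Lemma relation_at phi A x : (map_poly (mmap (@mpolyC p C) g) A).[phi] = 0 ->
  spec (evmap g x) (pev phi x) A = 0.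
Proof.
move=> e; have := meval_at g phi A (fun j => x 0 j); rewrite e meval0 => ->.
have E : map_poly (meval (fun j => evmap g x 0 j)) A =
         map_poly (meval (fun i => meval (fun j => x 0 j) (g i))) A.
  by apply: eq_map_poly => q; apply: meval_eq => i; rewrite mxE.
by rewrite /spec E.
Qed.

(** Where the leading coefficient of a relation does not vanish, its roots are
    bounded and depend continuously on the base point. *)
Lemma values_near_roots phi A c (eps : R) : A != 0 ->
  (map_poly (mmap (@mpolyC p C) g) A).[phi] = 0 ->
  pev (lead_coef A) c != 0 -> 0 < eps ->
  near_pt c (fun t => forall x, evmap g x = t ->
    exists2 r, spec c r A = 0 & nC (pev phi x - r) < eps).
Proof.
move=> A0 eA lc e0; pose l := nC (pev (lead_coef A) c).
have l0 : 0 < l by rewrite nC_gt0.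
pose N := (size A).-1.
pose B := \sum_(i < N) (nC (pev A`_i c) + 1).
have B0 : 0 <= B by apply: sumr_ge0 => i _; rewrite addr_ge0 ?nC_ge0.
pose M := 1 + 2 * B / l.
have M1 : 1 <= M by rewrite lerDl divr_ge0 ?mulr_ge0 // ltW.
have M0 : 0 <= M by apply: le_trans M1.
pose eta := l * eps ^+ N.
have eta0 : 0 < eta by rewrite mulr_gt0 // exprn_gt0.
have W0 : 0 < \sum_(i < size A) M ^+ i + 1.
  by rewrite ltr_wpDl //; apply: sumr_ge0 => i _; rewrite exprn_ge0.
pose eta' := eta / (\sum_(i < size A) M ^+ i + 1).
have eta'0 : 0 < eta' by rewrite divr_gt0.
have n1 := near_nonzero lc.
have n2 := near_all (fun i : 'I_(size A) => near_pev c A`_i (ltr01 : 0 < 1 :> R)).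
have n3 := near_all (fun i : 'I_(size A) => near_pev c A`_i eta'0).
apply: near_mono (near_and n1 (near_and n2 n3)) => t [h1 [h2 h3]] x ex.
have lt_ : pev (lead_coef A) t != 0.
  by rewrite -nC_gt0; apply: lt_trans h1; rewrite divr_gt0 // ltr0n.
have [qt [qt0 sqt qtz qti]] := spec_poly lt_; have [qc [qc0 sqc qcz qci]] := spec_poly lc.
set z := pev phi x.
have zt : qt.[z] = 0 by rewrite qtz -ex relation_at.
have zM : nC z <= M.
  have [h|] := cauchy_root_bound qt0 (introT rootP zt); first exact: le_trans M1.
  rewrite lead_coefE sqt qti -lead_coefE => h.
  have hB : \sum_(i < (size A).-1) nC qt`_i <= B.
    apply: ler_sum => i _; rewrite qti.
    have iA : (i < size A)%N by apply: leq_trans (ltn_ord i) (leq_pred _).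
    have := h2 (Ordinal iA) => /= h2'.
    have := nC_sub_ge (pev A`_i t) (pev A`_i c); lra.
  have h3' := le_trans h hB.
  have : l / 2 * nC z <= B.
    by apply: le_trans h3'; rewrite ler_wpM2r ?nC_ge0 // ltW.
  move=> h4; have h5 : nC z <= 2 * B / l.
    by rewrite ler_pdivlMr // mulrC -ler_pdivrMl // mulrA (mulrC 2^-1).
  by apply: le_trans h5 _; rewrite /M lerDr ler01.
have : nC qc.[z] < eta.
  have -> : qc.[z] = \sum_(i < size A) (qc`_i - qt`_i) * z ^+ i.
    have -> : qc.[z] = qc.[z] - qt.[z] by rewrite zt subr0.
    rewrite !horner_coef sqc sqt -sumrB; apply: eq_bigr => i _.
    by rewrite mulrBl.
  apply: le_lt_trans (nC_sum _ _ _) _.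
  have hs : \sum_(i < size A) nC ((qc`_i - qt`_i) * z ^+ i) <=
         \sum_(i < size A) eta' * M ^+ i.
    apply: ler_sum => i _; rewrite nCM nCX; apply: ler_pM; rewrite ?nC_ge0 ?exprn_ge0 ?nC_ge0 //.
      by rewrite qci qti nCBC ltW // h3.
    by rewrite lerXn2r ?nnegrE ?nC_ge0.
  apply: le_lt_trans hs _; rewrite -mulr_sumr /eta' mulrAC ltr_pdivrMr //.
  by rewrite ltr_pM2l // ltrDl ltr01.
have -> : eta = nC (lead_coef qc) * eps ^+ (size qc).-1.
  by rewrite /eta /l /N sqc (lead_coefE qc) sqc qci -lead_coefE.
by move=> /(root_near qc0 e0)[r /rootP rr hr]; exists r => //; rewrite -qcz.
Qed.

Variable A : 'I_p -> {poly P p}.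
Hypothesis hA : forall j, A j != 0 /\
  (map_poly (mmap (@mpolyC p C) g) (A j)).[mpolyX C (mnm1 j)] = 0.

(** The candidates for limits of fibres are the points whose coordinates are roots
    at c of the relations of the coordinates: finitely many, with a bound that does
    not depend on c. *)
Lemma fibre_grid c : (forall j, pev (lead_coef (A j)) c != 0) ->
  exists G : seq 'rV[C]_p, (size G <= (\max_j size (A j)) ^ p)%N /\
   forall eps : R, 0 < eps ->
    near_pt c (fun t => forall x, evmap g x = t -> exists2 y, y \in G & vn (x - y) < eps).
Proof.
move=> lc; pose L := \max_j size (A j).
have H j : exists rs : seq C, (size rs <= L)%N /\ forall z, spec c z (A j) = 0 -> z \in rs.
  pose q := map_poly (meval (fun i => c 0 i)) (A j).
  have q0 : q != 0.
    rewrite -size_poly_gt0 size_map_poly_id0; last exact: lc.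
    by rewrite size_poly_gt0; case: (hA j).
  have [rs [srs _ e _]] := nC_horner_prod q; exists rs; split.
    rewrite -srs //; apply: leq_trans (leq_pred _) _.
    by apply: leq_trans (size_poly _ _) _; apply: (leq_bigmax j).
  move=> z hz; have : root q z by apply/rootP.
  by rewrite e rootZ ?lead_coef_eq0 // root_prod_XsubC.
have [rs hrs] := choice H.
pose pt (u : {ffun 'I_p -> 'I_L}) : 'rV[C]_p := \row_j nth 0 (rs j) (u j).
exists [seq pt u | u <- enum {ffun 'I_p -> 'I_L}]; split.
  by rewrite size_map -cardE card_ffun !card_ord.
move=> eps e0.
have e1 : 0 < eps / p.+1%:R by rewrite divr_gt0 // ltr0n.
have := near_all (fun j => values_near_roots (proj1 (hA j)) (proj2 (hA j)) (lc j) e1).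
apply: near_mono => t ht x ex.
have H2 j : exists r : C, r \in rs j /\ nC (x 0 j - r) < eps / p.+1%:R.
  have [r hr hx] := ht j x ex; exists r; split; first by apply: (hrs j).2.
  by rewrite -pevX.
have [r hr] := choice H2.
have lt_ j : (index (r j) (rs j) < L)%N.
  by apply: leq_trans (hrs j).1; rewrite index_mem; case: (hr j).
exists (pt [ffun j => Ordinal (lt_ j)]); first by apply: map_f; rewrite mem_enum.
apply: vn_lt_of_coord => // j; rewrite !mxE ffunE /= nth_index; last by case: (hr j).
by apply: ltW; case: (hr j).
Qed.

(** Of the finite grid of candidates, those outside the fibre repel the preimage of
    a neighbourhood of c, by continuity of g; so the preimage gathers around the
    fibre. *)
Theorem fibre_near c : (forall j, pev (lead_coef (A j)) c != 0) ->
  exists F : seq 'rV[C]_p, [/\ (size F <= (\max_j size (A j)) ^ p)%N,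
   forall x, (x \in F) <-> evmap g x = c &
   forall eps : R, 0 < eps ->
    near_pt c (fun t => forall x, evmap g x = t -> exists2 y, y \in F & vn (x - y) < eps)].
Proof.
move=> /fibre_grid[G [sG hG]]; exists [seq y <- G | evmap g y == c].
have key (eps : R) : 0 < eps -> near_pt c (fun t => forall x, evmap g x = t ->
    exists2 y, y \in [seq y <- G | evmap g y == c] & vn (x - y) < eps).
  move=> e0.
  have H y : exists2 d : R, 0 < d & evmap g y != c ->
     forall x, vn (x - y) < d -> d <= vn (evmap g x - c).
    have [_|ne] := eqVneq (evmap g y) c; first by exists 1.
    pose a := vn (evmap g y - c); have a0 : 0 < a by apply: vn_gt0.
    have a20 : 0 < a / 2 by rewrite divr_gt0 // ltr0n.
    have [d d0 hd] := near_evmap g y a20.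
    exists (Num.min d (a / 2)) => [|_ x]; first by rewrite lt_min d0.
    rewrite lt_min => /andP[/hd h _].
    have := vn_tri (evmap g y) (evmap g x) c; rewrite (vnBC (evmap g y) (evmap g x)) -/a => h'.
    by rewrite ge_min; apply/orP; right; clear -h h'; lra.
  have [d hd] := choice (fun y => let: ex_intro2 d d0 h := H y in
     ex_intro (fun d => 0 < d /\ (evmap g y != c ->
     forall x, vn (x - y) < d -> d <= vn (evmap g x - c))) d (conj d0 h)).
  have [m [m0 me mle]] := seq_lower_bound e0 (fun y (_ : y \in G) => (hd y).1).
  apply: near_mono (near_and (hG m m0) (near_ball c m0)) => t [ht tm] x ex.
  have [y yG hy] := ht x ex; exists y; last exact: lt_le_trans me.
  rewrite mem_filter yG andbT; apply/negPn/negP => ny.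
  have := (hd y).2 ny x (lt_le_trans hy (mle _ yG)); rewrite ex leNgt.
  by rewrite (lt_le_trans tm (mle _ yG)).
split=> // [|x]; first by rewrite size_filter (leq_trans (count_size _ _)).
split=> [|ex]; first by rewrite mem_filter => /andP[/eqP].
apply/negPn/negP => xF.
set F := [seq y <- G | evmap g y == c] in key xF *.
have pos y : y \in F -> 0 < vn (x - y).
  by move=> yF; apply: vn_gt0; apply: contraNneq xF => ->.
have [m [m0 _ mle]] := seq_lower_bound (ltr01 : 0 < 1 :> R) pos.
have [y yF] := near_at (key m m0) x ex; apply/negP; rewrite -leNgt.
exact: mle.
Qed.
End FibreNear.

(** * The inverse function theorem *)

Section StrictDifferentiability.
Variable R : rcfType.
Local Notation C := (complex R).
Local Notation nC := (@ComplexField.Normc.normc R).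
Local Notation P m := (mpoly.mpoly m C).

(** The differential of f at x: points are rows, so it acts on the right and is the
    transpose of the usual Jacobian matrix. *)
Definition diffmx m n (f : 'I_m -> P n) (x : 'rV[C]_n) : 'M[C]_(n, m) :=
  \matrix_(j, i) pev (mderiv j (f i)) x.

Definition mxn m n (E : 'M[C]_(m, n)) : R := \sum_i \sum_j nC (E i j).

Lemma mxn_ge0 m n (E : 'M[C]_(m, n)) : 0 <= mxn E.
Proof. by do 2![apply: sumr_ge0 => ? _]; apply: nC_ge0. Qed.

Lemma vn_mulmx m n (v : 'rV[C]_m) (E : 'M[C]_(m, n)) : vn (v *m E) <= mxn E * vn v.
Proof.
rewrite /mxn exchange_big mulr_suml {1}/vn; apply: ler_sum => j _; rewrite mxE.
apply: le_trans (nC_sum _ _ _) _; rewrite mulr_suml; apply: ler_sum => i _.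
by rewrite nCM mulrC ler_wpM2l ?nC_ge0 ?nC_le_vn.
Qed.

Lemma strict_diff_poly n (q : P n) x0 (eta : R) : 0 < eta ->
  exists2 rho, 0 < rho & forall x y, vn (x - x0) < rho -> vn (y - x0) < rho ->
    nC (pev q y - pev q x - pdiff q x0 (y - x)) <= eta * vn (y - x).
Proof.
move=> e0; have [L L0 hL] := pev_taylor q (vn x0 + 1).
have e2 : 0 < eta / 2 / n.+1%:R by rewrite !divr_gt0 // ltr0n.
have [d d0 hd] := near_all (fun j => near_pev x0 (mderiv j q) e2).
pose b := eta / (4 * (L + 1)).
have b0 : 0 < b by rewrite divr_gt0 // mulr_gt0 ?ltr0n // ltr_wpDl.
exists (Num.min 1 (Num.min d b)) => [|x y]; first by rewrite !lt_min ltr01 d0.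
rewrite !lt_min => /and3P[x1 xd xb] /and3P[y1 yd yb].
have bnd z : vn (z - x0) < 1 -> vn z <= vn x0 + 1.
  by move=> h; rewrite -[z](subrK x0) (le_trans (vnD _ _)) // addrC lerD2l ltW.
have h1 := hL x y (bnd x x1) (bnd y y1).
have -> : pev q y - pev q x - pdiff q x0 (y - x) =
   (pev q y - pev q x - pdiff q x (y - x)) + (pdiff q x (y - x) - pdiff q x0 (y - x)).
  by rewrite addrA subrK.
apply: le_trans (nCD _ _) _; rewrite [eta]splitr mulrDl; apply: lerD.
  apply: le_trans h1 _; rewrite expr2 mulrA ler_wpM2r ?vn_ge0 //.
  have : vn (y - x) <= 2 * b.
    apply: le_trans (vn_tri y x0 x) _; rewrite (vnBC x0) mulr_natl mulr2n.
    by apply: lerD; apply: ltW.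
  move=> h; apply: le_trans (ler_wpM2l L0 h) _.
  have -> : L * (2 * b) = eta / 2 * (L / (L + 1)).
    rewrite /b; field; rewrite ?gt_eqF ?ltr_wpDl //.
  rewrite ger_pMr ?divr_gt0 ?ltr0n // ler_pdivrMr ?ltr_wpDl // mul1r.
  by rewrite lerDl ler01.
rewrite /pdiff -sumrB; apply: le_trans (nC_sum _ _ _) _.
have H : \sum_(j < n) nC (pev (mderiv j q) x * (y - x) 0 j -
      pev (mderiv j q) x0 * (y - x) 0 j) <= \sum_(j < n) (eta / 2 / n.+1%:R) * vn (y - x).
  apply: ler_sum => j _; rewrite -mulrBl nCM; apply: ler_pM; rewrite ?nC_ge0 ?nC_le_vn //.
  by apply: ltW; apply: hd.
apply: le_trans H _; rewrite sumr_const card_ord -[leLHS]mulr_natl mulrA ler_wpM2r ?vn_ge0 //.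
rewrite mulrCA ger_pMr ?divr_gt0 ?ltr0n // ler_pdivrMr ?ltr0n // mul1r ler_nat //.
Qed.

(** Strict differentiability: both points vary, as the contraction estimate for the
    inverse function theorem requires. *)
Lemma strict_diff m n (f : 'I_m -> P n) x0 (eta : R) : 0 < eta ->
  exists2 rho, 0 < rho & forall x y, vn (x - x0) < rho -> vn (y - x0) < rho ->
    vn (evmap f y - evmap f x - (y - x) *m diffmx f x0) <= eta * vn (y - x).
Proof.
move=> e0; have e1 : 0 < eta / m.+1%:R by rewrite divr_gt0 // ltr0n.
have [r hr] := choice (fun i => let: ex_intro2 r r0 h := strict_diff_poly (f i) x0 e1 in
  ex_intro (fun r => 0 < r /\ forall x y, vn (x - x0) < r -> vn (y - x0) < r ->
    nC (pev (f i) y - pev (f i) x - pdiff (f i) x0 (y - x)) <=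
    eta / m.+1%:R * vn (y - x)) r (conj r0 h)).
have [rho [rho0 _ hrho]] := seq_lower_bound (ltr01 : 0 < 1 :> R)
   (fun i (_ : i \in enum 'I_m) => (hr i).1).
exists rho => // x y hx hy.
have hi i : vn (x - x0) < r i /\ vn (y - x0) < r i.
  by split; apply: lt_le_trans (hrho i _) => //; rewrite mem_enum.
apply: le_trans (vn_le_of_coord (e := eta / m.+1%:R * vn (y - x)) _) _ => [i|].
  rewrite !mxE; have [h1 h2] := hi i; have := (hr i).2 x y h1 h2.
  congr (nC (_ - _) <= _); apply: eq_bigr => j _.
  by rewrite !mxE mulrC.
rewrite mulrA ler_wpM2r ?vn_ge0 // mulrCA ger_pMr //.
by rewrite ler_pdivrMr ?ltr0n // mul1r ler_nat.
Qed.

Lemma det_diffmx p (g : 'I_p -> P p) x : \det (diffmx g x) = pev (jacobian g) x.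
Proof.
rewrite -det_tr /jacobian /pev -(det_map_mx (meval (fun j => x 0 j))); congr (\det _).
by apply/matrixP => i j; rewrite !mxE.
Qed.

Lemma diffmx_unit p (g : 'I_p -> P p) x : pev (jacobian g) x != 0 -> diffmx g x \in unitmx.
Proof.
by rewrite unitmxE unitfE det_diffmx.
Qed.
End StrictDifferentiability.

(** Banach's fixed point theorem is applied to real rows; this makes them a complete
    normed space. *)
HB.instance Definition _ (R : realType) (m n : nat) := Complete.on (matrix R m n).

Section Realification.
Variable R : realType.
Local Notation C := (complex R).
Local Notation nC := (@ComplexField.Normc.normc R).

Definition unrealify n (u : 'rV[R]_(n + n)) : 'rV[C]_n :=
  \row_j Complex (lsubmx u 0 j) (rsubmx u 0 j).

Lemma realifyK n : cancel (@realify R n) (@unrealify n).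
Proof.
move=> z; apply/rowP => j; rewrite mxE /realify row_mxKl row_mxKr !mxE.
by case: (z 0 j).
Qed.

Lemma unrealifyK n : cancel (@unrealify n) (@realify R n).
Proof.
move=> u; rewrite /realify -[RHS]hsubmxK; congr row_mx; apply/rowP => j; by rewrite !mxE.
Qed.

Lemma realifyD n (x y : 'rV[C]_n) : realify (x + y) = realify x + realify y.
Proof.
rewrite /realify add_row_mx; congr row_mx; apply/rowP => j; rewrite !mxE;
  by case: (x 0 j); case: (y 0 j).
Qed.

Lemma realifyN n (x : 'rV[C]_n) : realify (- x) = - realify x.
Proof.
rewrite /realify opp_row_mx; congr row_mx; apply/rowP => j; rewrite !mxE;
  by case: (x 0 j).
Qed.

Lemma realifyB n (x y : 'rV[C]_n) : realify (x - y) = realify x - realify y.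
Proof. by rewrite realifyD realifyN. Qed.

Lemma Re_le_nC (z : C) : `|complex.Re z| <= nC z.
Proof.
case: z => a b; rewrite /ComplexField.Normc.normc /= -(sqrtr_sqr a) ler_sqrt.
  by rewrite lerDl sqr_ge0.
by rewrite addr_ge0 ?sqr_ge0.
Qed.

Lemma Im_le_nC (z : C) : `|complex.Im z| <= nC z.
Proof.
case: z => a b; rewrite /ComplexField.Normc.normc /= -(sqrtr_sqr b) ler_sqrt.
  by rewrite lerDr sqr_ge0.
by rewrite addr_ge0 ?sqr_ge0.
Qed.

Lemma nC_le_ReIm (z : C) : nC z <= `|complex.Re z| + `|complex.Im z|.
Proof.
case: z => a b; rewrite /ComplexField.Normc.normc /=.
rewrite -[leRHS]ger0_norm ?addr_ge0 // -sqrtr_sqr ler_sqrt ?sqr_ge0 //.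
by rewrite sqrrD !real_normK ?num_real // addrAC lerDl mulrn_wge0 // mulr_ge0.
Qed.

Lemma row_norm_coord n (u : 'rV[R]_n) j : `|u 0 j| <= `|u|.
Proof. by rewrite [leRHS]/Num.norm /= mx_normrE; apply: le_trans (le_bigmax _ _ (0, j)). Qed.

Lemma row_norm_le n (u : 'rV[R]_n) e : 0 <= e -> (forall j, `|u 0 j| <= e) -> `|u| <= e.
Proof.
move=> e0 h; rewrite [leLHS]/Num.norm /= mx_normrE; apply: bigmax_le => // -[i j] _ /=.
by rewrite ord1.
Qed.

Lemma norm_realify_le n (x : 'rV[C]_n) : `|realify x| <= vn x.
Proof.
apply: row_norm_le => [|j]; first exact: vn_ge0.
rewrite /realify; case: (split_ordP j) => k ->.
  by rewrite row_mxEl mxE (le_trans (Re_le_nC _)) // nC_le_vn.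
by rewrite row_mxEr mxE (le_trans (Im_le_nC _)) // nC_le_vn.
Qed.

Lemma vn_le_realify n (x : 'rV[C]_n) : vn x <= (n%:R * 2) * `|realify x|.
Proof.
rewrite -mulrA; apply: vn_le_of_coord => j; apply: le_trans (nC_le_ReIm _) _.
rewrite mulr_natl mulr2n; apply: lerD.
  have -> : complex.Re (x 0 j) = realify x 0 (lshift n j) by rewrite row_mxEl mxE.
  exact: row_norm_coord.
have -> : complex.Im (x 0 j) = realify x 0 (rshift n j) by rewrite row_mxEr mxE.
exact: row_norm_coord.
Qed.

(** The ball of radius rho is stable because its centre moves by at most rho / 2. *)
Lemma contraction_fixpoint n (phi : 'rV[C]_n -> 'rV[C]_n) x0 (rho : R) : 0 < rho ->
  (forall x y, `|realify (x - x0)| <= rho -> `|realify (y - x0)| <= rho ->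
     `|realify (phi x - phi y)| <= 2^-1 * `|realify (x - y)|) ->
  `|realify (phi x0 - x0)| <= rho / 2 ->
  exists2 x, `|realify (x - x0)| <= rho & phi x = x.
Proof.
move=> r0 hphi h0.
pose U := closed_ball_ Num.norm (realify x0) rho : set 'rV[R]_(n + n).
pose X : completeNormedModType R := 'rV[R]_(n + n).
pose F u := realify (phi (unrealify u)).
have UE u : U u <-> `|realify (unrealify u - x0)| <= rho.
  by rewrite /U /closed_ball_ /= realifyB unrealifyK distrC.
have x0U : `|realify (x0 - x0)| <= rho.
  by rewrite realifyB subrr normr0 ltW.
have FU : {homo F : x / U x >-> U x}.
  move=> u /UE hu; apply/UE; rewrite /F realifyK.
  have -> : phi (unrealify u) - x0 = (phi (unrealify u) - phi x0) + (phi x0 - x0).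
    by rewrite addrA subrK.
  rewrite realifyD; apply: le_trans (ler_normD _ _) _; rewrite [rho]splitr; apply: lerD => //.
  apply: le_trans (hphi _ _ hu x0U) _; rewrite mulrC ler_pM2r ?invr_gt0 ?ltr0n //.
have ctr : is_contraction (mkfun_fun FU).
  exists (2^-1)%:nng; split; first by rewrite /= invf_lt1 ?ltr0n // ltr1n.
  move=> [u v] /= [/UE hu /UE hv].
  rewrite -realifyB; apply: le_trans (hphi _ _ hu hv) _.
  by rewrite realifyB !unrealifyK.
have [|u /UE hu eu] := @banach_fixed_point R X U (mkfun_fun FU) ctr (@closed_closed_ball_ _ X _ _).
  by exists (realify x0); apply/UE; rewrite realifyK.
have eu' : u = realify (phi (unrealify u)) by exact: eu.
by exists (unrealify u) => //; rewrite {2}eu' realifyK.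
Qed.
End Realification.

Section LocalInverse.
Variable R : realType.
Local Notation C := (complex R).
Local Notation P m := (mpoly.mpoly m C).
Variables (p : nat) (g : 'I_p -> P p).

(** The inverse function theorem at a point with invertible differential: the
    Newton map with frozen differential is a contraction. The last clause
    provides the sections of g, the first estimate their Lipschitz constant. *)
Theorem local_inverse x0 : pev (jacobian g) x0 != 0 -> exists kappa rho : R,
  [/\ 0 < kappa, 0 < rho,
      forall x y, vn (x - x0) < rho -> vn (y - x0) < rho ->
        vn (x - y) <= kappa * vn (evmap g x - evmap g y),
      forall x, vn (x - x0) < rho -> pev (jacobian g) x != 0 &
      forall r, 0 < r ->
        near_pt (evmap g x0) (fun t => exists2 x, vn (x - x0) < r & evmap g x = t)].
Proof.
move=> J0; have uD := diffmx_unit J0; set D := diffmx g x0 in uD.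
pose E := invmx D; pose e := mxn E; have e0 : 0 <= e by apply: mxn_ge0.
have e1 : 0 < e + 1 by rewrite ltr_wpDl.
(* The factor p + 1 absorbs the constant between the norm vn and the sup norm on *)
(* real coordinates for which the contraction is stated. *)
pose eta : R := (4 * (e + 1) * (p%:R + 1))^-1.
have p1 : 0 < p%:R + 1 :> R by rewrite ltr_wpDl.
have eta0 : 0 < eta by rewrite invr_gt0 !mulr_gt0 // ltr0n.
have [rho1 rho10 h1] := strict_diff g x0 eta0.
have [rho2 rho20 h2] := near_nonzero J0.
pose rho := Num.min rho1 rho2.
have rho0 : 0 < rho by rewrite lt_min rho10.
have he : e / (e + 1) <= 1 by rewrite ler_pdivrMr // mul1r lerDl.
have hp : p%:R / (p%:R + 1) <= 1 :> R by rewrite ler_pdivrMr // mul1r lerDl.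
have eE : e * eta * (p%:R * 2) <= 2^-1.
  have -> : e * eta * (p%:R * 2) = 2^-1 * (e / (e + 1) * (p%:R / (p%:R + 1))).
    by rewrite /eta; field; rewrite ?gt_eqF.
  rewrite ger_pMr ?invr_gt0 ?ltr0n //.
  by apply: mulr_ile1 => //; rewrite divr_ge0 // ltW.
have eE' : e * eta <= 2^-1.
  have -> : e * eta = 4^-1 * (e / (e + 1) * (p%:R + 1)^-1).
    by rewrite /eta; field; rewrite ?gt_eqF.
  have : e / (e + 1) * (p%:R + 1)^-1 <= 1.
    apply: mulr_ile1 => //; rewrite ?divr_ge0 ?invr_ge0 ?(ltW e1) ?(ltW p1) //.
    by rewrite invf_le1 // lerDr.
  move=> h; apply: le_trans (ler_wpM2l _ h) _; first by rewrite invr_ge0.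
  by rewrite mulr1 lef_pV2 ?posrE ?ltr0n // ler_nat.
have key x y : vn (x - x0) < rho -> vn (y - x0) < rho ->
    vn (x - y - (evmap g x - evmap g y) *m E) <= e * eta * vn (x - y).
  rewrite !lt_min => /andP[hx _] /andP[hy _].
  have := h1 y x hy hx; rewrite -/D => h.
  have -> : x - y - (evmap g x - evmap g y) *m E =
            - ((evmap g x - evmap g y - (x - y) *m D) *m E).
    by rewrite [in RHS]mulmxBl -[in RHS]mulmxA mulmxV // mulmx1 opprB.
  rewrite vnN; apply: le_trans (vn_mulmx _ _) _; rewrite -mulrA.
  by rewrite ler_wpM2l.
exists (2 * e + 1), rho; split=> //.
- by rewrite ltr_wpDl // mulr_ge0.
- move=> x y hx hy; have h := key x y hx hy.
  have h3 : vn (x - y) <= vn (x - y - (evmap g x - evmap g y) *m E) +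
                          vn ((evmap g x - evmap g y) *m E).
    by apply: le_trans (vnD _ _); rewrite subrK.
  have h4 := vn_mulmx (evmap g x - evmap g y) E; rewrite -/e in h4.
  have h5 : e * eta * vn (x - y) <= 2^-1 * vn (x - y) by rewrite ler_wpM2r ?vn_ge0.
  have h6 := vn_ge0 (evmap g x - evmap g y).
  rewrite mulrDl mul1r -mulrA; clear -h h3 h4 h5 h6; lra.
- by move=> x; rewrite lt_min => /andP[_ /h2] h; rewrite -nC_gt0 (le_lt_trans _ h) // divr_ge0 ?nC_ge0.
move=> r r0; pose m := Num.min r rho.
have m0 : 0 < m by rewrite lt_min r0.
have q0 : 0 < p%:R * 2 + 1 :> R by rewrite ltr_wpDl // mulr_ge0.
pose s := m / (p%:R * 2 + 1); have s0 : 0 < s by rewrite divr_gt0.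
have sm x : `|realify (x - x0)| <= s -> vn (x - x0) < m.
  move=> h; apply: le_lt_trans (vn_le_realify _) _.
  apply: le_lt_trans (ler_wpM2l _ h) _; first by rewrite mulr_ge0.
  by rewrite /s mulrCA gtr_pMr // ltr_pdivrMr // mul1r ltrDl.
have d0 : 0 < s / 2 / (e + 1) by rewrite !divr_gt0 // ltr0n.
apply: near_mono (near_ball (evmap g x0) d0) => t ht.
pose phi x := x - (evmap g x - t) *m E.
have [||x hx ex] := @contraction_fixpoint _ _ phi x0 s s0.
- move=> x y /sm hx /sm hy.
  have hx' : vn (x - x0) < rho by apply: lt_le_trans hx _; rewrite ge_min lexx orbT.
  have hy' : vn (y - x0) < rho by apply: lt_le_trans hy _; rewrite ge_min lexx orbT.
  apply: le_trans (norm_realify_le _) _.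
  have -> : phi x - phi y = x - y - (evmap g x - evmap g y) *m E.
    rewrite /phi opprD addrACA -opprD -mulmxBl; congr (_ - _ *m E).
    by rewrite opprB addrA subrK.
  apply: le_trans (key x y hx' hy') _.
  apply: le_trans (ler_wpM2l _ (vn_le_realify _)) _; first by rewrite mulr_ge0 // ltW.
  by rewrite mulrA ler_wpM2r.
- have -> : phi x0 - x0 = - ((evmap g x0 - t) *m E) by rewrite /phi addrC addKr.
  apply: le_trans (norm_realify_le _) _; rewrite vnN.
  apply: le_trans (vn_mulmx _ _) _; rewrite vnBC -/e.
  move: ht; rewrite ltr_pdivlMr // => /ltW; apply: le_trans.
  by rewrite mulrC ler_wpM2l ?vn_ge0 // lerDl.
exists x; first by apply: lt_le_trans (sm x hx) _; rewrite ge_min lexx.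
have /eqP : x - (evmap g x - t) *m E = x - 0 by rewrite subr0.
rewrite (inj_eq (addrI x)) eqr_opp => /eqP z.
apply/eqP; rewrite -subr_eq0; apply/eqP.
by rewrite -[LHS]mulmx1 -(mulVmx uD) mulmxA z mul0mx.
Qed.
End LocalInverse.

(** * Good values *)

Lemma injective_rank (K : fieldType) m k (D : 'M[K]_(m, k)) :
  (forall w : 'cV_k, D *m w = 0 -> w = 0) -> \rank D = k.
Proof.
move=> H; rewrite -mxrank_tr; apply/eqP; rewrite -/(row_free _) -kermx_eq0.
apply: contraT => /rowV0Pn[v /sub_kermxP h] /negP[]; apply/eqP.
apply: trmx_inj; rewrite trmx0; apply: H.
by rewrite -[D]trmxK -trmx_mul h trmx0.
Qed.

Section Sections.
Variable R : realType.
Local Notation C := (complex R).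
Local Notation nC := (@ComplexField.Normc.normc R).
Local Notation P m := (mpoly.mpoly m C).

(** Openness at a linear rate. Displacements of the value by positive real multiples
    of the basis vectors are enough to force surjectivity of the differential, and both
    kinds of trivializations provide them directly. *)
Definition linearly_open_at m n (f : 'I_m -> P n) (x : 'rV[C]_n) : Prop :=
  forall j : 'I_m, exists K s0 : R, 0 < s0 /\ forall s : R, 0 < s -> s < s0 ->
    exists2 x', evmap f x' = evmap f x + real_complex R s *: delta_mx 0 j &
                vn (x' - x) <= K * s.

(** A linear form w that kills the image of the differential would change only to
    higher order in s under these displacements, whereas it changes by s w_j under
    the j-th one. *)
Lemma linearly_open_injective m n (f : 'I_m -> P n) x (w : 'cV[C]_m) :
  linearly_open_at f x -> diffmx f x *m w = 0 -> w = 0.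
Proof.
move=> lo dw; apply/colP => j; rewrite mxE; apply/eqP/negPn/negP => wj.
have [K [s0 [s00 hs]]] := lo j.
pose a := nC (w j 0); have a0 : 0 < a by rewrite nC_gt0.
pose K' := Num.max K 0; have K'0 : 0 <= K' by rewrite le_max lexx orbT.
pose e := mxn w * K' + 1; have e0 : 0 < e by rewrite ltr_wpDl // mulr_ge0 ?mxn_ge0.
have eta0 : 0 < a / (2 * e) by rewrite divr_gt0 // mulr_gt0 // ltr0n.
have [rho rho0 h] := strict_diff f x eta0.
pose s := Num.min (s0 / 2) (rho / (2 * (K' + 1))).
have K1 : 0 < K' + 1 by rewrite ltr_wpDl.
have sp : 0 < s by rewrite lt_min !divr_gt0 ?mulr_gt0 ?ltr0n.
have ss0 : s < s0.
  by rewrite gt_min ltr_pdivrMr ?ltr0n // ltr_pMr // ltr1n.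
have [x' ex' hx'] := hs s sp ss0.
have hx'' : vn (x' - x) <= K' * s.
  by apply: le_trans hx' _; rewrite ler_wpM2r ?le_max ?lexx // ltW.
have hr : vn (x' - x) < rho.
  apply: le_lt_trans hx'' _; apply: le_lt_trans (_ : K' * (rho / (2 * (K' + 1))) < _).
    by rewrite ler_wpM2l // ge_min lexx orbT.
  rewrite mulrCA gtr_pMr // ltr_pdivrMr ?mulr_gt0 ?ltr0n // mul1r; lra.
have := h x x'; rewrite subrr vn0 => /(_ rho0 hr).
rewrite ex' [evmap f x + _]addrC addrK => hd.
have E : (real_complex R s *: delta_mx 0 j - (x' - x) *m diffmx f x) *m w =
         (real_complex R s * w j 0) *: const_mx 1.
  rewrite mulmxBl -mulmxA dw mulmx0 subr0; apply/matrixP => k l.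
  rewrite !ord1 !mxE mulr1 (bigD1 j) //= !mxE !eqxx mulr1 big1 ?addr0 // => i ij.
  by rewrite !mxE (negPf ij) andbF mulr0 mul0r.
have h1 := vn_mulmx (real_complex R s *: delta_mx 0 j - (x' - x) *m diffmx f x) w.
rewrite E vnZ nCM nC_real gtr0_norm // -/a in h1.
have h2 : vn (const_mx 1 : 'rV[C]_1) = 1 by rewrite /vn big_ord1 mxE nC1.
rewrite h2 mulr1 in h1.
have h3 : mxn w * (a / (2 * e) * vn (x' - x)) <= mxn w * (a / (2 * e) * (K' * s)).
  by rewrite !ler_wpM2l ?mxn_ge0 // ltW.
have h4 : mxn w * (a / (2 * e) * (K' * s)) = s * a * (mxn w * K' / (2 * e)).
  by field; rewrite ?gt_eqF.
have h5 : mxn w * K' / (2 * e) < 1.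
  rewrite ltr_pdivrMr ?mulr_gt0 ?ltr0n // mul1r /e mulrDr.
  by have := mulr_ge0 (mxn_ge0 w) K'0; lra.
have h6 := le_trans h1 (ler_wpM2l (mxn_ge0 w) hd).
have h7 := le_trans h6 h3; rewrite h4 in h7.
have sa : 0 < s * a by rewrite mulr_gt0.
by move: h7; rewrite ler_pMr // leNgt h5.
Qed.

(** For maps between spaces of equal dimension a surjective differential is
    invertible. *)
Lemma linearly_open_unit p (g : 'I_p -> P p) x : linearly_open_at g x ->
  pev (jacobian g) x != 0.
Proof.
move=> lo; have rk := injective_rank (fun w => linearly_open_injective (w := w) lo).
by rewrite -det_diffmx -unitfE -unitmxE -row_free_unit /row_free rk.
Qed.
End Sections.

Section GoodValues.
Variable R : realType.
Local Notation C := (complex R).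
Local Notation nC := (@ComplexField.Normc.normc R).
Local Notation P m := (mpoly.mpoly m C).
Variables (p : nat) (g : 'I_p -> P p).

(** The values over which g is proper and a local diffeomorphism. *)
Definition good_value (c : 'rV[C]_p) : Prop :=
  (forall x, evmap g x = c -> pev (jacobian g) x != 0) /\
  exists d M : R, 0 < d /\ forall x, vn (evmap g x - c) < d -> vn x <= M.

(** Finiteness of the fibre over c, listed by F, and properness of g over c. *)
Definition finite_fibre_at (c : 'rV[C]_p) (F : seq 'rV[C]_p) : Prop :=
  (forall x, (x \in F) <-> evmap g x = c) /\
  (forall eps : R, 0 < eps ->
    near_pt c (fun t => forall x, evmap g x = t -> exists2 y, y \in F & vn (x - y) < eps)).

Hypothesis ig : independent g.

Lemma coordinate_annihilators : exists A : 'I_p -> {poly P p},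
  forall j, annihilator g (mpolyX C (mnm1 j)) (A j).
Proof.
have [A hA] := choice (fun j => annihilator_exists ig (mpolyX C (mnm1 j))).
by exists A.
Qed.

Lemma pev_prod_neq0 (I : finType) (q : I -> P p) c :
  pev (\prod_i q i) c != 0 <-> forall i, pev (q i) c != 0.
Proof.
have -> : pev (\prod_i q i) c = \prod_i pev (q i) c by apply: rmorph_prod.
by split=> [/prodf_neq0 h i|h]; [apply: h|apply/prodf_neq0 => i _].
Qed.

Lemma spec0 t (A : {poly P p}) : spec t 0 A = pev A`_0 t.
Proof. by rewrite /spec horner_coef0 coef_map. Qed.

Section WithAnnihilators.
Variables (A : 'I_p -> {poly P p}).
Hypothesis hA : forall j, annihilator g (mpolyX C (mnm1 j)) (A j).

Let hA' j : A j != 0 /\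
  (map_poly (mmap (@mpolyC p C) g) (A j)).[mpolyX C (mnm1 j)] = 0.
Proof. by have [? ? _ _] := hA j. Qed.

Lemma bounded_near_fibre c F : finite_fibre_at c F ->
  exists d M : R, 0 < d /\ forall x, vn (evmap g x - c) < d -> vn x <= M.
Proof.
move=> [_ /(_ 1 ltr01)[d d0 hd]]; exists d, (\sum_(y <- F) vn y + 1); split=> // x hx.
have [y yF hy] := hd _ hx x erefl.
have h2 : vn y <= \sum_(y <- F) vn y by apply: ler_sum_mem => // z; apply: vn_ge0.
have := vnD (x - y) y; rewrite subrK => h1.
by apply: le_trans h1 _; rewrite addrC; apply: lerD => //; apply: ltW.
Qed.

(** Properness bounds the coordinates on the fibres near a good value. *)
Lemma leads_nonvanishing c : good_value c -> forall j, pev (lead_coef (A j)) c != 0.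
Proof.
move=> [_ [d [M [d0 hM]]]] j; have M0 : 0 <= Num.max M 0 by rewrite le_max lexx orbT.
apply: (lead_nonvanishing ig (hA j) d0 M0) => x /hM h.
by rewrite pevX (le_trans (nC_le_vn _ _)) // (le_trans h) // le_max lexx.
Qed.

(** Nearby fibres over generic points have boundedly many points, and each point
    of the fibre with invertible differential persists. *)
Lemma fibre_finite c : (forall x, evmap g x = c -> pev (jacobian g) x != 0) ->
  exists F : seq 'rV[C]_p, forall x, (x \in F) <-> evmap g x = c.
Proof.
move=> hJ; pose N := ((\max_j size (A j)) ^ p)%N.
have [//|no] := pselect (exists F : seq 'rV[C]_p, forall x, (x \in F) <-> evmap g x = c).
exfalso.
have many k : exists s : seq 'rV[C]_p,
    [/\ uniq s, size s = k & forall x, x \in s -> evmap g x = c].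
  elim: k => [|k [s [us ss hs]]]; first by exists [::].
  have [h|/existsNP[x /not_implyP[ex xs]]] := pselect (forall x, evmap g x = c -> x \in s).
    by exfalso; apply: no; exists s => x; split; [apply: hs|apply: h].
  exists (x :: s); split; rewrite /= ?ss ?us ?andbT //; first exact/negP.
  by move=> y; rewrite inE => /orP[/eqP ->|/hs].
have [s [us ss hs]] := many N.+1.
have H x : exists eta : R, 0 < eta /\ forall y, y \in s -> y != x -> eta <= vn (y - x).
  have [|eta [e0 _ he]] := @seq_lower_bound R _ [seq y <- s | y != x] (fun y => vn (y - x)) 1 ltr01.
    by move=> y; rewrite mem_filter => /andP[yx _]; apply: vn_gt0.
  by exists eta; split=> // y ys yx; apply: he; rewrite mem_filter yx.
have [eta heta] := choice H.
have [e [e0 _ he]] := seq_lower_bound (ltr01 : 0 < 1 :> R) (fun x (_ : x \in s) => (heta x).1).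
have e20 : 0 < e / 2 by rewrite divr_gt0 // ltr0n.
have nr : near_pt c (fun t => forall x, x \in s -> exists2 y, vn (y - x) < e / 2 & evmap g y = t).
  apply: near_seq => x xs; have ex := hs x xs.
  by have [kap [rho [_ _ _ _ /(_ _ e20)]]] := local_inverse (hJ x ex); rewrite ex.
pose L := \prod_j lead_coef (A j).
have L0 : L != 0 by apply/prodf_neq0 => j _; rewrite lead_coef_eq0; case: (hA' j).
have [d d0 hd] := nr.
have [t [ht /pev_prod_neq0 lt_]] := nonvanishing_near c L0 d0.
have [F [sF hF _]] := fibre_near hA' lt_.
have [y hy] := choice (fun x => (match pselect (x \in s) with
  | left xs => let: ex_intro2 y h1 h2 := hd t ht x xs in
       ex_intro (fun y => x \in s -> vn (y - x) < e / 2 /\ evmap g y = t) y (fun=> conj h1 h2)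
  | right nx => ex_intro (fun y => x \in s -> vn (y - x) < e / 2 /\ evmap g y = t) x
       (fun xs => False_ind _ (nx xs)) end)).
have uy : uniq (map y s).
  rewrite map_inj_in_uniq // => x x' xs xs' exx'; apply/eqP/negPn/negP => ne.
  have [h1 _] := hy x xs; have [h2 _] := hy x' xs'.
  have h3 := (heta x').2 x xs ne; have h4 := he x' xs'.
  have := vn_tri x (y x) x'; rewrite (vnBC x (y x)) {2}exx'.
  clear -h1 h2 h3 h4; lra.
have sub : {subset map y s <= F}.
  by move=> _ /mapP[x xs ->]; apply/hF; have [_] := hy x xs.
have := uniq_leq_size uy sub; rewrite size_map ss => /leq_trans /(_ sF).
by rewrite ltnn.
Qed.
End WithAnnihilators.

(** The good values form the complement of a hypersurface. The equation is the
    product of the leading coefficients of the relations of the coordinates, which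
    detect points escaping to infinity, and of the constant coefficient of that of
    the Jacobian determinant, which detects critical points. *)
Theorem good_values_hypersurface : exists Q : P p,
  [/\ Q != 0, forall c, pev Q c != 0 <-> good_value c &
      forall c, good_value c -> exists F, finite_fibre_at c F].
Proof.
have [A hA] := coordinate_annihilators.
have hA' j : A j != 0 /\ (map_poly (mmap (@mpolyC p C) g) (A j)).[mpolyX C (mnm1 j)] = 0.
  by have [? ? _ _] := hA j.
have [B hB] := annihilator_exists ig (jacobian g).
have [B0 eB _ _] := hB.
have J0 := jacobian_neq0 ig.
have fib c : (forall j, pev (lead_coef (A j)) c != 0) -> exists F, finite_fibre_at c F.
  by move=> /(fibre_near hA')[F [_ hF nF]]; exists F.
have constB c : good_value c -> pev B`_0 c != 0.
  move=> gc; have [F [hF nF]] := fib c (leads_nonvanishing hA gc).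
  have [hJ [d [M [d0 hM]]]] := gc.
  have [b b0 hb] := pev_bounded (jacobian g) M.
  have FJ y : y \in F -> pev (jacobian g) y != 0 by move=> /hF /hJ.
  have H y : exists eta : R, 0 < eta /\ (y \in F -> forall x, vn (x - y) < eta ->
       nC (pev (jacobian g) y) / 2 < nC (pev (jacobian g) x)).
    have [yF|nyF] := boolP (y \in F); last by exists 1.
    by have [eta e0 he] := near_nonzero (FJ y yF); exists eta.
  have [eta heta] := choice H.
  have [e [e0 _ he]] := seq_lower_bound (ltr01 : 0 < 1 :> R) (fun y (_ : y \in F) => (heta y).1).
  have pos y : y \in F -> 0 < nC (pev (jacobian g) y) / 2.
    by move=> /FJ h; rewrite divr_gt0 ?nC_gt0 // ltr0n.
  have [m [m0 _ hm]] := seq_lower_bound (ltr01 : 0 < 1 :> R) pos.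
  have [d' d'0 hd'] := nF e e0.
  have dd : 0 < Num.min d d' by rewrite lt_min d0.
  apply: (constant_nonvanishing ig hB dd b0 _ J0 m0) => x; rewrite lt_min => /andP[h1 h2].
    by apply: hb; apply: hM.
  have [y yF hy] := hd' _ h2 x erefl.
  apply: le_trans (hm y yF) _; apply: ltW; apply: (heta y).2 => //.
  exact: lt_le_trans (he y yF).
exists ((\prod_j lead_coef (A j)) * B`_0); split.
- rewrite mulf_neq0 //; first by apply/prodf_neq0 => j _; rewrite lead_coef_eq0; case: (hA' j).
  apply/negP => /eqP z.
  have [B' [B'0 eB' sB']] := divide_out_root B0 z J0 eB.
  by have [_ _ /(_ _ B'0 eB')] := hB; rewrite leqNgt sB'.
- move=> c; rewrite pevM mulf_eq0 negb_or; split=> [/andP[/pev_prod_neq0 lc bc]|gc].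
    have [F hF] := fib c lc; split; last exact: bounded_near_fibre hF.
    move=> x ex; apply: contraNneq bc => jx.
    by have := relation_at x eB; rewrite jx spec0 ex => ->.
  apply/andP; split; last exact: constB.
  by apply/pev_prod_neq0; apply: leads_nonvanishing.
- by move=> c gc; apply: fib; apply: leads_nonvanishing.
Qed.
End GoodValues.

(** * Smoothness of algebraic functions *)

Section ComplexDerivative.
Variable R : rcfType.
Local Notation C := (complex R).
Local Notation nC := (@ComplexField.Normc.normc R).
Local Notation P m := (mpoly.mpoly m C).

(** The number a is the complex derivative of u at 0. Complex derivatives suffice: the
    real partial derivatives along both axes of a coordinate are obtained from them by
    restriction to real and to imaginary increments. *)
Definition has_d (u : C -> C) (a : C) : Prop :=
  forall eps : R, 0 < eps -> exists2 d : R, 0 < d & forall z, nC z < d ->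
    nC (u z - u 0 - z * a) <= eps * nC z.

Lemma has_d_ext u v a : u =1 v -> has_d u a -> has_d v a.
Proof. by move=> e h eps /h[d d0 hd]; exists d => // z; rewrite -!e; apply: hd. Qed.

Lemma has_d_lip u a : has_d u a -> exists K d : R, [/\ 0 <= K, 0 < d &
  forall z, nC z < d -> nC (u z - u 0) <= K * nC z].
Proof.
move=> /(_ 1 ltr01)[d d0 hd]; exists (1 + nC a), d; split=> // [|z /hd h].
  by rewrite addr_ge0 ?nC_ge0.
rewrite -[u z - u 0](subrK (z * a)); apply: le_trans (nCD _ _) _.
by rewrite mulrDl nCM [nC z * _]mulrC lerD2r.
Qed.

Lemma has_d_const c : has_d (fun=> c) 0.
Proof.
move=> eps e0; exists 1 => // z _; rewrite subrr mulr0 subr0 nC0.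
by rewrite mulr_ge0 ?nC_ge0 ?(ltW e0).
Qed.

Lemma has_dD u v a b : has_d u a -> has_d v b -> has_d (fun z => u z + v z) (a + b).
Proof.
move=> hu hv eps e0; have e2 : 0 < eps / 2 by rewrite divr_gt0 // ltr0n.
have [d d0 hd] := hu _ e2; have [d' d'0 hd'] := hv _ e2.
exists (Num.min d d') => [|z]; first by rewrite lt_min d0.
rewrite lt_min => /andP[/hd h /hd' h'].
rewrite mulrDr taylor_remainderD; apply: le_trans (nCD _ _) _.
by rewrite [eps]splitr mulrDl lerD.
Qed.

Lemma remainder_mul (A : comNzRingType) (u u0 v v0 z a b : A) :
  u * v - u0 * v0 - z * (a * v0 + u0 * b) =
  (u - u0 - z * a) * v + u0 * (v - v0 - z * b) + z * a * (v - v0).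
Proof. ring. Qed.

Lemma has_dM u v a b : has_d u a -> has_d v b ->
  has_d (fun z => u z * v z) (a * v 0 + u 0 * b).
Proof.
move=> hu hv eps e0; have [K [d1 [K0 d10 h1]]] := has_d_lip hv.
pose B := nC (v 0) + K + nC (u 0) + nC a * K + 1.
have B0 : 0 < B by rewrite ltr_wpDl // !addr_ge0 ?nC_ge0 // mulr_ge0 ?nC_ge0.
have eB : 0 < eps / B by rewrite divr_gt0.
have [d2 d20 h2] := hu _ eB; have [d3 d30 h3] := hv _ eB.
exists (Num.min (Num.min 1 (eps / B)) (Num.min d1 (Num.min d2 d3))) => [|z].
  by rewrite !lt_min ltr01 eB d10 d20 d30.
rewrite !lt_min -!andbA => /and5P[z1 zB /h1 g1 /h2 g2 /h3 g3].
rewrite remainder_mul.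
have vB : nC (v z) <= nC (v 0) + K.
  rewrite -[v z](subrK (v 0)) addrC; apply: le_trans (nCD _ _) _; rewrite lerD2l.
  by apply: le_trans g1 _; rewrite ler_piMr // ltW.
have nz := nC_ge0 z.
have t1 : nC ((u z - u 0 - z * a) * v z) <= (eps / B * nC z) * (nC (v 0) + K).
  by rewrite nCM ler_pM ?nC_ge0.
have t2 : nC (u 0 * (v z - v 0 - z * b)) <= nC (u 0) * (eps / B * nC z).
  by rewrite nCM ler_wpM2l ?nC_ge0.
have t3 : nC (z * a * (v z - v 0)) <= (eps / B * nC z) * (nC a * K).
  rewrite !nCM.
  have -> : eps / B * nC z * (nC a * K) = eps / B * nC a * (K * nC z) by ring.
  by rewrite ler_pM ?mulr_ge0 ?nC_ge0 // ler_wpM2r ?nC_ge0 // ltW.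
apply: le_trans (nCD _ _) _.
apply: le_trans (lerD (le_trans (nCD _ _) (lerD t1 t2)) t3) _.
have -> : eps / B * nC z * (nC (v 0) + K) + nC (u 0) * (eps / B * nC z) +
   eps / B * nC z * (nC a * K) = eps / B * nC z * (B - 1) by rewrite /B; ring.
have -> : eps * nC z = eps / B * nC z * B by field; rewrite gt_eqF.
apply: ler_wpM2l; first by rewrite mulr_ge0 // ltW.
by rewrite gerBl ler01.
Qed.

Lemma remainder_inv (F : fieldType) (u u0 z a : F) : u != 0 -> u0 != 0 ->
  u^-1 - u0^-1 - z * (- a / u0 ^+ 2) =
  (z * a * (u - u0) - u0 * (u - u0 - z * a)) * (u^-1 * (u0 ^+ 2)^-1).
Proof. by move=> h h0; field; rewrite h h0. Qed.

Lemma has_dV u a : has_d u a -> u 0 != 0 -> has_d (fun z => (u z)^-1) (- a / u 0 ^+ 2).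
Proof.
move=> hu u0 eps e0; have [K [d1 [K0 d10 h1]]] := has_d_lip hu.
have n0 : 0 < nC (u 0) by rewrite nC_gt0.
pose m := nC (u 0) / 2; have m0 : 0 < m by rewrite divr_gt0 // ltr0n.
pose B := (nC a * K + nC (u 0)) * (m^-1 * (nC (u 0) ^+ 2)^-1) + 1.
have B0 : 0 < B.
  rewrite ltr_wpDl // mulr_ge0 ?addr_ge0 ?mulr_ge0 ?nC_ge0 // invr_ge0 ?ltW //.
  exact: exprn_gt0.
have eB : 0 < eps / B by rewrite divr_gt0.
have [d2 d20 h2] := hu _ eB.
have mK : 0 < m / (K + 1) by rewrite divr_gt0 // ltr_wpDl.
exists (Num.min (Num.min (m / (K + 1)) (eps / B)) (Num.min d1 d2)) => [|z].
  by rewrite !lt_min mK eB d10 d20.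
rewrite !lt_min -!andbA => /and4P[zm zB /h1 g1 /h2 g2].
have um : m <= nC (u z).
  have : nC (u z - u 0) <= m.
    apply: le_trans g1 _; move: zm; rewrite ltr_pdivlMr ?ltr_wpDl // => /ltW.
    by apply: le_trans; rewrite mulrC ler_wpM2l ?nC_ge0 // lerDl.
  have := nC_sub_ge (u 0) (u z); rewrite nCBC /m; lra.
have uz : u z != 0 by rewrite -nC_gt0; apply: lt_le_trans um.
rewrite remainder_inv // nCM.
have nz := nC_ge0 z.
have t1 : nC (z * a * (u z - u 0) - u 0 * (u z - u 0 - z * a)) <=
          eps / B * nC z * (nC a * K + nC (u 0)).
  apply: le_trans (nCB _ _) _; rewrite !nCM mulrDr; apply: lerD.
    have -> : eps / B * nC z * (nC a * K) = eps / B * nC a * (K * nC z) by ring.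
    by rewrite ler_pM ?mulr_ge0 ?nC_ge0 // ler_wpM2r ?nC_ge0 // ltW.
  by rewrite mulrC ler_wpM2r ?nC_ge0.
have t2 : nC ((u z)^-1 / (u 0) ^+ 2) <= m^-1 * (nC (u 0) ^+ 2)^-1.
  rewrite nCM !nCV nCX ler_wpM2r ?invr_ge0 ?exprn_ge0 ?nC_ge0 //.
  by rewrite lef_pV2 // posrE // nC_gt0.
apply: le_trans (ler_pM (nC_ge0 _) (nC_ge0 _) t1 t2) _.
have hB : (nC a * K + nC (u 0)) * (m^-1 * (nC (u 0) ^+ 2)^-1) = B - 1 by rewrite /B addrK.
rewrite -[eps / B * nC z * _ * _]mulrA hB.
have -> : eps * nC z = eps / B * nC z * B by field; rewrite gt_eqF.
apply: ler_wpM2l; first by rewrite mulr_ge0 // ltW.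
by rewrite gerBl ler01.
Qed.

Lemma has_d_pev q (Q : P q) (T : C -> 'rV[C]_q) (v : 'rV[C]_q) :
  (forall k, has_d (fun z => T z 0 k) (v 0 k)) ->
  has_d (fun z => pev Q (T z)) (pdiff Q (T 0) v).
Proof.
move=> hT; elim/mpoly_ring_ind: Q => [c|i|a b ha hb|a b ha hb].
- rewrite pdiffC; apply: has_d_ext (has_d_const c) => z; by rewrite pevC.
- rewrite pdiffX; apply: has_d_ext (hT i) => z; by rewrite pevX.
- rewrite pdiffD; apply: has_d_ext (has_dD ha hb) => z; by rewrite pevD.
- rewrite pdiffM; apply: has_d_ext (has_dM ha hb) => z; by rewrite pevM.
Qed.
End ComplexDerivative.

Local Open Scope classical_set_scope.
Local Open Scope ring_scope.

Section Smoothness.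
Variable R : realType.
Local Notation C := (complex R).

Lemma realifyZ n (s : R) (x : 'rV[C]_n) :
  realify (real_complex R s *: x) = s *: realify x.
Proof.
rewrite /realify scale_row_mx; congr row_mx; apply/rowP => j; rewrite !mxE;
  case: (x 0 j) => a b /=; by rewrite mul0r ?subr0 ?addr0.
Qed.

Lemma unrealifyD n (u v : 'rV[R]_(n + n)) : unrealify (u + v) = unrealify u + unrealify v.
Proof. by rewrite -[u in LHS]unrealifyK -[v in LHS]unrealifyK -realifyD realifyK. Qed.

Lemma unrealifyB n (u v : 'rV[R]_(n + n)) : unrealify (u - v) = unrealify u - unrealify v.
Proof. by rewrite -[u in LHS]unrealifyK -[v in LHS]unrealifyK -realifyB realifyK. Qed.

Lemma unrealifyZ n (s : R) (u : 'rV[R]_(n + n)) :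
  unrealify (s *: u) = real_complex R s *: unrealify u.
Proof. by rewrite -[u in LHS]unrealifyK -realifyZ realifyK. Qed.

Lemma vn_unrealify n (u v : 'rV[R]_(n + n)) :
  vn (unrealify u - unrealify v) <= (n%:R * 2) * `|u - v|.
Proof. by rewrite -unrealifyB -[X in _ <= _ * `|X|]unrealifyK vn_le_realify. Qed.

Definition vn_open n (O : 'rV[C]_n -> Prop) : Prop := forall x, O x -> near_pt x O.

Lemma near_unrealify n (u : 'rV[R]_(n + n)) (Q : 'rV[C]_n -> Prop) :
  near_pt (unrealify u) Q -> \forall v \near u, Q (unrealify v).
Proof.
move=> [d d0 hd]; have n0 : 0 < n%:R * 2 + 1 :> R by rewrite ltr_wpDl // mulr_ge0.
apply/nbhs_ballP; exists (d / (n%:R * 2 + 1)); first by rewrite /= divr_gt0.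
move=> v; rewrite -ball_normE /= ltr_pdivlMr // => h; apply: hd.
apply: le_lt_trans (vn_unrealify _ _) _; apply: le_lt_trans h.
by rewrite distrC mulrC ler_wpM2l // lerDl.
Qed.

Lemma open_unrealify n (O : 'rV[C]_n -> Prop) : vn_open O ->
  open [set u : 'rV[R]_(n + n) | O (unrealify u)].
Proof. by move=> hO; rewrite openE => u /= /hO /near_unrealify. Qed.

(** Only values on the open set U matter, for derivatives as well. *)
Lemma Ck_on_ext n m k (U : set 'rV[R]_n) (f h : 'rV[R]_n -> 'rV[R]_m) : open U ->
  (forall x, U x -> f x = h x) -> Ck_on k U f -> Ck_on k U h.
Proof.
move=> oU; have nU (f1 h1 : 'rV[R]_n -> 'rV[R]_m) x : (forall x, U x -> f1 x = h1 x) -> U x ->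
    \forall y \near x, f1 y = h1 y.
  by move=> e Ux; have := open_nbhs_nbhs (conj oU Ux); apply: filterS => y /e.
have cU (f1 h1 : 'rV[R]_n -> 'rV[R]_m) x : (forall x, U x -> f1 x = h1 x) -> U x ->
    {for x, continuous f1} -> {for x, continuous h1}.
  move=> e Ux cf; have cf' : f1 @ x --> f1 x := cf.
  suff : h1 @ x --> h1 x by [].
  rewrite -(e x Ux); apply: cvg_trans cf'.
  exact: near_eq_cvg (nU _ _ x e Ux).
elim: k f h => [|k IH] f h fh [cf df]; split=> //.
- by move=> x Ux; apply: cU fh Ux (cf x Ux).
- by move=> x Ux; apply: cU fh Ux (cf x Ux).
- move=> j; have [dj Dj] := df j.
  split=> [x Ux|].
    exact: near_eq_derivable (nU _ _ x fh Ux) (dj x Ux).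
  apply: IH Dj => x Ux.
  exact: near_eq_derive (nU _ _ x fh Ux).
Qed.
End Smoothness.

Section PfaffianChain.
Variable R : realType.
Local Notation C := (complex R).
Local Notation nC := (@ComplexField.Normc.normc R).
Local Notation P m := (mpoly.mpoly m C).
Local Notation rc := (real_complex R).

Lemma has_d_row m (u : C -> 'rV[C]_m) (v : 'rV[C]_m) :
  (forall i, has_d (fun z => u z 0 i) (v 0 i)) ->
  forall eps : R, 0 < eps -> exists2 d : R, 0 < d & forall z, nC z < d ->
    vn (u z - u 0 - z *: v) <= eps * nC z.
Proof.
move=> hu eps e0; have e1 : 0 < eps / m.+1%:R by rewrite divr_gt0 // ltr0n.
have H i : exists d : R, 0 < d /\ forall z, nC z < d ->
    nC (u z 0 i - u 0 0 i - z * v 0 i) <= eps / m.+1%:R * nC z.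
  by have [d d0 hd] := hu i _ e1; exists d.
have [d hd] := choice H.
have [e [e'0 _ he]] := seq_lower_bound (ltr01 : 0 < 1 :> R)
  (fun i (_ : i \in enum 'I_m) => (hd i).1).
exists e => // z hz.
have h : vn (u z - u 0 - z *: v) <= m%:R * (eps / m.+1%:R * nC z).
  apply: vn_le_of_coord => i; rewrite !mxE; apply: (hd i).2.
  by apply: lt_le_trans hz (he i _); rewrite mem_enum.
apply: le_trans h _; rewrite mulrA ler_wpM2r ?nC_ge0 // mulrCA ger_pMr //.
by rewrite ler_pdivrMr ?ltr0n // mul1r ler_nat.
Qed.

Lemma delta_lshift n (j : 'I_n) :
  delta_mx 0 (lshift n j) = realify (1 *: delta_mx 0 j : 'rV[C]_n).
Proof.
rewrite scale1r /realify -[LHS]hsubmxK; congr row_mx; apply/rowP => k; rewrite !mxE /=.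
  rewrite (inj_eq (@lshift_inj _ _)); by case: eqP.
by rewrite eq_rlshift; case: eqP.
Qed.

Lemma delta_rshift n (j : 'I_n) :
  delta_mx 0 (rshift n j) = realify (Complex 0 1 *: delta_mx 0 j : 'rV[C]_n).
Proof.
rewrite /realify -[LHS]hsubmxK; congr row_mx; apply/rowP => k; rewrite !mxE /=.
  by rewrite eq_lrshift; case: eqP => _ /=; rewrite ?mul0r ?mulr0 ?subrr.
rewrite (inj_eq (@rshift_inj _ _)); case: eqP => _ /=; rewrite ?mul0r ?mulr0 ?mulr1 ?addr0 ?add0r //.
Qed.

(** A Pfaffian chain on the open set O: a map T whose partial derivatives are
    polynomials B in T. *)
Variables (n q : nat) (O : 'rV[C]_n -> Prop) (T : 'rV[C]_n -> 'rV[C]_q).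
Variable B : 'I_n -> 'I_q -> P q.
Hypothesis openO : vn_open O.
Hypothesis contT : forall x, O x -> forall eps : R, 0 < eps ->
  near_pt x (fun y => vn (T y - T x) < eps).
Hypothesis derT : forall x, O x -> forall j k,
  has_d (fun z => T (x + z *: delta_mx 0 j) 0 k) (pev (B j k) (T x)).

Let F m (Q : 'I_m -> P q) (u : 'rV[R]_(n + n)) : 'rV[R]_(m + m) :=
  realify (evmap Q (T (unrealify u))).

Lemma pfaffian_continuous m (Q : 'I_m -> P q) (u : 'rV[R]_(n + n)) :
  O (unrealify u) -> {for u, continuous (F Q)}.
Proof.
move=> Ou; suff : F Q @ u --> F Q u by [].
have FF : Filter (nbhs u) by apply: nbhs_filter.
apply/cvgrPdist_lt => eps e0.
have [d d0 hd] := near_evmap Q (T (unrealify u)) e0.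
have := near_unrealify (contT Ou d0); apply: filterS => v /hd h.
by rewrite /F distrC -realifyB; apply: le_lt_trans (norm_realify_le _) _.
Qed.

(** The chain rule for Q o T; the factor a is 1 or i for the two real directions of
    the j-th coordinate. *)
Definition pfaffian_derivative m (Q : 'I_m -> P q) (j : 'I_n) (a : C) (i : 'I_m) : P q :=
  mpolyC q a * \sum_k mderiv k (Q i) * B j k.

Lemma pfaffian_has_derivative m (Q : 'I_m -> P q) j (a : C) (u : 'rV[R]_(n + n)) :
  O (unrealify u) -> nC a = 1 ->
  (fun s : R => s^-1 *: (F Q (s *: realify (a *: delta_mx 0 j) + u) - F Q u)) @ 0^'
    --> F (pfaffian_derivative Q j a) u.
Proof.
move=> Ou a1; set x := unrealify u in Ou *.
pose p := evmap (fun i => \sum_k mderiv k (Q i) * B j k) (T x).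
have E : F (pfaffian_derivative Q j a) u = realify (a *: p).
  rewrite /F -/x; congr realify; apply/rowP => i; rewrite !mxE /pfaffian_derivative.
  by rewrite pevM pevC.
have hp i : has_d (fun z => evmap Q (T (x + z *: delta_mx 0 j)) 0 i) (p 0 i).
  have := @has_d_pev R q (Q i) (fun z => T (x + z *: delta_mx 0 j)) (evmap (B j) (T x)).
  have -> : pdiff (Q i) (T (x + 0 *: delta_mx 0 j)) (evmap (B j) (T x)) = p 0 i.
    rewrite scale0r addr0 mxE /pdiff.
    have -> : pev (\sum_k mderiv k (Q i) * B j k) (T x) =
      \sum_k pev (mderiv k (Q i) * B j k) (T x) by apply: rmorph_sum.
    by apply: eq_bigr => k _; rewrite mxE pevM.
  move=> h; apply: has_d_ext (h _) => [z|k]; first by rewrite mxE.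
  by rewrite mxE; apply: derT.
rewrite E; apply/cvgrPdist_le => eps e0.
have [d d0 hd] := has_d_row hp e0.
rewrite /dnbhs near_withinE; apply/nbhs_ballP; exists d => // s.
rewrite -ball_normE /= sub0r normrN => sd s0.
have zs : nC (rc s * a) = `|s| by rewrite nCM nC_real a1 mulr1.
have := hd (rc s * a); rewrite zs => /(_ sd); rewrite scale0r addr0 => h.
have Eu : unrealify (s *: realify (a *: delta_mx 0 j) + u) = x + (rc s * a) *: delta_mx 0 j.
  by rewrite unrealifyD unrealifyZ realifyK scalerA addrC.
rewrite /F Eu -/x.
set A := evmap Q _ - _ in h.
have -> : realify (a *: p) - s^-1 *: (realify (evmap Q (T (x + (rc s * a) *: delta_mx 0 j)))
    - realify (evmap Q (T x))) = - (s^-1 *: realify (A - (rc s * a) *: p)).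
  rewrite realifyB -[in RHS]scalerA realifyZ [in RHS]scalerBr.
  by rewrite [s^-1 *: (s *: _)]scalerA mulVf // scale1r opprB /A realifyB.
rewrite normrN normrZ normfV ler_pdivrMl ?normr_gt0 // [leRHS]mulrC.
exact: le_trans (norm_realify_le _) h.
Qed.

(** A map whose partial derivatives are polynomials in the map itself is smooth,
    as is every polynomial in it: differentiation never leaves this class. *)
Theorem pfaffian_smooth m (Q : 'I_m -> P q) k :
  Ck_on k [set u | O (unrealify u)] (F Q).
Proof.
elim: k m Q => [|k IH] m Q; split=> //.
- by move=> u Ou; apply: pfaffian_continuous.
- by move=> u Ou; apply: pfaffian_continuous.
- move=> j.
  have [j' [a [a1 ->]]] : exists j' a, nC a = 1 /\
      delta_mx 0 j = realify (a *: delta_mx 0 j' : 'rV[C]_n).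
    case: (split_ordP j) => j' ->.
      by exists j', 1; rewrite nC1 delta_lshift.
    exists j', (Complex 0 1); rewrite delta_rshift; split=> //.
    by rewrite /ComplexField.Normc.normc expr0n expr1n add0r sqrtr1.
  split=> [u Ou|].
    apply/cvg_ex; exists (F (pfaffian_derivative Q j' a) u).
    exact: pfaffian_has_derivative.
  apply: (Ck_on_ext (open_unrealify openO) _ (IH m (pfaffian_derivative Q j' a))).
  move=> u Ou; apply/esym/cvg_lim => //.
  exact: pfaffian_has_derivative.
Qed.
End PfaffianChain.

Section PolynomialSmooth.
Variable R : realType.
Local Notation C := (complex R).
Local Notation P m := (mpoly.mpoly m C).

Lemma has_d_id : has_d (fun z : C => z) 1.
Proof.
by move=> eps e0; exists 1 => // z _; rewrite subr0 mulr1 subrr nC0 mulr_ge0 ?nC_ge0 ?(ltW e0).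
Qed.

(** The identity map is a Pfaffian chain with constant derivatives. *)
Lemma polynomial_smooth n m (Q : 'I_m -> P n) k (O : 'rV[C]_n -> Prop) : vn_open O ->
  Ck_on k [set u | O (unrealify u)] (fun u => realify (evmap Q (unrealify u))).
Proof.
move=> oO; pose B (j k : 'I_n) : P n := mpolyC n (j == k)%:R.
apply: (@pfaffian_smooth R n n O id B oO) => [x _ eps e0|x _ j i].
  exact: near_ball.
rewrite pevC; have := has_dD (has_d_const (x 0 i)) (has_dM (@has_d_id) (has_d_const ((j == i)%:R : C))).
rewrite mul1r mul0r addr0 add0r.
by apply: has_d_ext => z; rewrite !mxE eqxx /= eq_sym.
Qed.
End PolynomialSmooth.

(** * Sheets over a good value *)

Section Sheets.
Variable R : realType.
Local Notation C := (complex R).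
Local Notation P m := (mpoly.mpoly m C).
Variables (p : nat) (g : 'I_p -> P p).

(** The preimage of the ball of radius delta around c is cut into the disjoint
    sheets s y, one for each point y of the fibre over c; b x is the point of the
    fibre whose sheet contains x. *)
Record sheet_system (c : 'rV[C]_p) (s : 'rV[C]_p -> 'rV[C]_p -> 'rV[C]_p)
    (b : 'rV[C]_p -> 'rV[C]_p) (rho delta kappa M : R) : Prop := SheetSystem {
  ss_rho : 0 < rho;
  ss_delta : 0 < delta;
  ss_kappa : 0 < kappa;
  ss_section : forall y t, evmap g y = c -> vn (t - c) < delta ->
    vn (s y t - y) < rho /\ evmap g (s y t) = t;
  ss_base : forall y x, evmap g y = c -> vn (x - y) < rho -> b x = y;
  ss_cover : forall x, vn (evmap g x - c) < delta ->
    evmap g (b x) = c /\ vn (x - b x) < rho;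
  ss_inverse : forall y x x', evmap g y = c -> vn (x - y) < rho -> vn (x' - y) < rho ->
    vn (x - x') <= kappa * vn (evmap g x - evmap g x');
  ss_regular : forall y x, evmap g y = c -> vn (x - y) < rho -> pev (jacobian g) x != 0;
  ss_separated : forall y y', evmap g y = c -> evmap g y' = c -> y != y' ->
    4 * rho <= vn (y - y');
  ss_bounded : forall x, vn (evmap g x - c) < delta -> vn x <= M }.

(** The fibre is finite, so the radii and the constants of the local inverses at its
    points can be chosen uniform, with rho at most a quarter of the mutual distances;
    properness leaves no other points over a small ball. *)
Lemma sheets_exist c F : good_value g c -> finite_fibre_at g c F ->
  exists s b rho delta kappa M, sheet_system c s b rho delta kappa M.
Proof.
move=> [hJ [d0 [M [d00 hM]]]] [hF nF].
have H y : exists kr : R * R, [/\ 0 < kr.1, 0 < kr.2 & evmap g y = c ->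
   [/\ forall x x', vn (x - y) < kr.2 -> vn (x' - y) < kr.2 ->
        vn (x - x') <= kr.1 * vn (evmap g x - evmap g x'),
      forall x, vn (x - y) < kr.2 -> pev (jacobian g) x != 0 &
      forall r, 0 < r ->
        near_pt c (fun t => exists2 x, vn (x - y) < r & evmap g x = t)]].
  have [e|ne] := eqVneq (evmap g y) c; last first.
    by exists (1, 1); split=> // e; rewrite e eqxx in ne.
  have [k [r [k0 r0 h1 h2 h3]]] := local_inverse (hJ y e).
  by exists (k, r); split=> // _; split=> //; rewrite -e.
have [kr hkr] := choice H.
have k2 y : 0 < (kr y).2 by case: (hkr y).
have [r1 [r10 _ hr1]] := seq_lower_bound (ltr01 : 0 < 1 :> R)
  (fun y (_ : y \in F) => k2 y).
have [r2 [r20 _ hr2]] : exists r2 : R, [/\ 0 < r2, r2 <= 1 & forall y, y \in F ->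
     forall y', y' \in F -> y != y' -> r2 <= vn (y - y')].
  have [|r2 [r20 r21 h]] := @seq_lower_bound R _ [seq q <- [seq (y, y') | y <- F, y' <- F] | q.1 != q.2]
      (fun q => vn (q.1 - q.2)) 1 ltr01.
    by move=> q; rewrite mem_filter => /andP[ne _]; apply: vn_gt0.
  exists r2; split=> // y yF y' y'F ne; apply: (h (y, y')).
  by rewrite mem_filter /= ne; apply/allpairsP; exists (y, y').
pose rho := Num.min r1 (r2 / 4).
have rho0 : 0 < rho by rewrite lt_min r10 divr_gt0 // ltr0n.
have rhoF y x : evmap g y = c -> vn (x - y) < rho -> vn (x - y) < (kr y).2.
  move=> /hF yF; rewrite lt_min => /andP[h _]; exact: lt_le_trans h (hr1 y yF).
have sep y y' : evmap g y = c -> evmap g y' = c -> y != y' -> 4 * rho <= vn (y - y').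
  move=> /hF yF /hF yF' ne; apply: le_trans (hr2 y yF y' yF' ne).
  by rewrite mulrC -ler_pdivlMr ?ltr0n // ge_min lexx orbT.
pose kappa := \sum_(y <- F) (kr y).1 + 1.
have k1 y : 0 < (kr y).1 by case: (hkr y).
have kappa0 : 0 < kappa.
  by rewrite ltr_wpDl // sumr_ge0 // => y _; apply: ltW.
have kle y : y \in F -> (kr y).1 <= kappa.
  move=> yF; apply: le_trans (_ : \sum_(y <- F) (kr y).1 <= _); last by rewrite lerDl.
  by apply: (ler_sum_mem (F := fun y => (kr y).1)) => // z; apply: ltW.
have nS : near_pt c (fun t => forall y, y \in F -> exists2 x, vn (x - y) < rho & evmap g x = t).
  by apply: near_seq => y /hF e; have [_ _ /(_ e)[_ _]] := hkr y; apply.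
have [delta delta0 hd] := near_and (nF _ rho0) (near_and nS (near_ball c d00)).
have hs y t : exists x, evmap g y = c -> vn (t - c) < delta -> vn (x - y) < rho /\ evmap g x = t.
  have [e|ne] := eqVneq (evmap g y) c; last by exists 0 => e; rewrite e eqxx in ne.
  have [/hd[_ [hS _]]|//] := pselect (vn (t - c) < delta); last by exists 0.
  by have [x hx ex] := hS y (proj2 (hF y) e); exists x.
have [s0 hs0] := choice (fun yt : 'rV[C]_p * 'rV[C]_p => hs yt.1 yt.2).
have hb x : exists y, (exists2 y', evmap g y' = c & vn (x - y') < rho) ->
    evmap g y = c /\ vn (x - y) < rho.
  have [[y e h]|no] := pselect (exists2 y', evmap g y' = c & vn (x - y') < rho); first by exists y.
  by exists 0 => h; case: no.
have [b hb'] := choice hb.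
exists (fun y t => s0 (y, t)), b, rho, delta, kappa, M; split=> //.
- by move=> y t; apply: (hs0 (y, t)).
- move=> y x e h; have [e' h'] := hb' x (ex_intro2 _ _ y e h).
  apply/eqP/negPn/negP => ne; have := sep _ _ e' e ne.
  by have := vn_tri (b x) x y; rewrite (vnBC (b x) x); clear -h h' rho0; lra.
- move=> x /hd[/(_ x erefl)[y yF hy] _]; apply: hb'; exists y => //.
  exact/hF.
- move=> y x x' e h h'; have [_ _ /(_ e)[h1 _ _]] := hkr y.
  apply: le_trans (h1 x x' (rhoF _ _ e h) (rhoF _ _ e h')) _.
  by rewrite ler_wpM2r ?vn_ge0 // kle //; apply/hF.
- by move=> y x e h; have [_ _ /(_ e)[_ h2 _]] := hkr y; apply/h2/rhoF.
- by move=> x /hd[_ [_ h]]; apply: hM.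
Qed.

Section Properties.
Variables (c : 'rV[C]_p) (s : 'rV[C]_p -> 'rV[C]_p -> 'rV[C]_p)
    (b : 'rV[C]_p -> 'rV[C]_p) (rho delta kappa M : R).
Hypothesis S : sheet_system c s b rho delta kappa M.

Lemma sheet_eq x : vn (evmap g x - c) < delta -> s (b x) (evmap g x) = x.
Proof.
move=> h; have [e hx] := ss_cover S h; have [hs es] := ss_section S e h.
have := ss_inverse S e hs hx; rewrite es subrr vn0 mulr0 => h'.
by apply/subr0_eq/vn_eq0/eqP; rewrite eq_le vn_ge0 h'.
Qed.

Lemma base_section y t : evmap g y = c -> vn (t - c) < delta -> b (s y t) = y.
Proof. by move=> e h; have [hs _] := ss_section S e h; apply: (ss_base S). Qed.

(** On one sheet this is the estimate for the local inverse; points of different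
    sheets are at distance at least 2 rho and stay within rho of their bases. *)
Lemma section_lipschitz y y' t t' : evmap g y = c -> evmap g y' = c ->
  vn (t - c) < delta -> vn (t' - c) < delta ->
  vn (s y t - s y' t') <= (2 + kappa) * (vn (y - y') + vn (t - t')).
Proof.
move=> e e' h h'; have [hs es] := ss_section S e h; have [hs' es'] := ss_section S e' h'.
have k0 := ss_kappa S; have n1 := vn_ge0 (y - y'); have n2 := vn_ge0 (t - t').
have [eq|ne] := eqVneq y y'.
  subst y'; have := ss_inverse S e hs hs'; rewrite es es' => h1.
  by apply: le_trans h1 _; apply: ler_pM; rewrite ?lerDr ?vn_ge0 // ltW.
have sp := ss_separated S e e' ne.
have h1 := vn_tri (s y t) y (s y' t'); have h2 := vn_tri y y' (s y' t').
rewrite (vnBC y' (s y' t')) in h2.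
have h3 : 0 <= kappa * (vn (y - y') + vn (t - t')) by rewrite mulr_ge0 ?addr_ge0 // ltW.
rewrite mulrDl; clear -hs hs' h1 h2 h3 sp n2 n1; lra.
Qed.

(** On one sheet b is constant, and points of different sheets are far apart. *)
Lemma base_lipschitz x x' : vn (evmap g x - c) < delta -> vn (evmap g x' - c) < delta ->
  vn (b x - b x') <= 2 * vn (x - x').
Proof.
move=> h h'; have [e hx] := ss_cover S h; have [e' hx'] := ss_cover S h'.
have n1 := vn_ge0 (x - x').
have [->|ne] := eqVneq (b x) (b x'); first by rewrite subrr vn0 mulr_ge0.
have sp := ss_separated S e e' ne.
have h1 := vn_tri (b x) x (b x'); have h2 := vn_tri x x' (b x').
rewrite (vnBC (b x) x) in h1; clear -hx hx' h1 h2 sp; lra.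
Qed.
End Properties.
End Sheets.

(** * Good values are trivial *)

Section EuclideanDistance.
Variable R : realType.
Local Notation C := (complex R).
Local Notation nC := (@ComplexField.Normc.normc R).

Lemma sum_sqr_le (I : Type) (r : seq I) (a : I -> R) : (forall i, 0 <= a i) ->
  0 <= \sum_(i <- r) a i /\ \sum_(i <- r) a i ^+ 2 <= (\sum_(i <- r) a i) ^+ 2.
Proof.
move=> a0; elim: r => [|i r [h0 h]]; first by rewrite !big_nil expr0n.
rewrite !big_cons; split; first exact: addr_ge0.
rewrite sqrrD -addrA lerD2l; apply: le_trans h _.
by rewrite lerDr mulrn_wge0 // mulr_ge0.
Qed.

Lemma euclid_le_vn n (x y : 'rV[C]_n) : euclid_dist x y <= vn (x - y).
Proof.
rewrite /euclid_dist -[leRHS]ger0_norm ?vn_ge0 // -sqrtr_sqr ler_sqrt ?sqr_ge0 //.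
have -> : vn (x - y) = \sum_j nC (x 0 j - y 0 j).
  by apply: eq_bigr => j _; rewrite !mxE.
by have [] := @sum_sqr_le _ (index_enum 'I_n) (fun j => nC (x 0 j - y 0 j)) (fun j => nC_ge0 _).
Qed.

Lemma vn_le_euclid n (x y : 'rV[C]_n) : vn (x - y) <= n%:R * euclid_dist x y.
Proof.
apply: vn_le_of_coord => j; rewrite !mxE /euclid_dist.
rewrite -[leLHS]ger0_norm ?nC_ge0 // -sqrtr_sqr ler_sqrt; last first.
  by apply: sumr_ge0 => i _; rewrite sqr_ge0.
by rewrite (bigD1 j) //= lerDl sumr_ge0 // => i _; rewrite sqr_ge0.
Qed.

Lemma euclid_ge0 n (x y : 'rV[C]_n) : 0 <= euclid_dist x y.
Proof. exact: sqrtr_ge0. Qed.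

Definition vn_lipschitz n m (A : set 'rV[C]_n) (h : 'rV[C]_n -> 'rV[C]_m) : Prop :=
  exists2 K : R, 0 <= K & forall x y, A x -> A y -> vn (h x - h y) <= K * vn (x - y).

Lemma vn_lipschitzP n m (A : set 'rV[C]_n) (h : 'rV[C]_n -> 'rV[C]_m) :
  vn_lipschitz A h <-> Defs.lipschitz_on A h.
Proof.
split=> [[K K0 hK]|[K hK]].
  exists (K * n%:R) => x y Ax Ay; apply: le_trans (euclid_le_vn _ _) _.
  apply: le_trans (hK x y Ax Ay) _; rewrite -mulrA ler_wpM2l //.
  exact: vn_le_euclid.
exists (m%:R * Num.max K 0) => [|x y Ax Ay]; first by rewrite mulr_ge0 // le_max lexx orbT.
apply: le_trans (vn_le_euclid _ _) _; rewrite -mulrA ler_wpM2l //.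
apply: le_trans (hK x y Ax Ay) _.
apply: le_trans (_ : Num.max K 0 * euclid_dist x y <= _).
  by rewrite ler_wpM2r ?euclid_ge0 // le_max lexx.
by rewrite ler_wpM2l ?euclid_le_vn // le_max lexx orbT.
Qed.

Lemma neighbourhoodP n (c : 'rV[C]_n) (V : set 'rV[C]_n) :
  neighbourhood c V <-> near_pt c V.
Proof.
split=> [[r r0 hr]|[d d0 hd]].
  exists r => // t ht; apply: hr; apply: le_lt_trans (euclid_le_vn _ _) _.
  by rewrite vnBC.
exists (d / n.+1%:R) => [|t]; first by rewrite divr_gt0 // ltr0n.
rewrite ltr_pdivlMr ?ltr0n // => ht; apply: hd; rewrite vnBC.
apply: le_lt_trans (vn_le_euclid _ _) _; apply: le_lt_trans ht.
by rewrite mulrC ler_wpM2l ?euclid_ge0 // ler_nat.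
Qed.

Lemma vn_row_mx n m (x : 'rV[C]_n) (t : 'rV[C]_m) : vn (row_mx x t) = vn x + vn t.
Proof.
rewrite /vn big_split_ord; congr (_ + _); apply: eq_bigr => j _.
  by rewrite row_mxEl.
by rewrite row_mxEr.
Qed.
End EuclideanDistance.

Section Trivializations.
Variable R : realType.
Local Notation C := (complex R).
Local Notation nC := (@ComplexField.Normc.normc R).
Local Notation P m := (mpoly.mpoly m C).
Variables (n p : nat) (g : 'I_p -> P p) (f : 'I_p -> P n).
Variables (Pm : 'M[C]_(n, p)) (Sm : 'M[C]_(p, n)).
Hypothesis SP : Sm *m Pm = 1%:M.
Hypothesis fg : forall y, evmap f y = evmap g (y *m Pm).
Variables (c : 'rV[C]_p) (s : 'rV[C]_p -> 'rV[C]_p -> 'rV[C]_p)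
    (b : 'rV[C]_p -> 'rV[C]_p) (rho delta kappa M : R).
Hypothesis S : sheet_system g c s b rho delta kappa M.

Let V : set 'rV[C]_p := [set t | vn (t - c) < delta].
Let A := prod_set (evmap f @^-1` [set c]) V.

(** Points are moved along the chosen complement of the kernel of the projection,
    as their images move in the sheets. *)
Definition lifted_flow (z : 'rV[C]_(n + p)) : 'rV[C]_n :=
  lsubmx z + (s (lsubmx z *m Pm) (rsubmx z) - lsubmx z *m Pm) *m Sm.

Definition lifted_flow_inv (z : 'rV[C]_n) : 'rV[C]_(n + p) :=
  row_mx (z + (b (z *m Pm) - z *m Pm) *m Sm) (evmap f z).

Lemma lifted_flow_row y t :
  lifted_flow (row_mx y t) = y + (s (y *m Pm) t - y *m Pm) *m Sm.
Proof. by rewrite /lifted_flow row_mxKl row_mxKr. Qed.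

Lemma moved_proj (z : 'rV[C]_n) u : (z + (u - z *m Pm) *m Sm) *m Pm = u.
Proof. by rewrite (mulmxDl z) -mulmxA SP mulmx1 addrC subrK. Qed.

Lemma lifted_flow_proj y t : lifted_flow (row_mx y t) *m Pm = s (y *m Pm) t.
Proof. by rewrite lifted_flow_row moved_proj. Qed.

Lemma lifted_flow_value y t : evmap f y = c -> V t -> evmap f (lifted_flow (row_mx y t)) = t.
Proof.
move=> e Vt; rewrite fg lifted_flow_proj; rewrite fg in e.
by have [_] := ss_section S e Vt.
Qed.

Lemma lifted_flowK y t : evmap f y = c -> V t ->
  lifted_flow_inv (lifted_flow (row_mx y t)) = row_mx y t.
Proof.
move=> e Vt; rewrite /lifted_flow_inv lifted_flow_value // lifted_flow_proj.
rewrite fg in e; rewrite (base_section S e Vt) lifted_flow_row; congr row_mx.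
by rewrite -addrA -mulmxDl addrA subrK subrr mul0mx addr0.
Qed.

Lemma lifted_flow_invA z : V (evmap f z) -> A (lifted_flow_inv z).
Proof.
move=> Vz; exists (z + (b (z *m Pm) - z *m Pm) *m Sm), (evmap f z); split=> //=.
rewrite fg in Vz; rewrite fg moved_proj.
by have [] := ss_cover S Vz.
Qed.

Lemma lifted_flow_invK z : V (evmap f z) -> lifted_flow (lifted_flow_inv z) = z.
Proof.
move=> Vz; rewrite lifted_flow_row moved_proj.
rewrite fg in Vz; rewrite fg (sheet_eq S Vz).
by rewrite -addrA -mulmxDl addrA subrK subrr mul0mx addr0.
Qed.

Lemma lifted_flow_bij : set_bij A (evmap f @^-1` V) lifted_flow.
Proof.
split.
- by move=> _ [y [t [e Vt ->]]]; rewrite /= lifted_flow_value.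
- move=> z z' /set_mem[y [t [e Vt ->]]] /set_mem[y' [t' [e' Vt' ->]]] h.
  by rewrite -(lifted_flowK e Vt) h lifted_flowK.
- move=> z Vz; exists (lifted_flow_inv z); first exact: lifted_flow_invA.
  exact: lifted_flow_invK.
Qed.

Lemma lifted_flow_cancel : {in A, cancel lifted_flow lifted_flow_inv}.
Proof. by move=> _ /set_mem[y [t [e Vt ->]]]; apply: lifted_flowK. Qed.

Lemma V_neighbourhood : neighbourhood c V.
Proof. by apply/neighbourhoodP; exists delta => //; apply: ss_delta S. Qed.

Lemma lifted_flow_lipschitz : vn_lipschitz A lifted_flow.
Proof.
have k0 := ss_kappa S; pose K := mxn Pm; pose L := mxn Sm.
have K0 : 0 <= K by apply: mxn_ge0.
have L0 : 0 <= L by apply: mxn_ge0.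
exists (1 + ((2 + kappa) * (K + 1) + K) * L).
  rewrite addr_ge0 // mulr_ge0 // addr_ge0 // mulr_ge0 // addr_ge0 // ltW //.
move=> _ _ [y [t [e Vt ->]]] [y' [t' [e' Vt' ->]]].
rewrite !lifted_flow_row opp_row_mx add_row_mx vn_row_mx.
rewrite /= fg in e; rewrite /= fg in e'.
have h1 := section_lipschitz S e e' Vt Vt'.
have hK : vn (y *m Pm - y' *m Pm) <= K * vn (y - y') by rewrite -mulmxBl vn_mulmx.
set a := s _ t in h1 *; set a' := s _ t' in h1 *.
have -> : y + (a - y *m Pm) *m Sm - (y' + (a' - y' *m Pm) *m Sm) =
   (y - y') + ((a - a') - (y *m Pm - y' *m Pm)) *m Sm.
  rewrite opprD addrACA -mulmxBl; congr (_ + _ *m _).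
  by rewrite !opprD !opprK addrACA.
apply: le_trans (vnD _ _) _.
have h2 := vn_mulmx ((a - a') - (y *m Pm - y' *m Pm)) Sm; rewrite -/L in h2.
have h3 := vnB (a - a') (y *m Pm - y' *m Pm).
have n1 := vn_ge0 (y - y'); have n2 := vn_ge0 (t - t').
have h4 : vn (a - a' - (y *m Pm - y' *m Pm)) <=
   ((2 + kappa) * (K + 1) + K) * (vn (y - y') + vn (t - t')).
  apply: le_trans h3 _; rewrite mulrDl; apply: lerD.
    apply: le_trans h1 _; rewrite -mulrA ler_wpM2l ?addr_ge0 ?(ltW k0) //.
    rewrite mulrDl mul1r mulrDr; have := mulr_ge0 K0 n2; lra.
  by apply: le_trans hK _; rewrite mulrDr lerDl mulr_ge0.
have h5 := ler_wpM2l L0 h4.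
rewrite mulrDl mul1r; apply: lerD; first by rewrite lerDl.
by apply: le_trans h2 _; apply: le_trans h5 _; rewrite mulrCA mulrA.
Qed.

Lemma evmap_lipschitz m q (h : 'I_m -> P q) (B : R) : exists2 L, 0 <= L &
  forall x y, vn x <= B -> vn y <= B -> vn (evmap h x - evmap h y) <= L * vn (x - y).
Proof.
have H i : exists L : R, 0 <= L /\ forall x y, vn x <= B -> vn y <= B ->
    nC (pev (h i) x - pev (h i) y) <= L * vn (x - y).
  by have [L L0 hL] := pev_lipschitz (h i) B; exists L.
have [L hL] := choice H.
exists (\sum_i L i) => [|x y hx hy]; first by apply: sumr_ge0 => i _; case: (hL i).
rewrite {1}/vn mulr_suml; apply: ler_sum => i _; rewrite !mxE.
by case: (hL i) => _; apply.
Qed.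

Lemma lifted_flow_inv_lipschitz : vn_lipschitz (evmap f @^-1` V) lifted_flow_inv.
Proof.
pose K := mxn Pm; pose L := mxn Sm.
have K0 : 0 <= K by apply: mxn_ge0.
have L0 : 0 <= L by apply: mxn_ge0.
have [D D0 hD] := evmap_lipschitz g M.
exists (1 + (2 * K + K) * L + D * K).
  by rewrite addr_ge0 ?mulr_ge0 // addr_ge0 ?mulr_ge0 // addr_ge0 ?mulr_ge0.
move=> z z'; rewrite /= !fg => Vz Vz'.
rewrite /lifted_flow_inv opp_row_mx add_row_mx vn_row_mx !fg.
have hK : vn (z *m Pm - z' *m Pm) <= K * vn (z - z') by rewrite -mulmxBl vn_mulmx.
have hb := base_lipschitz S Vz Vz'.
have hg := hD _ _ (ss_bounded S Vz) (ss_bounded S Vz').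
set a := b _ in hb *; set a' := b _ in hb *.
have n1 := vn_ge0 (z - z').
rewrite mulrDl; apply: lerD; last first.
  by apply: le_trans hg _; rewrite -mulrA ler_wpM2l.
have -> : z + (a - z *m Pm) *m Sm - (z' + (a' - z' *m Pm) *m Sm) =
   (z - z') + ((a - a') - (z *m Pm - z' *m Pm)) *m Sm.
  rewrite opprD addrACA -mulmxBl; congr (_ + _ *m _).
  by rewrite !opprD !opprK addrACA.
apply: le_trans (vnD _ _) _; rewrite mulrDl mul1r lerD2l.
apply: le_trans (vn_mulmx _ _) _; rewrite -/L [leRHS]mulrAC [leRHS]mulrC ler_wpM2l //.
apply: le_trans (vnB _ _) _; rewrite mulrDl; apply: lerD => //.
by apply: le_trans hb _; rewrite -mulrA ler_wpM2l.
Qed.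

Lemma sheets_lipschitz_trivial : lipschitz_trivial_values (polymap f) c.
Proof.
exists V, lifted_flow; split; first exact: V_neighbourhood; last first.
  by move=> y t e Vt; apply: lifted_flow_value.
split; first exact: lifted_flow_bij.
split; first exact/vn_lipschitzP/lifted_flow_lipschitz.
exists lifted_flow_inv; split; first exact: lifted_flow_cancel.
exact/vn_lipschitzP/lifted_flow_inv_lipschitz.
Qed.
End Trivializations.

Section SmoothTrivialization.
Variable R : realType.
Local Notation C := (complex R).
Local Notation nC := (@ComplexField.Normc.normc R).
Local Notation P m := (mpoly.mpoly m C).

Lemma near_ball_of n (x y : 'rV[C]_n) (r : R) : vn (x - y) < r ->
  near_pt x (fun z => vn (z - y) < r).
Proof.
move=> h; exists (r - vn (x - y)) => [|z hz]; first by rewrite subr_gt0.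
by apply: le_lt_trans (vn_tri z x y) _; rewrite -ltrBrDr.
Qed.

Lemma near_inv n (q : P n) x (eps : R) : pev q x != 0 -> 0 < eps ->
  near_pt x (fun z => nC ((pev q z)^-1 - (pev q x)^-1) < eps).
Proof.
move=> qx e0; have a0 : 0 < nC (pev q x) by rewrite nC_gt0.
have d0 : 0 < eps * (nC (pev q x) / 2 * nC (pev q x)) by rewrite !mulr_gt0 // invr_gt0 ltr0n.
apply: near_mono (near_and (near_nonzero qx) (near_pev x q d0)) => z [h1 h2].
have qz : pev q z != 0.
  by rewrite -nC_gt0; apply: le_lt_trans h1; rewrite divr_ge0 // ltW.
have -> : (pev q z)^-1 - (pev q x)^-1 = (pev q x - pev q z) / (pev q z * pev q x).
  by field; rewrite qx qz.
rewrite nCM nCV nCM ltr_pdivrMr ?mulr_gt0 ?nC_gt0 // nCBC.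
by apply: lt_le_trans h2 _; rewrite !ler_pM2l // ler_pM2r // ltW.
Qed.

Section Widen.
Variables (n k : nat).

Definition widen_poly (q : P n) : P (n + k) :=
  mmap (@mpolyC (n + k) C) (fun i => mpolyX C (mnm1 (lshift k i))) q.

Lemma pev_widen (q : P n) (x : 'rV[C]_n) (w : 'rV[C]_k) :
  pev (widen_poly q) (row_mx x w) = pev q x.
Proof.
rewrite /pev meval_mmap; apply: meval_eq => i.
by rewrite mevalXU row_mxEl.
Qed.
End Widen.

Variables (p : nat) (g : 'I_p -> P p).
Variables (c : 'rV[C]_p) (s : 'rV[C]_p -> 'rV[C]_p -> 'rV[C]_p)
    (b : 'rV[C]_p -> 'rV[C]_p) (rho delta kappa M : R).
Hypothesis S : sheet_system g c s b rho delta kappa M.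

Lemma vn_delta j (z : C) : vn (z *: delta_mx 0 j : 'rV[C]_p) = nC z.
Proof.
rewrite vnZ /vn (bigD1 j) //= mxE !eqxx nC1 big1 ?addr0 ?mulr1 // => i ij.
by rewrite mxE (negPf ij) andbF nC0.
Qed.

Lemma section_close y t t' : evmap g y = c -> vn (t - c) < delta -> vn (t' - c) < delta ->
  vn (s y t' - s y t) <= kappa * vn (t' - t).
Proof.
move=> e h h'; have [hs es] := ss_section S e h; have [hs' es'] := ss_section S e h'.
by have := ss_inverse S e hs' hs; rewrite es es'.
Qed.

(** Differentiate g o s = id at a point where the differential of g is
    invertible. *)
Lemma section_has_d y t j k : evmap g y = c -> vn (t - c) < delta ->
  has_d (fun z => s y (t + z *: delta_mx 0 j) 0 k)
        (((delta_mx 0 j : 'rV[C]_p) *m invmx (diffmx g (s y t))) 0 k).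
Proof.
move=> e ht eps e0; have [hx ex] := ss_section S e ht.
set x := s y t in hx ex *.
have uD : diffmx g x \in unitmx by apply: diffmx_unit; apply: ss_regular S _ _ e hx.
have k0 := ss_kappa S.
pose E := invmx (diffmx g x); have E0 := mxn_ge0 E.
have q0 : 0 < mxn E * kappa + 1 by rewrite ltr_wpDl // mulr_ge0 // ltW.
have e1 : 0 < eps / (mxn E * kappa + 1) by rewrite divr_gt0.
have [r r0 hr] := strict_diff g x e1.
have dt : 0 < delta - vn (t - c) by rewrite subr_gt0.
have k1 : 0 < kappa + 1 by rewrite ltr_wpDl // ltW.
have rk : 0 < r / (kappa + 1) by rewrite divr_gt0.
exists (Num.min (delta - vn (t - c)) (r / (kappa + 1))) => [|z].
  by rewrite lt_min dt.
rewrite lt_min ltr_pdivlMr // => /andP[hz1 hz2].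
set t' := t + z *: delta_mx 0 j.
have tt : t' - t = z *: delta_mx 0 j by rewrite /t' addrC addKr.
have ht' : vn (t' - c) < delta.
  by apply: le_lt_trans (vn_tri t' t c) _; rewrite tt vn_delta -ltrBrDr.
have cl := section_close e ht ht'; rewrite tt vn_delta -/x in cl.
have near_x : vn (s y t' - x) < r.
  by apply: le_lt_trans cl _; apply: le_lt_trans hz2; rewrite mulrC ler_wpM2l ?nC_ge0 // lerDl.
have := hr x (s y t'); rewrite subrr vn0 => /(_ r0 near_x).
have [_ es'] := ss_section S e ht'; rewrite es' ex tt => h.
rewrite scale0r addr0 -/x -/t'.
have -> : s y t' 0 k - x 0 k - z * ((delta_mx 0 j : 'rV[C]_p) *m invmx (diffmx g x)) 0 k =
   (- ((z *: delta_mx 0 j - (s y t' - x) *m diffmx g x) *m E)) 0 k.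
  rewrite [in RHS]mulmxBl -[in RHS]mulmxA mulmxV // mulmx1 -scalemxAl opprB.
  by rewrite !mxE.
apply: le_trans (nC_le_vn _ _) _; rewrite vnN.
apply: le_trans (vn_mulmx _ _) _; apply: le_trans (ler_wpM2l E0 h) _.
apply: le_trans (_ : mxn E * (eps / (mxn E * kappa + 1) * (kappa * nC z)) <= _).
  by rewrite ler_wpM2l // ler_wpM2l // ltW.
have -> : mxn E * (eps / (mxn E * kappa + 1) * (kappa * nC z)) =
  eps * nC z * (mxn E * kappa / (mxn E * kappa + 1)) by field; rewrite gt_eqF.
rewrite ler_piMr ?mulr_ge0 ?nC_ge0 ?(ltW e0) // ler_pdivrMr // mul1r lerDl //.
Qed.

Let D : 'M[P p]_p := \matrix_(a, i) mderiv a (g i).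

Let Dx x : diffmx g x = map_mx (meval (fun j => x 0 j)) D.
Proof. by apply/matrixP => a i; rewrite !mxE. Qed.

(** The section y together with the reciprocal of the Jacobian determinant along
    it: by Cramer's rule its partial derivatives are polynomials in it. *)
Let T (y : 'rV[C]_p) (z : 'rV[C]_(p + p)) : 'rV[C]_(p + 1) :=
  row_mx (s y (rsubmx z)) (const_mx (pev (jacobian g) (s y (rsubmx z)))^-1).

(* The extra variable stands for the reciprocal of the Jacobian determinant. *)
Let inv_var : P (p + 1) := mpolyX C (mnm1 (rshift p (ord0 : 'I_1))).

Let dsection (j a : 'I_p) : P (p + 1) := inv_var * widen_poly 1 ((\adj D) j a).

(* The section does not depend on the first block of variables. *)
Let BT (j : 'I_(p + p)) (k : 'I_(p + 1)) : P (p + 1) :=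
  match fintype.split j with
  | inl _ => 0
  | inr j' => match fintype.split k with
              | inl a => dsection j' a
              | inr _ => - (inv_var * inv_var) *
                   \sum_a widen_poly 1 (mderiv a (jacobian g)) * dsection j' a
              end
  end.

(* A point of the product close to the base y: there the trivialization is given *)
(* by the section y alone, as the other points of the fibre are far away. *)
Let O (y : 'rV[C]_p) (z : 'rV[C]_(p + p)) : Prop :=
  vn (lsubmx z - y) < rho /\ vn (rsubmx z - c) < delta.

Let near_rsub (z : 'rV[C]_(p + p)) Q : near_pt (rsubmx z) Q -> near_pt z (fun w => Q (rsubmx w)).
Proof.
move=> [d d0 hd]; exists d => // w hw; apply: hd; apply: le_lt_trans hw.
by rewrite -[w]hsubmxK -[z]hsubmxK opp_row_mx add_row_mx !row_mxKr vn_row_mx lerDr vn_ge0.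
Qed.

Let near_lsub (z : 'rV[C]_(p + p)) Q : near_pt (lsubmx z) Q -> near_pt z (fun w => Q (lsubmx w)).
Proof.
move=> [d d0 hd]; exists d => // w hw; apply: hd; apply: le_lt_trans hw.
by rewrite -[w]hsubmxK -[z]hsubmxK opp_row_mx add_row_mx !row_mxKl vn_row_mx lerDl vn_ge0.
Qed.

Let openO y : vn_open (O y).
Proof.
move=> z [h1 h2]; apply: near_and.
  by apply: near_lsub (near_ball_of h1).
by apply: near_rsub (near_ball_of h2).
Qed.

Let contT y : evmap g y = c -> forall z, O y z -> forall eps : R, 0 < eps ->
  near_pt z (fun w => vn (T y w - T y z) < eps).
Proof.
move=> e z [h1 h2] eps e0; have [hx ex] := ss_section S e h2.
have Jx := ss_regular S e hx; have k0 := ss_kappa S.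
have k1 : 0 < kappa + 1 by rewrite ltr_wpDl // ltW.
have e2 : 0 < eps / 2 by rewrite divr_gt0 // ltr0n.
have e3 : 0 < eps / 2 / (kappa + 1) by rewrite divr_gt0 // ltr_wpDl // ltW.
have [d d0 hd] := near_inv Jx e2.
have dk : 0 < d / (kappa + 1) by rewrite divr_gt0 // ltr_wpDl // ltW.
apply: near_mono (near_rsub (near_and (near_ball_of h2)
   (near_and (near_ball _ e3) (near_ball _ dk)))) => w [hw [w1 w2]].
have cl := section_close e h2 hw.
rewrite /T opp_row_mx add_row_mx vn_row_mx [ltRHS]splitr.
have lek (a : R) : vn (rsubmx w - rsubmx z) < a / (kappa + 1) ->
    vn (s y (rsubmx w) - s y (rsubmx z)) < a.
  rewrite ltr_pdivlMr // => h; apply: le_lt_trans cl _.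
  by apply: le_lt_trans h; rewrite mulrC ler_wpM2l ?vn_ge0 // lerDl.
apply: ltrD; first exact: lek.
by rewrite /vn big_ord1 !mxE; apply: hd; apply: lek.
Qed.

Let derT y : evmap g y = c -> forall z, O y z -> forall j k,
  has_d (fun w => T y (z + w *: delta_mx 0 j) 0 k) (pev (BT j k) (T y z)).
Proof.
move=> e z [h1 h2] j k; rewrite /BT; case: (split_ordP j) => j' ->.
  have -> : pev 0 (T y z) = 0 by apply: meval0.
  apply: has_d_ext (has_d_const (T y z 0 k)) => w.
  suff -> : T y (z + w *: delta_mx 0 (lshift p j')) = T y z by [].
  rewrite /T; suff -> : rsubmx (z + w *: delta_mx 0 (lshift p j')) = rsubmx z by [].
  by apply/rowP => i; rewrite !mxE eq_rlshift andbF mulr0 addr0.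
have Er w : rsubmx (z + w *: delta_mx 0 (rshift p j')) = rsubmx z + w *: delta_mx 0 j'.
  by apply/rowP => i; rewrite !mxE (inj_eq (@rshift_inj _ _)).
have [hx ex] := ss_section S e h2; set x := s y (rsubmx z) in hx ex *.
have Jx := ss_regular S e hx.
have uD := diffmx_unit Jx.
have Tz : T y z = row_mx x (const_mx (pev (jacobian g) x)^-1) by [].
have dsecE a : pev (dsection j' a) (T y z) = ((delta_mx 0 j' : 'rV[C]_p) *m invmx (diffmx g x)) 0 a.
  rewrite /dsection pevM Tz pev_widen /inv_var pevX row_mxEr mxE -rowE mxE.
  rewrite /invmx uD mxE det_diffmx [RHS]mxE; congr (_ * _).
  by rewrite Dx -map_mx_adj !mxE.
have ds a : has_d (fun w => s y (rsubmx z + w *: delta_mx 0 j') 0 a) (pev (dsection j' a) (T y z)).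
  by rewrite dsecE; apply: section_has_d.
case: (split_ordP k) => a ->.
  by apply: has_d_ext (ds a) => w; rewrite /T Er row_mxEl.
have hJ : has_d (fun w => pev (jacobian g) (s y (rsubmx z + w *: delta_mx 0 j')))
    (pdiff (jacobian g) x (evmap (dsection j') (T y z))).
  have := @has_d_pev R p (jacobian g) (fun w => s y (rsubmx z + w *: delta_mx 0 j'))
     (evmap (dsection j') (T y z)).
  rewrite scale0r addr0; apply => a'; rewrite mxE; exact: ds.
have := has_dV hJ; rewrite scale0r addr0 -/x => /(_ Jx) hV.
have -> : pev (- (inv_var * inv_var) *
    \sum_a' widen_poly 1 (mderiv a' (jacobian g)) * dsection j' a') (T y z) =
    - pdiff (jacobian g) x (evmap (dsection j') (T y z)) / pev (jacobian g) x ^+ 2.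
  rewrite pevM.
  have -> : pev (- (inv_var * inv_var)) (T y z) = - (pev (jacobian g) x ^+ 2)^-1.
    have -> : pev (- (inv_var * inv_var)) (T y z) = - pev (inv_var * inv_var) (T y z).
      exact: mevalN.
    by rewrite pevM /inv_var pevX Tz row_mxEr mxE -expr2 exprVn.
  have -> : pev (\sum_a' widen_poly 1 (mderiv a' (jacobian g)) * dsection j' a') (T y z) =
     \sum_a' pev (widen_poly 1 (mderiv a' (jacobian g)) * dsection j' a') (T y z).
    exact: rmorph_sum.
  have -> : \sum_a' pev (widen_poly 1 (mderiv a' (jacobian g)) * dsection j' a') (T y z) =
     pdiff (jacobian g) x (evmap (dsection j') (T y z)).
    by apply: eq_bigr => a' _; rewrite pevM {1}Tz pev_widen mxE.
  by rewrite mulrC mulrN mulNr.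
by apply: has_d_ext hV => w; rewrite /T Er row_mxEr mxE.
Qed.

Let V : set 'rV[C]_p := [set t | vn (t - c) < delta].
Let SP : 1%:M *m 1%:M = 1%:M :> 'M[C]_p.
Proof. exact: mulmx1. Qed.
Let fg y : evmap g y = evmap g (y *m 1%:M).
Proof. by rewrite mulmx1. Qed.
(* With pi the identity, the lifted flow is the flow along the sheets. *)
Let H := lifted_flow 1%:M 1%:M s.
Let G := lifted_flow_inv g 1%:M 1%:M b.

Lemma sheets_smooth_trivial : smooth_trivial_values (polymap g) c.
Proof.
exists V, H; split; first exact: V_neighbourhood S; last first.
  by move=> y t e Vt; apply: (lifted_flow_value SP fg S).
split; first exact: (lifted_flow_bij SP fg S).
split; last first.
  exists G; split; first exact: (lifted_flow_cancel SP fg S).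
  move=> a Va; pose y0 := b a.
  have [e0 ha] := ss_cover S (Va : vn (evmap g a - c) < delta).
  pose Oa x := vn (x - y0) < rho.
  pose Q (i : 'I_(p + p)) : P p :=
    match fintype.split i with inl k => mpolyC p (y0 0 k) | inr k => g k end.
  have oO : vn_open Oa by move=> x /near_ball_of.
  exists [set u | Oa (unrealify u)], (fun u => realify (evmap Q (unrealify u))); split.
  - exact: (open_unrealify oO).
  - by rewrite /= realifyK.
  - by move=> k; apply: (polynomial_smooth Q k oO).
  - move=> x Vx; rewrite /= realifyK => hx; congr realify.
    rewrite /G /lifted_flow_inv !mulmx1 addrC subrK (ss_base S e0 hx).
    apply/rowP => i; rewrite [RHS]mxE /Q; case: (split_ordP i) => k ->.
      by rewrite row_mxEl pevC.
    by rewrite row_mxEr mxE.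
move=> _ [y [t [e Vt ->]]].
pose Q (i : 'I_p) : P (p + 1) := mpolyX C (mnm1 (lshift 1 i)).
have QT z : evmap Q (T y z) = s y (rsubmx z).
  by apply/rowP => i; rewrite mxE pevX row_mxEl.
exists [set u | O y (unrealify u)], (fun u => realify (evmap Q (T y (unrealify u)))); split.
- exact: (open_unrealify (openO (y := y))).
- by rewrite /= realifyK /O row_mxKl row_mxKr subrr vn0; split=> //; apply: ss_rho S.
- by move=> k; apply: (pfaffian_smooth (openO (y := y)) (contT e) (derT e)).
- move=> _ [y' [t' [e' Vt' ->]]]; rewrite /= realifyK QT row_mxKr => -[].
  rewrite row_mxKl => hy _.
  have -> : y' = y.
    apply/eqP/negPn/negP => ne; have := ss_separated S e' e ne.
    by have := ss_rho S; lra.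
  by rewrite /H lifted_flow_row !mulmx1 addrC subrK.
Qed.
End SmoothTrivialization.

(** * Trivial values are good *)

Section TrivialIsGood.
Variable R : realType.
Local Notation C := (complex R).
Local Notation P m := (mpoly.mpoly m C).

(** A bi-Lipschitz trivialization moves each point above V to any other fibre above
    V by a displacement controlled by that of the value, and its inverse bounds
    the variation of the value by that of the point. *)
Lemma lipschitz_trivial_bounds n p (phi : 'rV[C]_n -> 'rV[C]_p) c :
  lipschitz_trivial_values phi c -> exists K r : R, [/\ 0 <= K, 0 < r,
   forall y t, vn (phi y - c) < r -> vn (t - c) < r ->
     exists2 y', phi y' = t & vn (y' - y) <= K * vn (t - phi y) &
   forall y y', vn (phi y - c) < r -> vn (phi y' - c) < r ->
     vn (phi y - phi y') <= K * vn (y - y')].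
Proof.
move=> [V [H [/neighbourhoodP[r r0 hr] [[_ _ Hsur] [hH [G [HG hG]]]] tr]]].
have [K1 K10 h1] := (vn_lipschitzP _ _).2 hH; have [K2 K20 h2] := (vn_lipschitzP _ _).2 hG.
have lift y : vn (phi y - c) < r -> exists2 x, phi x = c & H (row_mx x (phi y)) = y.
  move=> /hr Vy; have [_ [x [t [ex Vt ->]]] e] := Hsur y Vy.
  by exists x => //; rewrite -{1}e tr.
exists (K1 + K2), r; split=> // [|y t hy ht|y y' hy hy']; first exact: addr_ge0.
  have [x ex e] := lift y hy; exists (H (row_mx x t)); first by apply: tr => //; apply: hr.
  rewrite -[X in vn (_ - X)]e.
  apply: le_trans (h1 _ _ _ _) _; [by exists x, t; split=> //; apply: hr|
     by exists x, (phi y); split=> //; apply: hr|].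
  rewrite opp_row_mx add_row_mx subrr vn_row_mx vn0 add0r.
  by rewrite ler_wpM2r ?vn_ge0 // lerDl.
have Gy z : vn (phi z - c) < r -> exists x, G z = row_mx x (phi z).
  move=> hz; have [x ex e] := lift z hz; exists x; rewrite -{1}e HG //.
  by apply/mem_set; exists x, (phi z); split=> //; apply: hr.
have [x ex] := Gy y hy; have [x' ex'] := Gy y' hy'.
have := h2 y y' (hr _ hy) (hr _ hy'); rewrite ex ex' opp_row_mx add_row_mx vn_row_mx.
move=> h; apply: le_trans (_ : K2 * vn (y - y') <= _).
  by apply: le_trans h; rewrite lerDr vn_ge0.
by rewrite ler_wpM2r ?vn_ge0 // lerDr.
Qed.

Lemma lipschitz_trivial_linearly_open n p (f : 'I_p -> P n) c :
  lipschitz_trivial_values (evmap f) c -> exists2 r : R, 0 < r &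
    forall x, vn (evmap f x - c) < r -> linearly_open_at f x.
Proof.
move=> /lipschitz_trivial_bounds[K [r [K0 r0 h1 _]]]; exists r => // x hx j.
exists K, (r - vn (evmap f x - c)); split=> [|s s0 hs]; first by rewrite subr_gt0.
set t := _ + _ *: _.
have tx : vn (t - evmap f x) = s.
  by rewrite /t addrC addKr vn_delta nC_real gtr0_norm.
have [|x' ex' hx'] := h1 x t hx.
  by apply: le_lt_trans (vn_tri t (evmap f x) c) _; rewrite tx -ltrBrDr.
by exists x' => //; rewrite -tx.
Qed.

(** Points of C^p are transported to C^n by the section Sm of pi, moved there by the
    trivialization of f, and projected back. The fibre of g over c is then free of
    critical points, hence finite, and every point over a small ball is within a
    bounded distance of it. *)
Lemma lipschitz_trivial_good n p (g : 'I_p -> P p) (f : 'I_p -> P n)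
    (Pm : 'M[C]_(n, p)) (Sm : 'M[C]_(p, n)) c :
  independent g -> Sm *m Pm = 1%:M -> (forall y, evmap f y = evmap g (y *m Pm)) ->
  lipschitz_trivial_values (evmap f) c -> good_value g c.
Proof.
move=> ig SP fg Lc; have [K [r [K0 r0 h1 _]]] := lipschitz_trivial_bounds Lc.
have lift x : evmap f (x *m Sm) = evmap g x by rewrite fg -mulmxA SP mulmx1.
have hJ x : evmap g x = c -> pev (jacobian g) x != 0.
  move=> ex; apply: linearly_open_unit => j.
  exists (mxn Pm * K), r; split=> // s s0 hs.
  have tx : vn (evmap g x + real_complex R s *: delta_mx 0 j - c) = s.
    by rewrite ex addrC addKr vn_delta nC_real gtr0_norm.
  have [||y' ey' hy'] := h1 (x *m Sm) (evmap g x + real_complex R s *: delta_mx 0 j).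
  - by rewrite lift ex subrr vn0.
  - by rewrite tx.
  exists (y' *m Pm); first by rewrite -fg.
  have -> : y' *m Pm - x = (y' - x *m Sm) *m Pm.
    by rewrite mulmxBl -mulmxA SP mulmx1.
  apply: le_trans (vn_mulmx _ _) _; rewrite -mulrA ler_wpM2l ?mxn_ge0 //.
  by apply: le_trans hy' _; rewrite lift addrC addKr vn_delta nC_real gtr0_norm.
split=> //.
have [A hA] := coordinate_annihilators ig.
have [F hF] := fibre_finite hA hJ.
exists r, (\sum_(y <- F) vn y + mxn Pm * (K * r)); split=> // x hx.
have [||y' ey' hy'] := h1 (x *m Sm) c; rewrite ?lift ?subrr ?vn0 //.
have yF : y' *m Pm \in F by apply/hF; rewrite -fg.
have e : x = y' *m Pm - (y' - x *m Sm) *m Pm.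
  by rewrite mulmxBl -mulmxA SP mulmx1 opprB addrC subrK.
rewrite {1}e; apply: le_trans (vnB _ _) _; apply: lerD.
  by apply: ler_sum_mem => // z; apply: vn_ge0.
apply: le_trans (vn_mulmx _ _) _; rewrite ler_wpM2l ?mxn_ge0 //.
apply: le_trans hy' _; rewrite ler_wpM2l // lift vnBC; exact: ltW.
Qed.

(** A smooth trivialization is Lipschitz near each point of the fibre over c: this
    gives the absence of critical points, hence finiteness of the fibre. Then the
    continuity at finitely many points bounds the preimage of a small ball. *)
Lemma smooth_trivial_good p (g : 'I_p -> P p) c : independent g ->
  smooth_trivial_values (evmap g) c -> good_value g c.
Proof.
move=> ig [V [H [/neighbourhoodP[r r0 hr] [[Hin _ Hsur] [smH _]] tr]]].
have Vc : V c by apply: hr; rewrite subrr vn0.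
have lift y : vn (evmap g y - c) < r -> exists2 x, evmap g x = c & H (row_mx x (evmap g y)) = y.
  move=> /hr Vy; have [_ [x [t [ex Vt ->]]] e] := Hsur y Vy.
  by exists x => //; rewrite -{1}e tr.
have local x0 : evmap g x0 = c -> exists (U : set 'rV[R]_((p + p) + (p + p)))
    (F : 'rV[R]_((p + p) + (p + p)) -> 'rV[R]_(p + p)),
    [/\ open U, U (realify (row_mx x0 c)), forall k, Ck_on k U F &
        forall t, V t -> U (realify (row_mx x0 t)) ->
          realify (H (row_mx x0 t)) = F (realify (row_mx x0 t))].
  move=> e; have [|U [F [oU Ua FC FH]]] := smH (row_mx x0 c); first by exists x0, c.
  by exists U, F; split=> // t Vt Ut; apply: FH => //; exists x0, t.
have hJ x : evmap g x = c -> pev (jacobian g) x != 0.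
  move=> ex; apply: linearly_open_unit => j.
  have [|x0 e0 Hx] := lift x; first by rewrite ex subrr vn0.
  rewrite ex in Hx.
  have [U [F [oU Ua FC FH]]] := local x0 e0.
  have [_ /(_ (lshift (p + p) (rshift p j)))[dF _]] := FC 1%N.
  set v := delta_mx _ _ in dF; set u := realify (row_mx x0 c) in Ua FH *.
  have /cvg_ex[/= D hD] := dF u Ua.
  have vE : v = realify (row_mx 0 (delta_mx 0 j) : 'rV[C]_(p + p)).
    rewrite /v delta_lshift scale1r; congr realify.
    by rewrite -[LHS]hsubmxK; congr row_mx; apply/rowP => i; rewrite !mxE /=
      ?eq_lrshift ?(inj_eq (@rshift_inj _ _)).
  have uE (s : R) : s *: v + u = realify (row_mx x0 (c + real_complex R s *: delta_mx 0 j)).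
    rewrite vE -realifyZ -realifyD; congr realify.
    by rewrite scale_row_mx add_row_mx scaler0 add0r addrC.
  have n1 : \forall s \near (0 : R), U (s *: v + u).
    have oU' : nbhs u U by apply: open_nbhs_nbhs.
    have c0 : (fun s : R => s *: v + u) @ 0 --> 0 *: v + u.
      by apply: cvgD; [apply: cvgZr_tmp; apply: cvg_id|apply: cvg_cst].
    rewrite scale0r add0r in c0; exact: c0 oU'.
  move: hD => /cvgrPdist_le /(_ 1 ltr01).
  rewrite /dnbhs near_withinE => /nbhs_ballP[d /= d0 hd].
  move: n1 => /nbhs_ballP[d' /= d'0 hd'].
  exists ((p%:R * 2) * (`|D| + 1)), (Num.min r (Num.min d d')).
  split=> [|s s0]; first by rewrite !lt_min r0 d0.
  rewrite !lt_min => /and3P[sr sd sd'].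
  have ts : vn (c + real_complex R s *: delta_mx 0 j - c) = s.
    by rewrite addrC addKr vn_delta nC_real gtr0_norm.
  have Vs : V (c + real_complex R s *: delta_mx 0 j) by apply: hr; rewrite ts.
  have bs (e : R) : s < e -> ball 0 e s.
    by rewrite -ball_normE /= sub0r normrN gtr0_norm.
  exists (H (row_mx x0 (c + real_complex R s *: delta_mx 0 j))).
    by rewrite ex; apply: tr.
  apply: le_trans (vn_le_realify _) _; rewrite -[leRHS]mulrA ler_wpM2l ?mulr_ge0 //.
  have Us := hd' s (bs _ sd'); rewrite /= uE in Us.
  rewrite -Hx realifyB FH // -uE.
  rewrite FH //= -/u.
  have := hd s (bs _ sd) (lt0r_neq0 s0) => /=.
  set w := _ - F u => h.
  have -> : w = s *: (D - (D - s^-1 *: w)).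
    by rewrite opprB addrC subrK scalerA mulfV ?scale1r // lt0r_neq0.
  rewrite normrZ gtr0_norm // mulrC ler_wpM2r ?(ltW s0) //.
  by apply: le_trans (ler_normB _ _) _; rewrite lerD2l.
split=> //.
have [A hA] := coordinate_annihilators ig.
have [F hF] := fibre_finite hA hJ.
have nb : near_pt c (fun t => forall x0, x0 \in F ->
     vn (H (row_mx x0 t) - H (row_mx x0 c)) <= p%:R * 2).
  apply: near_seq => x0 /hF e0.
  have [U [Fm [oU Ua FC FH]]] := local x0 e0; set u := realify (row_mx x0 c) in Ua FH *.
  have [cF _] := FC 0%N; have cFu : Fm @ u --> Fm u := cF u Ua.
  have FF : Filter (nbhs u) by apply: nbhs_filter.
  have oU' : nbhs u U by apply: open_nbhs_nbhs.
  move: cFu => /cvgrPdist_lt /(_ 1 ltr01) n1.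
  have : nbhs u (U `&` [set t | `|Fm u - Fm t| < 1]) by apply: filterI.
  move=> /nbhs_ballP[d /= d0 hd].
  exists (Num.min r d) => [|t]; first by rewrite lt_min r0.
  rewrite lt_min => /andP[/hr Vt ht].
  have bt : ball u d (realify (row_mx x0 t)).
    rewrite -ball_normE /= -realifyB; apply: le_lt_trans (norm_realify_le _) _.
    by rewrite opp_row_mx add_row_mx subrr vn_row_mx vn0 add0r vnBC.
  have [Ut Ft] := hd _ bt.
  apply: le_trans (vn_le_realify _) _; rewrite ler_piMr ?mulr_ge0 //.
  by rewrite realifyB FH // FH // -normrN opprB ltW.
have [d d0 hd] := near_and nb (near_ball c r0).
exists d, (\sum_(y <- F) vn (H (row_mx y c)) + p%:R * 2); split=> // x hx.
have [hF' hr'] := hd _ hx; have [x0 e0 e] := lift x hr'.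
have x0F : x0 \in F by apply/hF.
have := hF' x0 x0F; rewrite e => h.
rewrite -[x](subrK (H (row_mx x0 c))) addrC; apply: le_trans (vnD _ _) _.
apply: lerD => //.
by apply: (ler_sum_mem (F := fun y => vn (H (row_mx y c)))) => // z; apply: vn_ge0.
Qed.
End TrivialIsGood.

(** * Factorization through a projection *)

(** At a point where e is invertible the equation determines the Taylor coefficients of a
    solution one after the other, as for a linear differential equation. *)
Lemma linear_system_unique (K : numFieldType) p (e : {poly K})
    (A : 'I_p -> 'I_p -> {poly K}) (y : 'I_p -> {poly K}) : e`_0 != 0 ->
  (forall i, e * (y i)^`() = \sum_k A i k * y k) -> (forall i, (y i)`_0 = 0) ->
  forall i, y i = 0.
Proof.
move=> e0 ode y0.
have H m : forall k, (k <= m)%N -> forall i, (y i)`_k = 0.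
  elim: m => [|m IH] k; first by rewrite leqn0 => /eqP -> i.
  rewrite leq_eqVlt => /orP[/eqP ->|/IH //] i.
  have := congr1 (fun q : {poly K} => q`_m) (ode i); rewrite coef_sum.
  rewrite big1 => [|k' _]; last first.
    by rewrite coefM big1 // => j _; rewrite IH ?mulr0 ?leq_subr.
  rewrite coefM big_ord_recl big1 => [|j _]; last first.
    by rewrite coef_deriv IH ?mul0rn ?mulr0 // lift0 subnSK // leq_subr.
  rewrite addr0 subn0 coef_deriv => /eqP.
  by rewrite mulf_eq0 (negPf e0) mulrn_eq0 /= => /eqP.
by move=> i; apply/polyP => m; rewrite coef0 (H m).
Qed.

Section LinearFactorization.
Variable R : rcfType.
Local Notation C := (complex R).
Local Notation P m := (mpoly.mpoly m C).
Variables (n p : nat) (f : 'I_p -> P n).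

(** Over the fractions this expresses the Hessians of f through its gradients; e
    clears all denominators. *)
Definition gradient_closed (e : P n) (a : 'I_p -> 'I_n -> 'I_p -> P n) : Prop :=
  forall i j v, e * mderiv v (mderiv j (f i)) = \sum_k a i j k * mderiv v (f k).

(** The product of all denominators. *)
Lemma common_denominator :
  (forall i j, exists e c, e != 0 /\ forall u,
    e * mderiv u (mderiv j (f i)) = \sum_k c k * mderiv u (f k)) ->
  exists e a, e != 0 /\ gradient_closed e a.
Proof.
move=> H.
have H' (ij : 'I_p * 'I_n) : exists ec : P n * ('I_p -> P n), ec.1 != 0 /\ forall u,
    ec.1 * mderiv u (mderiv ij.2 (f ij.1)) = \sum_k ec.2 k * mderiv u (f k).
  by have [e [c h]] := H ij.1 ij.2; exists (e, c).
have [ec hec] := choice H'.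
exists (\prod_ij (ec ij).1), (fun i j k => \prod_(ij | ij != (i, j)) (ec ij).1 * (ec (i, j)).2 k).
split=> [|i j v]; first by apply/prodf_neq0 => ij _; case: (hec ij).
rewrite (bigD1 (i, j)) //= mulrAC (hec (i, j)).2 mulr_suml.
by apply: eq_bigr => k _; rewrite -mulrA mulrC.
Qed.

(** Along any line through a point where e does not vanish, the derivatives of f
    in the direction w solve a linear system; hence they vanish everywhere as soon as
    they vanish at that point. *)
Lemma kernel_constant e a x0 (w : 'rV[C]_n) : gradient_closed e a -> pev e x0 != 0 ->
  w *m diffmx f x0 = 0 -> forall x, w *m diffmx f x = 0.
Proof.
move=> hc e0 w0 x; pose u := x - x0.
pose L := on_line x0 u.
pose y i := \sum_v w 0 v *: L (mderiv v (f i)).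
have yE i s : (y i).[s] = (w *m diffmx f (x0 + s *: u)) 0 i.
  rewrite /y horner_sum mxE; apply: eq_bigr => v _.
  by rewrite hornerZ on_line_horner mxE.
have y0 : forall i, y i = 0.
  apply: (@linear_system_unique _ p (L e) (fun i k => \sum_j u 0 j *: L (a i j k))).
  - by rewrite -horner_coef0 on_line_horner scale0r addr0.
  - move=> i.
    have -> : (y i)^`() = \sum_j u 0 j *: \sum_v w 0 v *: L (mderiv v (mderiv j (f i))).
      rewrite /y raddf_sum /=.
      under eq_bigr => v _ do rewrite derivZ on_line_deriv scaler_sumr.
      under [RHS]eq_bigr => j _ do rewrite scaler_sumr.
      rewrite exchange_big; apply: eq_bigr => j _; apply: eq_bigr => v _ /=.
      by rewrite mderiv_comm !scalerA mulrC.
    rewrite mulr_sumr.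
    under [RHS]eq_bigr => k _ do rewrite mulr_suml.
    rewrite exchange_big; apply: eq_bigr => j _ /=.
    rewrite -scalerAr mulr_sumr.
    under [RHS]eq_bigr => k _ do rewrite -scalerAl.
    rewrite -scaler_sumr; congr (_ *: _).
    under eq_bigr => v _ do rewrite -scalerAr -on_lineM hc on_line_sum scaler_sumr.
    rewrite exchange_big; apply: eq_bigr => k _ /=.
    rewrite /y mulr_sumr; apply: eq_bigr => v _.
    by rewrite on_lineM scalerAr.
  - by move=> i; rewrite -horner_coef0 yE scale0r addr0 w0 mxE.
apply/rowP => i; have := yE i 1; rewrite y0 horner0 scale1r /u addrC subrK => <-.
by rewrite mxE.
Qed.

(** The derivative along the lines of direction w vanishes identically. *)
Lemma constant_along (w : 'rV[C]_n) : (forall x, w *m diffmx f x = 0) ->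
  forall x, evmap f (x + w) = evmap f x.
Proof.
move=> h x; apply/rowP => i; rewrite !mxE.
pose y := on_line x w (f i).
have d0 : y^`() = 0.
  apply/eqP; apply: contraT => /closed_nonrootP[s] /negP[]; apply/eqP.
  apply: etrans (_ : (w *m diffmx f (x + s *: w)) 0 i = 0); last by rewrite h mxE.
  rewrite on_line_deriv horner_sum mxE; apply: eq_bigr => v _.
  by rewrite hornerZ on_line_horner mxE.
have yC : y = (y`_0)%:P.
  apply/polyP => -[|k]; rewrite coefC //=.
  have := congr1 (fun q : {poly C} => q`_k) d0; rewrite coef_deriv coef0 => /eqP.
  by rewrite mulrn_eq0 /= => /eqP.
have e1 := on_line_horner x w (f i) 1; have e0 := on_line_horner x w (f i) 0.
rewrite scale1r in e1; rewrite scale0r addr0 in e0.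
by rewrite -e1 -e0 -/y yC !hornerC.
Qed.

(** The kernel of a generic differential is contained in all the others, so f only
    depends on the argument modulo that kernel. Its codimension is p because the
    differential at x1 has rank p. *)
Lemma linear_factorization e a x1 : gradient_closed e a -> e != 0 ->
  (forall w : 'cV[C]_p, diffmx f x1 *m w = 0 -> w = 0) ->
  exists (Pm : 'M[C]_(n, p)) (Sm : 'M[C]_(p, n)), Sm *m Pm = 1%:M /\
    forall x, evmap f x = evmap f (x *m Pm *m Sm).
Proof.
move=> hc /meval_nonzero[v hv] inj; pose x0 : 'rV[C]_n := \row_j v j.
have e0 : pev e x0 != 0 by rewrite pev_row.
pose Pm := diffmx f x0.
have /row_fullP[Sm SP] : row_full Pm.
  have r1 := injective_rank inj.
  rewrite -col_leq_rank -[leqLHS]r1 -(@leq_sub2lE n) ?rank_leq_row // -!mxrank_ker.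
  apply: mxrankS; apply/sub_kermxP/row_matrixP => i.
  rewrite row_mul row0; apply: (kernel_constant hc e0).
  by rewrite -row_mul mulmx_ker row0.
exists Pm, Sm; split=> // x.
have w0 : (x - x *m Pm *m Sm) *m diffmx f x0 = 0.
  by rewrite mulmxBl -!mulmxA SP mulmx1 subrr.
by rewrite -[in LHS](subrK (x *m Pm *m Sm) x) addrC (constant_along (kernel_constant hc e0 w0)).
Qed.

(** Composition with the linear map of matrix Sm, on the level of polynomials. *)
Lemma substitute_linear (Sm : 'M[C]_(p, n)) : exists g : 'I_p -> P p,
  forall y, evmap g y = evmap f (y *m Sm).
Proof.
exists (fun i => mmap (@mpolyC p C) (fun j => \sum_k mpolyC p (Sm k j) * mpolyX C (mnm1 k)) (f i)).
move=> y; apply/rowP => i; rewrite !mxE /pev meval_mmap; apply: meval_eq => j.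
rewrite mxE [LHS]rmorph_sum; apply: eq_bigr => k _.
by apply: etrans (mevalM _ _ _) _; rewrite mevalC mevalXU mulrC.
Qed.
End LinearFactorization.

Section Attained.
Variable R : realType.
Local Notation C := (complex R).
Local Notation nC := (@ComplexField.Normc.normc R).
Local Notation P m := (mpoly.mpoly m C).

(** Compare f at x with f at a point close to x on the j-th axis through x. *)
Lemma derivative_bounded n p (f : 'I_p -> P n) c (K r : R) x i j : vn (evmap f x - c) < r ->
  (forall y, vn (evmap f y - c) < r -> vn (evmap f y - evmap f x) <= K * vn (y - x)) ->
  nC (pev (mderiv j (f i)) x) <= K + 1.
Proof.
move=> hx hL; have [rho rho0 hd] := strict_diff f x (ltr01 : 0 < 1 :> R).
have r' : 0 < r - vn (evmap f x - c) by rewrite subr_gt0.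
have [d d0 hn] := near_evmap f x r'.
pose s := Num.min (rho / 2) (d / 2).
have s0 : 0 < s by rewrite lt_min !divr_gt0 ?ltr0n.
have half (a : R) : 0 < a -> a / 2 < a by move=> a0; rewrite ltr_pdivrMr ?ltr0n // ltr_pMr // ltr1n.
have srho : s < rho by rewrite gt_min half.
have sd : s < d by rewrite gt_min (half d) ?orbT.
pose y := x + real_complex R s *: delta_mx 0 j.
have yx : y - x = real_complex R s *: delta_mx 0 j by rewrite /y addrC addKr.
have vs : vn (y - x) = s by rewrite yx vn_delta nC_real gtr0_norm.
have h1 : vn (evmap f y - c) < r.
  apply: le_lt_trans (vn_tri _ (evmap f x) _) _; rewrite -ltrBrDr; apply: hn; by rewrite vs.
have := hd x y; rewrite subrr vn0 vs => /(_ rho0 srho); rewrite mul1r => h2.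
have h3 : vn ((y - x) *m diffmx f x) <= (K + 1) * s.
  have -> : (y - x) *m diffmx f x =
     (evmap f y - evmap f x) - (evmap f y - evmap f x - (y - x) *m diffmx f x).
    by rewrite opprB [RHS]addrC subrK.
  apply: le_trans (vnB _ _) _; rewrite mulrDl mul1r; apply: lerD => //.
  by rewrite -vs; apply: hL.
have := le_trans (nC_le_vn _ i) h3.
rewrite yx -scalemxAl mxE nCM nC_real gtr0_norm // mulrC ler_pM2r //.
by rewrite -rowE !mxE.
Qed.

(** A relation between the components of f vanishes on a ball, hence is zero. *)
Lemma ball_in_range_independent n p (f : 'I_p -> P n) c (r : R) : 0 < r ->
  (forall t, vn (t - c) < r -> exists x, evmap f x = t) -> independent f.
Proof.
move=> r0 hr U eU; apply/eqP; apply: contraT => U0.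
have [t [/hr[x ex] Ut]] := nonvanishing_near c U0 r0.
move: Ut; rewrite -ex /pev.
have -> : meval (fun j => evmap f x 0 j) U = meval (fun j => x 0 j) (mmap (@mpolyC n C) f U).
  by rewrite meval_mmap; apply: meval_eq => j; rewrite mxE.
by rewrite eU meval0 eqxx.
Qed.

(** The Zariski closure of the image is the whole space. *)
Lemma independent_generic n p (f : 'I_p -> P n) : independent f ->
  exists2 q : P p, q != 0 & forall t, pev q t != 0 -> exists x, evmap f x = t.
Proof.
move=> hf; have [Q Q0 hQ] := image_contains_open_of_closure f; exists Q => [|t Qt].
  by apply: contraNneq Q0 => ->; rewrite rmorph0.
have [U /hf ->|//|x hx] := hQ (fun i => t 0 i); first by rewrite meval0.
exists (\row_j x j); apply/evmapP => i; by rewrite pev_row.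
Qed.

(** Otherwise (f, h) would be dominant and take values with first component close
    to c and last component arbitrarily large. *)
Lemma bounded_relation n p (f : 'I_p -> P n) h c (B r : R) : 0 < r ->
  (forall x, vn (evmap f x - c) < r -> nC (pev h x) <= B) ->
  exists2 U : P p.+1, U != 0 &
    mmap (@mpolyC n C) (fun i : 'I_p.+1 => extend f h i) U = 0.
Proof.
move=> r0 hB; apply: contrapT => nU.
have iF : independent (fun i : 'I_p.+1 => extend f h i).
  move=> U eU; apply/eqP; apply: contraT => U0; case: nU; by exists U.
have [q q0 hq] := independent_generic iF.
pose t0 : 'rV[C]_p.+1 := \row_(i < p.+1) extend (c 0) (real_complex R (`|B| + 2)) i.
pose d := Num.min r 1; have d0 : 0 < d by rewrite lt_min r0 ltr01.
have [t [ht /hq[x ex]]] := nonvanishing_near t0 q0 d0.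
have [tr t1] : vn (t - t0) < r /\ vn (t - t0) < 1 by move: ht; rewrite lt_min => /andP[].
have ti (i : 'I_p.+1) : t 0 i = pev (extend f h i) x by rewrite -ex mxE.
have hx : vn (evmap f x - c) < r.
  apply: le_lt_trans tr; rewrite /vn [leRHS]big_ord_recr /= ler_wpDr ?nC_ge0 //.
  apply: ler_sum => i _; rewrite !mxE ti /=.
  by rewrite !(extend_ord _ _ i).
have := le_lt_trans (nC_le_vn _ ord_max) t1.
rewrite !mxE ti /= !extend_last => h1.
have h2 := hB x hx.
have := nC_sub_ge (real_complex R (`|B| + 2)) (pev h x).
rewrite nCBC nC_real ger0_norm ?addr_ge0 // => h3.
have := ler_norm B; lra.
Qed.

(** The bound for the derivatives makes them algebraic over f; the factorization
    follows by the constancy of the kernel of the differentials, which has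
    codimension p because the differentials over c are surjective. *)
Lemma lipschitz_trivial_factorization n p (f : 'I_p -> P n) c :
  lipschitz_trivial_values (evmap f) c -> range (evmap f) c ->
  exists (Pm : 'M[C]_(n, p)) (Sm : 'M[C]_(p, n)) (g : 'I_p -> P p),
  [/\ Sm *m Pm = 1%:M, independent g & forall x, evmap f x = evmap g (x *m Pm)].
Proof.
move=> Lc [x1 _ e1]; have [K [r [K0 r0 h1 h2]]] := lipschitz_trivial_bounds Lc.
have hr t : vn (t - c) < r -> exists x, evmap f x = t.
  by move=> ht; have [|x' ex' _] := h1 x1 t _ ht; [rewrite e1 subrr vn0|exists x'].
have iF := ball_in_range_independent r0 hr.
have [e [a [e0 hc]]] : exists e a, e != 0 /\ gradient_closed f e a.
  apply: common_denominator => i j.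
  have [U U0 eU] := bounded_relation r0 (fun x hx => derivative_bounded i j hx
    (fun y hy => h2 y x hy hx)).
  have [A hA] := annihilator_of_relation iF U0 eU.
  by have [e [b h]] := gradient_in_span iF hA; exists e, b.
have [r' r'0 lo] := lipschitz_trivial_linearly_open Lc.
have [|Pm [Sm [SP fP]]] := linear_factorization (x1 := x1) hc e0.
  by move=> w; apply: linearly_open_injective; apply: lo; rewrite e1 subrr vn0.
have [g hg] := substitute_linear f Sm; exists Pm, Sm, g.
have fg x : evmap f x = evmap g (x *m Pm) by rewrite hg fP.
split=> //; apply: (ball_in_range_independent r0) => t /hr[x ex].
by exists (x *m Pm); rewrite -fg.
Qed.

(** A polynomial that vanishes on the image is a relation. *)
Lemma dominantP n p (f : 'I_p -> P n) : dominant f <-> independent f.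
Proof.
have E U x : pev U (evmap f x) = pev (mmap (@mpolyC n C) f U) x.
  by rewrite /pev meval_mmap; apply: meval_eq => j; rewrite mxE.
split=> [df U eU|iF].
  apply/eqP; apply: contraT => /meval_nonzero[v]; rewrite -pev_row => /negP[].
  have : zariski_closure (range (polymap f)) (\row_j v j) by rewrite df.
  move=> h; apply/eqP; apply: h => _ [x _ <-].
  by rewrite -[LHS]/(pev U (evmap f x)) E eU /pev meval0.
apply/seteqP; split=> // c _ q hq.
have -> : q = 0.
  apply: iF; apply/eqP; apply: contraT => /meval_nonzero[v]; rewrite -pev_row -E.
  by rewrite [pev _ _]hq ?eqxx //; exists (\row_j v j).
exact: meval0.
Qed.

(** * Trivial values of a composite *)

Section Composite.
Variables (n p : nat) (f : 'I_p -> P n) (g : 'I_p -> P p).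
Variables (Pm : 'M[C]_(n, p)) (Sm : 'M[C]_(p, n)).
Hypotheses (ig : independent g) (SP : Sm *m Pm = 1%:M).
Hypothesis fg : forall x, evmap f x = evmap g (x *m Pm).

(** An empty fibre would leave a whole ball outside the image, which contains the
    complement of a hypersurface. *)
Lemma good_value_attained c F : good_value g c -> finite_fibre_at g c F ->
  range (evmap f) c.
Proof.
move=> gc [hF hnear].
have [x /hF gx] : exists x, x \in F.
  case: F hF hnear => [|x F] hF hnear; last by exists x; apply: mem_head.
  have [d d0 hd] := hnear 1 ltr01.
  have [q q0 hq] := independent_generic ig.
  have [t [ht /hq[x ex]]] := nonvanishing_near c q0 d0.
  by have [y] := hd t ht x ex.
by exists (x *m Sm) => //; rewrite fg -mulmxA SP mulmx1.
Qed.

(** The sheets over a good value of g give both trivializations, and conversely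
    either trivialization makes the value good. *)
Theorem trivial_values_of_composite : exists Q : P p, [/\ Q != 0,
  lipschitz_trivial_values (evmap f) = [set c | pev Q c != 0],
  smooth_trivial_values (evmap g) = [set c | pev Q c != 0] &
  lipschitz_trivial_values (evmap f) `<=` range (evmap f)].
Proof.
have [Q [Q0 hQ hF]] := good_values_hypersurface ig; exists Q.
have L : lipschitz_trivial_values (evmap f) = [set c | pev Q c != 0].
  apply/seteqP; split=> c /=; first by move=> /(lipschitz_trivial_good ig SP fg)/hQ.
  move=> /hQ gc; have [F FF] := hF c gc.
  have [s [b [rho [delta [kappa [M S]]]]]] := sheets_exist gc FF.
  exact: (sheets_lipschitz_trivial SP fg S).
split=> //.
  apply/seteqP; split=> c /=; first by move=> /(smooth_trivial_good ig)/hQ.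
  move=> /hQ gc; have [F FF] := hF c gc.
  have [s [b [rho [delta [kappa [M S]]]]]] := sheets_exist gc FF.
  exact: (sheets_smooth_trivial S).
rewrite L => c /hQ gc; have [F FF] := hF c gc; exact: good_value_attained gc FF.
Qed.
End Composite.

(** At a point over such a value small displacements of the value are realized by
    comparable ones of the point, so that the differential is surjective. *)
Lemma lipschitz_trivial_regular n p (f : 'I_p -> P n) :
  lipschitz_trivial_values (evmap f) `<=` regular_values f.
Proof.
move=> c Lc [x hx ex]; have [r r0 lo] := lipschitz_trivial_linearly_open Lc.
have lox : linearly_open_at f x by apply: lo; rewrite -ex subrr vn0.
have := injective_rank (fun w => linearly_open_injective (w := w) lox) => rk.
move: hx; rewrite /critical_points /=.
have -> : jacobian_mx f x = (diffmx f x)^T by apply/matrixP => i j; rewrite !mxE.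
by rewrite mxrank_tr rk ltnn.
Qed.

(** The k-th row of the section is a preimage of the k-th basis vector. *)
Lemma linear_surjection_section n p (pi : {linear 'rV[C]_n -> 'rV[C]_p}) :
  range pi = setT -> exists Sm : 'M[C]_(p, n), Sm *m lin1_mx pi = 1%:M.
Proof.
move=> sur.
have H (k : 'I_p) : exists x, pi x = delta_mx 0 k.
  have : range pi (delta_mx 0 k) by rewrite sur.
  by move=> [x _ <-]; exists x.
have [s hs] := choice H.
exists (\matrix_k s k); apply/row_matrixP => k.
by rewrite row_mul rowK mul_rV_lin1 hs row1.
Qed.
End Attained.

Theorem corollary4p1 (R : realType) (n p : nat)
    (f : 'I_p -> mpoly.mpoly n R[i]) :
  [/\ attains_lipschitz_trivial_value (polymap f) <->
        (exists (g : 'I_p -> mpoly.mpoly p R[i])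
                (pi : {linear 'rV[R[i]]_n -> 'rV[R[i]]_p}),
           [/\ dominant g, range pi = setT &
               polymap f = polymap g \o pi]),
      forall (g : 'I_p -> mpoly.mpoly p R[i])
             (pi : {linear 'rV[R[i]]_n -> 'rV[R[i]]_p}),
        dominant g -> range pi = setT -> polymap f = polymap g \o pi ->
        lipschitz_trivial_values (polymap f) = ~` Bif (polymap g),
      attains_lipschitz_trivial_value (polymap f) ->
        empty_or_hypersurface_complement
          (regular_values f `&` lipschitz_trivial_values (polymap f)) &
      empty_or_hypersurface_complement
        (regular_values f `&` lipschitz_trivial_values (polymap f)
           `&` range (polymap f))].
Proof.
have composite (g : 'I_p -> mpoly.mpoly p R[i]) (pi : {linear 'rV[R[i]]_n -> 'rV[R[i]]_p}) :
    dominant g -> range pi = setT -> polymap f = polymap g \o pi ->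
    exists Q : mpoly.mpoly p R[i], [/\ Q != 0,
      lipschitz_trivial_values (polymap f) = [set c | mpoly_at Q c != 0],
      smooth_trivial_values (polymap g) = [set c | mpoly_at Q c != 0] &
      lipschitz_trivial_values (polymap f) `<=` range (polymap f)].
  move=> /dominantP ig /linear_surjection_section[Sm SP] fg.
  apply: (trivial_values_of_composite ig SP) => x.
  by rewrite mul_rV_lin1 -[LHS]/(polymap f x) fg.
have factor : attains_lipschitz_trivial_value (polymap f) ->
    exists (g : 'I_p -> mpoly.mpoly p R[i]) (pi : {linear 'rV[R[i]]_n -> 'rV[R[i]]_p}),
    [/\ dominant g, range pi = setT & polymap f = polymap g \o pi].
  move=> [c Lc rc]; have [Pm [Sm [g [SP ig fg]]]] := lipschitz_trivial_factorization Lc rc.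
  exists g, (mulmxr Pm : {linear 'rV[R[i]]_n -> 'rV[R[i]]_p}); split.
  - exact/dominantP.
  - by apply/seteqP; split=> // y _; exists (y *m Sm) => //=; rewrite -mulmxA SP mulmx1.
  - by apply/funext => x; apply: fg.
have complement : attains_lipschitz_trivial_value (polymap f) ->
    exists Q : mpoly.mpoly p R[i], [/\ Q != 0,
      regular_values f `&` lipschitz_trivial_values (polymap f) = ~` [set c | mpoly_at Q c = 0] &
      lipschitz_trivial_values (polymap f) `<=` range (polymap f)].
  move=> /factor[g [pi [dg sur fg]]]; have [Q [Q0 L _ Lr]] := composite g pi dg sur fg.
  exists Q; split=> //; rewrite setIidr; last exact: lipschitz_trivial_regular.
  by rewrite L; apply/seteqP; split=> c /= /eqP.
split.
- split=> // -[g [pi [dg sur fg]]].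
  have [Q [Q0 L _ Lr]] := composite g pi dg sur fg.
  have [v hv] := meval_nonzero Q0; rewrite -pev_row in hv.
  have Lv : lipschitz_trivial_values (polymap f) (\row_j v j) by rewrite L.
  by exists (\row_j v j) => //; apply: Lr.
- move=> g pi dg sur fg; have [Q [_ L S _]] := composite g pi dg sur fg.
  by rewrite /Bif setCK L S.
- move=> /complement[Q [Q0 e _]]; right; exists [set c | mpoly_at Q c = 0] => //.
  by exists Q.
- have [/complement[Q [Q0 e Lr]]|na] := pselect (attains_lipschitz_trivial_value (polymap f)).
    right; exists [set c | mpoly_at Q c = 0]; first by exists Q.
    by rewrite setIidl // => c [_ /Lr].
  left; apply/seteqP; split=> // c [[_ Lc] rc]; by case: na; exists c.
Qed.
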